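(* Let $n\ge3$ and $d\ge3$. Then the set \[ \{ f\in\mathrm{End}_d^n : f^{k}(\mathcal{C}_f)\subseteq f(\mathcal{C}_f) \text{ for some } k\ge2\} \] is contained in a proper Zariski closed subvariety of $\mathrm{End}_d^n$.
   Context: Work over an algebraically closed field $\mathbb{F}$ of characteristic $0$. $\mathrm{End}_d^n$ is the set of morphisms $f:\mathbb{P}^n\to\mathbb{P}^n$ of algebraic degree $d$ (i.e. $f=[f_0:\dots:f_n]$, $f_i$ homogeneous of degree $d$ with no common zero), a Zariski open subset of $\mathbb{P}^N$, $N=(n+1)\binom{d+n}{n}-1$. The critical locus is $\mathcal{C}_f=\{\det(\partial f_i/\partial x_j)=0\}$. *)

(* Defs.v *)
From HB Require Import structures.
From mathcomp Require Import all_boot all_order all_algebra.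
From mathcomp Require Import mpoly.
Set Implicit Arguments. Unset Strict Implicit. Unset Printing Implicit Defensive.
Import GRing.Theory.
Local Open Scope ring_scope.

Section Defs.
Variables (F : fieldType) (n d : nat).

(* A point of A^{n+1}; points of P^n are nonzero vectors up to scaling. *)
Definition nonzero_vec (x : 'I_n.+1 -> F) : Prop := exists j, x j != 0.

Definition proj_eq (x y : 'I_n.+1 -> F) : Prop :=
  exists l : F, l != 0 /\ forall j, y j = l * x j.

Definition isEnd (f : 'I_n.+1 -> {mpoly F[n.+1]}) : Prop :=
  (forall i, f i \is d.-homog) /\
  (forall x : 'I_n.+1 -> F, (forall i, (f i).@[x] = 0) -> forall j, x j = 0).

Definition fapply (f : 'I_n.+1 -> {mpoly F[n.+1]}) (x : 'I_n.+1 -> F)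
  : 'I_n.+1 -> F := fun i => (f i).@[x].

Definition jacdet (f : 'I_n.+1 -> {mpoly F[n.+1]}) (x : 'I_n.+1 -> F) : F :=
  \det (\matrix_(i < n.+1, j < n.+1) ((f i)^`M(j)).@[x]).

Definition in_crit (f : 'I_n.+1 -> {mpoly F[n.+1]}) (x : 'I_n.+1 -> F) : Prop :=
  nonzero_vec x /\ jacdet f x = 0.

Definition iter_crit_sub (f : 'I_n.+1 -> {mpoly F[n.+1]}) (k : nat) : Prop :=
  forall x, in_crit f x ->
    exists y, in_crit f y /\ proj_eq (fapply f y) (iter k (fapply f) x).

(* Coordinates of P^N: pairs (i, m) with m a monomial of degree exactly d. *)
Definition monD := {m : 'X_{1..n.+1 < d.+1} | mdeg m == d}.
Definition coefIdx := ('I_n.+1 * monD)%type.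
Definition Ncoef := #|{: coefIdx}|.

Definition coefvec (f : 'I_n.+1 -> {mpoly F[n.+1]}) : 'I_Ncoef -> F :=
  fun k => let im := @enum_val _ (mem {: coefIdx}) k in
           (f im.1)@_(val (val im.2)).

End Defs.
Arguments coefvec [F n] d f _.

(* Main.v *)
(* Let [J] be the Jacobian determinant of [f] and [C] the hypersurface [J = 0].
   For generic [f], [C] has no singular point on the plane [x_3 = ... = x_n = 0], so
   it is irreducible and normal; [f] restricted to [C] is birational onto its
   image; and [f] has a fold at the general point of [C].  If [f^k (C)] lies in
   [f (C)], then either some [f^i] with [0 < i < k] maps [C] into itself, and
   [kappa = f^i], or composing [f^k] with the inverse of [f] on [f (C)] gives a
   rational map [kappa : C --> C] with [f o kappa = f^k].  By normality the
   monomials of degree [d] in [kappa] are restrictions of forms.  Since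
   [deg C = (n + 1)(d - 1) > n + 1], the canonical sheaf of [C] is positive, and
   comparing degrees in its pullback shows that the differential of [kappa] along
   [C] is degenerate.  Hence so are those of [f^k] and of [f], against the fold
   condition.  The smoothness condition is generic by a count of parameters; the
   other two are open and hold for an explicit map. *)

Require Import Defs.
From HB Require Import structures.
From Stdlib Require Import Classical ClassicalEpsilon.
From mathcomp Require Import all_boot all_order all_algebra.
From mathcomp Require Import perm.
From mathcomp Require Import mpoly zify ring.
Set Implicit Arguments. Unset Strict Implicit. Unset Printing Implicit Defensive.
Import GRing.Theory.
Local Open Scope ring_scope.

(** * Ideals and algebraic dependence *)

(** For [n >= 4] the differential drops rank by two on a nonempty locus of codimension at most four,
    and [C] is singular there, so smoothness can only be asked in low codimension. Missing one plane
    is the right condition: the singular locus then has codimension at least three in projective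
    space, which for a hypersurface means normality, and on a plane a count of parameters is enough
    to establish it. Everything takes place on the affine cone: [J] generates a prime ideal, [K] is
    the fraction field of the quotient and [phi] the map to it. Dimension theory is replaced by one
    count of monomials, [dependent_mod]. Since [f o kappa = f^k], the pullback of O(1) by [kappa] is
    known only through its [d]-th power, which is O(d^k); hence degrees are compared after raising
    to the power [d]. Birationality onto the image is certified at one point: over it, the critical
    cone of the explicit map has exactly [d] reduced points, the least that scaling by [d]-th roots
    of unity allows. *)

Definition is_ideal (R : comNzRingType) (I : R -> Prop) :=
  [/\ I 0, (forall a b, I a -> I b -> I (a + b)) & (forall a b, I b -> I (a * b))].

Section Ideals.
Variables (R : comNzRingType) (I : R -> Prop) (II : is_ideal I).

Lemma ideal0 : I 0. Proof. by case: II. Qed.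

Lemma idealD a b : I a -> I b -> I (a + b). Proof. by case: II => _ h _; apply: h. Qed.

Lemma idealMl a b : I b -> I (a * b). Proof. by case: II => _ _; apply. Qed.

Lemma idealMr a b : I a -> I (a * b). Proof. by rewrite mulrC; apply: idealMl. Qed.

Lemma idealN a : I a -> I (- a). Proof. by rewrite -mulN1r; apply: idealMl. Qed.

Lemma idealB a b : I a -> I b -> I (a - b).
Proof. by move=> Ia Ib; apply: idealD => //; apply: idealN. Qed.

Lemma ideal_sum (T : Type) (r : seq T) (P : pred T) (G : T -> R) :
  (forall i, P i -> I (G i)) -> I (\sum_(i <- r | P i) G i).
Proof. by move=> h; elim/big_ind: _ => //; [exact: ideal0 | exact: idealD]. Qed.

Lemma ideal_congr a b : I (a - b) -> I b -> I a.
Proof. by move=> h1 h2; rewrite -(subrK b a); apply: idealD. Qed.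

End Ideals.

Notation cmp f := (mmap (@mpolyC _ _) f).

Section Evaluation.
Variables (n : nat) (R S S' : comNzRingType).

Lemma rmorph_mmap (f : {rmorphism R -> S}) (h : 'I_n -> S) (phi : {rmorphism S -> S'}) p :
  phi (mmap f h p) = mmap (phi \o f) (phi \o h) p.
Proof.
rewrite /mmap rmorph_sum; apply: eq_bigr => m _; rewrite rmorphM /=; congr (_ * _).
by rewrite /mmap1 rmorph_prod; apply: eq_bigr => i _; rewrite rmorphXn.
Qed.

Lemma mmap_ext (f g : R -> S) (h k : 'I_n -> S) p :
  f =1 g -> h =1 k -> mmap f h p = mmap g k p.
Proof.
move=> fg hk; rewrite /mmap; apply: eq_bigr => m _; rewrite fg; congr (_ * _).
by apply: mmap1_eq.
Qed.

Lemma mmap_id (p : {mpoly R[n]}) : cmp (fun i => 'X_i) p = p.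
Proof.
rewrite {2}[p]mpolyE /mmap; apply: eq_bigr => m _.
by rewrite mul_mpolyC; congr (_ *: _); rewrite /mmap1 -mpolyXE_id.
Qed.

End Evaluation.

Section EvaluationComp.
Variables (n : nat) (R S : comNzRingType).

Lemma mmap_mmap m (f : {rmorphism R -> S}) (k : 'I_m -> S) (h : 'I_n -> {mpoly R[m]}) p :
  mmap f k (cmp h p) = mmap f (fun i => mmap f k (h i)) p.
Proof.
rewrite rmorph_mmap; apply: mmap_ext => // c /=; exact: mmapC.
Qed.

Lemma mmap_XU (f : {rmorphism R -> S}) (h : 'I_n -> S) i : mmap f h 'X_i = h i.
Proof. by rewrite mmapX mmap1U. Qed.

Lemma rmorph_mpolyP (phi psi : {rmorphism {mpoly R[n]} -> S}) :
  (forall c, phi c%:MP = psi c%:MP) -> (forall i, phi 'X_i = psi 'X_i) -> phi =1 psi.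
Proof.
move=> hC hX p; rewrite -[p]mmap_id !rmorph_mmap; exact: mmap_ext.
Qed.

End EvaluationComp.

Section Multinomials.
Variable n : nat.

Lemma mnm_split (m : 'X_{1..n}) M : (M <= mdeg m)%N ->
  exists m1 m2, m = (m1 + m2)%MM /\ mdeg m2 = M.
Proof.
move: {2}(mdeg m - M)%N (erefl (mdeg m - M)%N) => k; elim: k m => [|k IH] m hk hM.
  exists 0%MM, m; split; first by rewrite add0m.
  by apply/eqP; rewrite eqn_leq hM andbT -subn_eq0 hk.
have [i hi] : exists i, (0 < m i)%N.
  apply/existsP; apply: contraT; rewrite negb_exists => /forallP h.
  have : mdeg m = 0%N by rewrite mdegE big1 // => i _; apply/eqP; move: (h i); rewrite -eqn0Ngt.
  lia.
have em : m = ((m - U_(i)) + U_(i))%MM by rewrite submK // lep1mP -lt0n.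
have dm : mdeg m = (mdeg (m - U_(i))%MM).+1 by rewrite {1}em mdegD mdeg1 addn1.
have [||m1 [m2 [e d2]]] := IH (m - U_(i))%MM; try lia.
exists (m1 + U_(i))%MM, m2; split=> //.
by rewrite {1}em e -!addmA; congr (_ + _)%MM; rewrite addmC.
Qed.

End Multinomials.

Lemma msizeM_leS n (R : idomainType) (p q : {mpoly R[n]}) a b :
  (msize p <= a.+1 -> msize q <= b.+1 -> msize (p * q) <= (a + b).+1)%N.
Proof.
have [->|np] := eqVneq p 0; first by rewrite mul0r msize0.
have [->|nq] := eqVneq q 0; first by rewrite mulr0 msize0.
by rewrite msizeM //; lia.
Qed.

Section Dependence.
Variables (F : fieldType) (n : nat) (I : {mpoly F[n]} -> Prop) (II : is_ideal I).
Variables (K : nat) (y : 'I_K -> {mpoly F[n]}) (M : nat).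
Hypothesis HM : forall m : 'X_{1..n}, mdeg m = M -> exists B : 'I_K -> {mpoly F[n]},
  (forall j, msize (B j) <= M)%N /\ I ('X_[m] - \sum_j B j * y j).

Let bas T (x : 'X_{1..n < M} * {ffun 'I_K -> 'I_T.+1}) : {mpoly F[n]} :=
  'X_[x.1] * \prod_j y j ^+ x.2 j.

Let spn T p := exists c : 'X_{1..n < M} * {ffun 'I_K -> 'I_T.+1} -> F,
  I (p - \sum_x c x *: bas x).

Let spn_I T p : I p -> spn T p.
Proof. by move=> h; exists (fun=> 0); rewrite big1 ?subr0 // => x _; rewrite scale0r. Qed.

Let spnD T p q : spn T p -> spn T q -> spn T (p + q).
Proof.
move=> [c hc] [c' hc']; exists (fun x => c x + c' x).
rewrite (eq_bigr (fun x => c x *: bas x + c' x *: bas x)); last by move=> x _; rewrite scalerDl.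
by rewrite big_split opprD addrACA; apply: idealD.
Qed.

Let spn_sum T (J : Type) (r : seq J) (G : J -> {mpoly F[n]}) :
  (forall j, spn T (G j)) -> spn T (\sum_(j <- r) G j).
Proof.
move=> h; elim/big_ind: _ => //; [exact: spn_I (ideal0 II) | exact: spnD].
Qed.

Let spn_bas T c (m : 'X_{1..n}) (a : 'I_K -> nat) :
  (mdeg m < M)%N -> (forall j, a j <= T)%N -> spn T (c *: ('X_[m] * \prod_j y j ^+ a j)).
Proof.
move=> hm ha; pose x0 : 'X_{1..n < M} * {ffun 'I_K -> 'I_T.+1} := (BMultinom hm, [ffun j => inord (a j)]).
exists (fun x => if x == x0 then c else 0).
have -> : \sum_x (if x == x0 then c else 0) *: bas x = c *: bas x0.
  transitivity (\sum_(x | x == x0) c *: bas x); last by rewrite big_pred1_eq.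
  by rewrite [RHS]big_mkcond; apply: eq_bigr => x _; case: ifP; rewrite ?scale0r.
have -> : bas x0 = 'X_[m] * \prod_j y j ^+ a j.
  rewrite /bas /=; congr (_ * _); apply: eq_bigr => j _.
  by rewrite ffunE inordK // ltnS.
by rewrite subrr; exact: ideal0.
Qed.

(** Each use of [HM] on a factor of degree [M] lowers the degree of the cofactor by at least one and
    raises a single exponent by one, so exponent plus degree never exceeds [T0]. *)
Let span T0 T p (a : 'I_K -> nat) : (msize p <= T.+1)%N -> (forall j, a j + T <= T0)%N ->
  spn T0 (p * \prod_j y j ^+ a j).
Proof.
elim: T p a => [|T IH] p a hp ha.
  rewrite [p]mpolyE mulr_suml; apply: big_ind => //; [exact: spn_I (ideal0 II)|exact: spnD|move=> m _].
  rewrite -scalerAl.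
  have [->|nz] := eqVneq p@_m 0; first by rewrite scale0r; exact: spn_I (ideal0 II).
  have hm : mdeg m = 0%N.
    have := msize_mdeg_lt (etrans (mcoeff_msupp p m) nz); lia.
  have [hM|hM] := ltnP (mdeg m) M; first by apply: spn_bas => // j; have := ha j; lia.
  have [|B [hB hI]] := HM (m := m); first lia.
  apply: spn_I; rewrite scalerAl; apply: idealMr => //; rewrite -mul_mpolyC; apply: idealMl => //.
  apply: (ideal_congr II hI); rewrite big1; first exact: ideal0 II; move=> j _.
  have/eqP : msize (B j) = 0%N by have := hB j; lia.
  by rewrite msize_poly_eq0 => /eqP->; rewrite mul0r.
rewrite [p]mpolyE mulr_suml; apply: big_ind => //; [exact: spn_I (ideal0 II)|exact: spnD|move=> m _].
rewrite -scalerAl.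
have [->|nz] := eqVneq p@_m 0; first by rewrite scale0r; exact: spn_I (ideal0 II).
have hm := leq_trans (msize_mdeg_lt (etrans (mcoeff_msupp p m) nz)) hp.
have [hM|hM] := ltnP (mdeg m) M; first by apply: spn_bas => // j; have := ha j; lia.
have [m1 [m2 [em d2]]] := mnm_split hM.
have [B [hB hI]] := HM d2.
set P := \prod_j _; rewrite em mpolyXD.
have -> : p@_(m1 + m2) *: ('X_[m1] * 'X_[m2] * P) =
  (p@_(m1 + m2))%:MP * 'X_[m1] * P * ('X_[m2] - \sum_j B j * y j) +
  \sum_j ((p@_(m1 + m2))%:MP * ('X_[m1] * B j)) * \prod_i y i ^+ (a i + (i == j)).
  rewrite -mul_mpolyC.
  rewrite [X in _ = _ + X](eq_bigr (fun j => (p@_(m1 + m2))%:MP * 'X_[m1] * P * (B j * y j))).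
    by rewrite -mulr_sumr; ring.
  move=> j _; have -> : \prod_i y i ^+ (a i + (i == j)) = P * y j.
    rewrite (eq_bigr (fun i => y i ^+ a i * y i ^+ (i == j))); last by move=> i _; rewrite exprD.
    rewrite big_split /=; congr (_ * _); rewrite (bigD1 j) //= eqxx expr1 big1 ?mulr1 //.
    by move=> i /negPf ->.
  ring.
apply: spnD; first by apply: spn_I; apply: idealMl.
apply: spn_sum => j; apply: IH => [|i]; last by have := ha i; case: eqP => /= _; lia.
rewrite mul_mpolyC; apply: leq_trans (msizeZ_le _ _) _.
have [->|nB] := eqVneq (B j) 0; first by rewrite mulr0 msize0.
have nX : 'X_[m1] != 0 :> {mpoly F[n]} by rewrite -msize_poly_eq0 msizeX.
have hM0 : (0 < M)%N.
  by apply: leq_trans (hB j); rewrite lt0n msize_poly_eq0.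
rewrite em mdegD d2 in hm; apply: (@leq_trans (mdeg m1 + M.-1).+1); last lia.
by apply: msizeM_leS; rewrite ?msizeX ?prednK.
Qed.

(** Modulo [I] the ring is spanned over the polynomials in the [y j] by the finitely many monomials
    of degree below [M]. Products of the [p i] with exponents at most [T] have degree linear in [T],
    so they live in a space of dimension O(T^K), while there are [(T+1)^N] of them. This is the only
    source of dimension bounds below. *)
Lemma dependent_mod N (p : 'I_N -> {mpoly F[n]}) : (K < N)%N ->
  exists Phi : {mpoly F[N]}, Phi != 0 /\ I (cmp p Phi).
Proof.
move=> KN; pose e := \max_i msize (p i).
have he i : (msize (p i) <= e.+1)%N by apply: leqW; exact: leq_bigmax.
(* The choice of [T] gives [C (T0+1)^K <= T (T+1)^K < (T+1)^(K+1) <= (T+1)^N]. *)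
pose C := #|{: 'X_{1..n < M}}|; pose T := (C * (N * e).+1 ^ K)%N; pose T0 := (N * (e * T))%N.
pose PP (b : {ffun 'I_N -> 'I_T.+1}) := \prod_i p i ^+ b i.
have sX q k : (msize q <= e.+1)%N -> (msize (q ^+ k : {mpoly F[n]}) <= (e * k).+1)%N.
  move=> hq; elim: k => [|k IH]; first by rewrite expr0 msize1.
  by rewrite exprS mulnS; apply: msizeM_leS.
have hP b : (msize (PP b) <= T0.+1)%N.
  suff : forall (r : seq 'I_N), (msize (\prod_(i <- r) p i ^+ b i)%R <= (size r * (e * T)).+1)%N.
    by move=> h; have := h (index_enum 'I_N); rewrite /PP /T0 [index_enum _]unlock -enumT size_enum_ord.
  elim=> [|i r IH]; first by rewrite big_nil msize1.
  rewrite big_cons /= mulSn; apply: msizeM_leS => //.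
  apply: leq_trans (sX _ _ (he i)) _; rewrite ltnS leq_mul2l; have := ltn_ord (b i).
  by rewrite ltnS => ->; rewrite orbT.
have hs b : spn T0 (PP b).
  have := @span T0 T0 (PP b) (fun=> 0%N) (hP b) (fun _ => leqnn _).
  by rewrite [X in _ * X]big1 ?mulr1 // => j _; rewrite expr0.
have [c hc] := fin_all_exists hs.
pose XX := ('X_{1..n < M} * {ffun 'I_K -> 'I_T0.+1})%type.
pose BB := {ffun 'I_N -> 'I_T.+1}.
pose A : 'M[F]_(#|{: BB}|, #|{: XX}|) := \matrix_(i, j) c (enum_val i) (enum_val j).
have hcard : (#|{: XX}| < #|{: BB}|)%N.
  rewrite /XX /BB card_prod !card_ffun !card_ord -/C.
  have h1 : ((N * (e * T)).+1 ^ K <= ((N * e).+1 * T.+1) ^ K)%N.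
    by case: (K) => // k; rewrite leq_exp2r //; rewrite mulnA; nia.
  rewrite /T0; apply: (@leq_ltn_trans (T * T.+1 ^ K)).
    rewrite /T -mulnA leq_mul2l; apply/orP; right; rewrite -/T.
    by rewrite -expnMn.
  apply: (@leq_trans (T.+1 ^ K.+1)); last by rewrite leq_pexp2l.
  by rewrite expnS ltn_mul2r expn_gt0 ltnSn.
have [v v0 vA] : exists2 v : 'rV[F]_(#|{: BB}|), v != 0 & v *m A = 0.
  exists (nz_row (kermx A)).
    rewrite nz_row_eq0 -mxrank_eq0 mxrank_ker -lt0n subn_gt0.
    exact: leq_ltn_trans (rank_leq_col A) hcard.
  by apply/sub_kermxP; apply: nz_row_sub.
pose mn (b : BB) : 'X_{1..N} := [multinom (b i : nat) | i < N].
have mn_inj : injective mn.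
  move=> b b' /mnmP h; apply/ffunP => i; apply/val_inj; by have := h i; rewrite !mnmE.
pose Phi : {mpoly F[N]} := \sum_(b : BB) v 0 (enum_rank b) *: 'X_[mn b].
exists Phi; split.
  have/rV0Pn [i vi] := v0.
  apply: contraNneq vi => h0; apply/eqP; have := congr1 (mcoeff (mn (enum_val i))) h0.
  rewrite mcoeff0 /Phi raddf_sum (bigD1 (enum_val i)) //= mcoeffZ mcoeffX eqxx mulr1 enum_valK.
  rewrite big1 ?addr0 // => b hb; rewrite mcoeffZ mcoeffX.
  by case: eqP => [/mn_inj h|]; [rewrite h eqxx in hb | rewrite mulr0].
have -> : cmp p Phi = \sum_(b : BB) (v 0 (enum_rank b))%:MP * PP b.
  rewrite /Phi raddf_sum; apply: eq_bigr => b _ /=; rewrite mmapZ mmapX; congr (_ * _).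
  by rewrite /mmap1 /PP; apply: eq_bigr => i _; rewrite mnmE.
have -> : \sum_(b : BB) (v 0 (enum_rank b))%:MP * PP b =
  \sum_(b : BB) (v 0 (enum_rank b))%:MP * (PP b - \sum_x c b x *: bas x).
  apply/eqP; rewrite -subr_eq0 -sumrB; apply/eqP.
  rewrite (eq_bigr (fun b => \sum_x (v 0 (enum_rank b) * c b x) *: bas x)); last first.
    move=> b _; rewrite mulrBr opprB addrC subrK mulr_sumr; apply: eq_bigr => x _.
    by rewrite mul_mpolyC scalerA.
  rewrite exchange_big big1 //= => x _; rewrite -scaler_suml.
  have := congr1 (fun w : 'rV_ _ => w 0 (enum_rank x)) vA; rewrite !mxE => h.
  suff -> : \sum_(b : BB) v 0 (enum_rank b) * c b x = 0 by rewrite scale0r.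
  rewrite -[RHS]h (reindex (@enum_val BB (mem BB))) /=.
    by apply: eq_bigr => i _; rewrite mxE enum_valK enum_rankK.
  by exists enum_rank => b _; rewrite ?enum_valK ?enum_rankK.
by apply: ideal_sum => // b _; apply: idealMl.
Qed.

End Dependence.

(** * Unique factorization *)

Definition dvdr (R : comNzRingType) (a b : R) := exists c, b = c * a.

Lemma dvdrr (R : comNzRingType) (a : R) : dvdr a a.
Proof. by exists 1; rewrite mul1r. Qed.

Lemma dvdr_mull (R : comNzRingType) (a b c : R) : dvdr a b -> dvdr a (c * b).
Proof. by case=> d ->; exists (c * d); rewrite mulrA. Qed.

Lemma dvdr_mulr (R : comNzRingType) (a b c : R) : dvdr a b -> dvdr a (b * c).
Proof. by rewrite mulrC; apply: dvdr_mull. Qed.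

Lemma dvdr_ideal (R : comNzRingType) (a : R) : is_ideal (dvdr a).
Proof.
split; first by exists 0; rewrite mul0r.
  by move=> x y [c ->] [d ->]; exists (c + d); rewrite mulrDl.
by move=> x y; apply: dvdr_mull.
Qed.

Definition primer (R : idomainType) (p : R) :=
  [/\ p != 0, p \isn't a GRing.unit & forall a b, dvdr p (a * b) -> dvdr p a \/ dvdr p b].

(* Unique factorization, in the form that passes most directly to polynomial
   rings: an additive length that vanishes on units only, and a prime divisor
   for every nonunit. *)
Definition ufd (R : idomainType) := exists len : R -> nat,
  [/\ forall a b : R, a != 0 -> b != 0 -> len (a * b) = (len a + len b)%N,
      forall a : R, a != 0 -> len a = 0%N -> a \is a GRing.unit
    & forall a : R, a != 0 -> a \isn't a GRing.unit -> exists2 p : R, primer p & dvdr p a].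

Inductive factors (R : idomainType) : R -> Prop :=
| factors_unit u : u \is a GRing.unit -> factors u
| factors_mul p a : primer p -> factors a -> factors (p * a).

Lemma ufd_factors (R : idomainType) (a : R) : ufd R -> a != 0 -> factors a.
Proof.
move=> [len [lenM len0 divp]]; move: {2}(len a) (leqnn (len a)) => k.
elim: k a => [|k IH] a hk a0.
  by apply/factors_unit/len0 => //; lia.
have [ua|nua] := boolP (a \is a GRing.unit); first exact: factors_unit.
have [p pp [c ec]] := divp _ a0 nua.
have [p0 nup _] := pp.
have c0 : c != 0 by apply: contraNneq a0 => h; rewrite ec h mul0r.
rewrite ec mulrC; apply: factors_mul => //; apply: IH => //.
have : len p != 0%N by apply: contra nup => /eqP; apply: len0.
by move: hk; rewrite ec lenM //; lia.
Qed.

(** A domain has no zero divisors, so some factor is killed. A minimal polynomial is later obtained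
    in this way, as a prime factor of a monic relation. *)
Lemma prime_divides_factor (R : idomainType) (S : idomainType) (f : {rmorphism R -> S}) x :
  factors x -> f x = 0 -> exists2 p, primer p & dvdr p x /\ f p = 0.
Proof.
elim=> [u uu fu0|p a pp _ IH].
  have : f u \is a GRing.unit by rewrite rmorph_unit.
  by rewrite fu0 unitr0.
rewrite rmorphM => /eqP; rewrite mulf_eq0 => /orP[/eqP fp|/eqP fa].
  by exists p => //; split=> //; apply/dvdr_mulr/dvdrr.
by have [q qq [dq fq]] := IH fa; exists q => //; split=> //; apply: dvdr_mull.
Qed.

Section PolyUFD.
Variable R : idomainType.

(** Gauss's lemma. If [p] divides [a b], it divides the product of the leading coefficients, hence
    one of them; that leading term is removed and the total size drops. *)
Lemma primer_polyC (p : R) : primer p -> primer p%:P.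
Proof.
case=> p0 nup pM; split; first by rewrite polyC_eq0.
  apply: contra nup; rewrite poly_unitE coefC eqxx => /andP[_ ->] //.
move=> a b; move: {2}(size a + size b)%N (leqnn (size a + size b)%N) => k.
have trunc (c : {poly R}) : c != 0 -> exists2 c' : {poly R}, (size c' < size c)%N &
    c = c' + (lead_coef c)%:P * 'X^((size c).-1).
  move=> c0; have sc : (size c).-1.+1 = size c by rewrite prednK // lt0n size_poly_eq0.
  exists (\poly_(i < (size c).-1) c`_i); first by rewrite -{2}sc ltnS size_poly.
  apply/polyP => i; rewrite coefD coef_poly coefCM coefXn lead_coefE.
  case: ltngtP => [||->]; rewrite ?mulr0 ?addr0 ?add0r ?mulr1 //.
  by move=> hi; rewrite nth_default // -sc.
have dC c (e : {poly R}) : dvdr p c -> dvdr p%:P (c%:P * e).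
  by move=> [f ->]; exists (f%:P * e); rewrite polyCM; ring.
elim: k a b => [|k IH] a b hk hab.
  left; have -> : a = 0 by apply/eqP; rewrite -size_poly_eq0; lia.
  exact: ideal0 (dvdr_ideal _).
have [->|a0] := eqVneq a 0; first by left; apply: ideal0 (dvdr_ideal _).
have [->|b0] := eqVneq b 0; first by right; apply: ideal0 (dvdr_ideal _).
have hl : dvdr p (lead_coef a * lead_coef b).
  rewrite -lead_coefM; case: hab => c ->; exists (lead_coef c).
  by rewrite lead_coefM lead_coefC.
have [a' sa ea] := trunc a a0; have [b' sb eb] := trunc b b0.
case: (pM _ _ hl) => h.
  have h1 : dvdr p%:P (a' * b).
    have ea' : a' = a - (lead_coef a)%:P * 'X^((size a).-1) by rewrite [X in X - _]ea addrK.
    rewrite ea' mulrBl -mulrA.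
    by apply: idealB => //; [exact: dvdr_ideal | exact: dC].
  case: (IH a' b _ h1) => [|h2|]; [lia| left |by right].
  by rewrite ea; apply: idealD => //; [exact: dvdr_ideal | exact: dC].
have h1 : dvdr p%:P (a * b').
  have eb' : b' = b - (lead_coef b)%:P * 'X^((size b).-1) by rewrite [X in X - _]eb addrK.
  rewrite eb' mulrBr [a * (_ * _)]mulrCA.
  by apply: idealB => //; [exact: dvdr_ideal | exact: dC].
case: (IH a b' _ h1) => [||h2]; [lia|by left|right].
by rewrite eb; apply: idealD => //; [exact: dvdr_ideal | exact: dC].
Qed.

Definition primitive (a : {poly R}) := forall p : R, primer p -> ~ dvdr p%:P a.

(** A prime factor of [r] divides [b c] but not the primitive [b], so it can be cancelled from
    [c]. *)
Lemma strip_primitive (r : R) (a b c : {poly R}) :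
  factors r -> primitive b -> r%:P * a = b * c -> dvdr b a.
Proof.
move=> fr pb; elim: fr a c => [u uu|p r' pp _ IH] a c e.
  exists ((u^-1)%:P * c); rewrite -mulrA [c * b]mulrC -e mulrA -polyCM mulVr //.
  by rewrite mul1r.
have [_ _ pM] := primer_polyC pp.
have : dvdr p%:P (b * c) by rewrite -e polyCM; exists (r'%:P * a); ring.
case/pM => [/(pb _ pp) //|[c1 ec]]; apply: (IH a c1).
have p0 : p%:P != 0 by case: pp; rewrite polyC_eq0.
by apply: (mulfI p0); rewrite mulrA -polyCM e ec; ring.
Qed.

(** Each prime of [r] is cancelled from whichever of the two factors it divides, which leaves the
    degrees alone: a factorisation over the fraction field descends to [R]. *)
Lemma strip_factor (r : R) (a b c : {poly R}) :
  factors r -> r%:P * a = b * c ->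
  exists b' c', [/\ a = b' * c', size b' = size b & size c' = size c].
Proof.
move=> fr; elim: fr a b c => [u uu|p r' pp _ IH] a b c e.
  exists b, ((u^-1)%:P * c); split=> //.
    by rewrite mulrCA -e mulrA -polyCM mulVr // mul1r.
  by rewrite mul_polyC size_scale //; apply: contraTneq uu => h; rewrite -unitrV h unitr0.
have [_ _ pM] := primer_polyC pp.
have p0 : p != 0 by case: pp.
have p0' : p%:P != 0 by rewrite polyC_eq0.
have : dvdr p%:P (b * c) by rewrite -e polyCM; exists (r'%:P * a); ring.
case/pM => [[b1 eb]|[c1 ec]].
  have [|b' [c' [-> sb' sc']]] := IH a b1 c.
    by apply: (mulfI p0'); rewrite mulrA -polyCM e eb; ring.
  by exists b', c'; split=> //; rewrite eb mulrC mul_polyC size_scale.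
have [|b' [c' [-> sb' sc']]] := IH a b c1.
  by apply: (mulfI p0'); rewrite mulrA -polyCM e ec; ring.
by exists b', c'; split=> //; rewrite ec mulrC mul_polyC size_scale.
Qed.

(** The length is the degree plus the length of the leading coefficient. When no prime constant
    divides [a], it is split until a factor is irreducible over the fraction field; such a primitive
    factor is prime, because it either divides [x] or is coprime to it. *)
Lemma poly_ufd : ufd R -> ufd {poly R}.
Proof.
move=> uR; have [len [lenM len0 divp]] := uR.
exists (fun a : {poly R} => (size a).-1 + len (lead_coef a))%N; split.
- move=> a b a0 b0; rewrite lead_coefM lenM ?lead_coef_eq0 // size_mul //.
  have : (0 < size a)%N by rewrite lt0n size_poly_eq0.
  have : (0 < size b)%N by rewrite lt0n size_poly_eq0.
  lia.
- move=> a a0 h; rewrite poly_unitE.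
  have s1 : size a = 1%N.
    have h1 : (0 < size a)%N by rewrite lt0n size_poly_eq0.
    lia.
  rewrite s1 eqxx /=; have : lead_coef a \is a GRing.unit.
    by apply: len0; rewrite ?lead_coef_eq0 //; lia.
  by rewrite lead_coefE s1.
move=> a a0 nua; have [[p pp dp]|prim] := classic (exists2 p : R, primer p & dvdr p%:P a).
  by exists p%:P => //; apply: primer_polyC.
have {prim} prim : primitive a by move=> p pp dp; apply: prim; exists p.
have sa : (1 < size a)%N.
  rewrite ltnNge; apply/negP => /size1_polyC ea.
  have c0 : a`_0 != 0 by apply: contraNneq a0 => h; rewrite ea h polyC0.
  have nuc : a`_0 \isn't a GRing.unit.
    by apply: contra nua => h; rewrite ea poly_unitE coefC eqxx size_polyC c0.
  have [p pp [c ec]] := divp _ c0 nuc.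
  by apply: (prim p pp); exists c%:P; rewrite ea ec polyCM.
move: {2}(size a) (leqnn (size a)) => k; elim: k a a0 {nua} prim sa => [|k IH] a a0 prim sa hk.
  lia.
(* Irreducibility over the fraction field, with the denominator [r] cleared. *)
have [irr|red] := classic (forall (r : R) b c, r != 0 -> r%:P * a = b * c ->
    (size b <= 1)%N \/ (size c <= 1)%N); last first.
  have [b [c [r [r0 e [sb sc]]]]] : exists b c (r : R), [/\ r != 0, r%:P * a = b * c &
      (1 < size b)%N /\ (1 < size c)%N].
    apply: NNPP => h; apply: red => r b c r0 e; apply: NNPP => h1; apply: h.
    exists b, c, r; split=> //; split; rewrite ltnNge; apply/negP => ?; apply: h1; by [left|right].
  have [b' [c' [ea eb ec]]] := strip_factor (ufd_factors uR r0) e.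
  have nb : b' != 0 by rewrite -size_poly_eq0 eb; lia.
  have nc : c' != 0 by rewrite -size_poly_eq0 ec; lia.
  have := size_mul nb nc; rewrite -ea eb ec => es.
  have [||||q qq dq] := IH b'; rewrite ?eb //; try lia.
    by move=> p pp dp; apply: (prim p pp); rewrite ea; apply: dvdr_mulr.
  by exists q => //; rewrite ea; apply: dvdr_mulr.
exists a; last exact: dvdrr.
have dvdE x : a %| x -> dvdr a x.
  case/Pdiv.Idomain.dvdpP => -[r q] /= r0 e.
  by apply: (strip_primitive (ufd_factors uR r0) prim (c := q)); rewrite mul_polyC e mulrC.
split=> //; first by rewrite poly_unitE; apply/negP => /andP[/eqP h]; rewrite h in sa.
move=> x y [z ez]; have [ax|nax] := boolP (a %| x); first by left; apply: dvdE.
right; apply: dvdE; suff cop : coprimep a x by rewrite -(Gauss_dvdpr _ cop) ez dvdp_mull.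
have/Pdiv.Idomain.dvdpP [[r q] /= r0 e] := dvdp_gcdl a x.
have {}e : r%:P * a = q * gcdp a x by rewrite mul_polyC e.
have g0 : gcdp a x != 0 by rewrite gcdp_eq0 (negPf a0).
case: (irr r q _ r0 e) => [sq|sg]; last first.
  rewrite /coprimep eqn_leq sg lt0n size_poly_eq0 //.
case/negP: nax; apply: dvdp_trans (dvdp_gcdr a x).
have q0 : q`_0 != 0.
  apply: contraTneq r0 => h; rewrite negbK; move: e; rewrite (size1_polyC sq) h polyC0 mul0r.
  by move/eqP; rewrite mulf_eq0 polyC_eq0 (negPf a0) orbF.
apply/Pdiv.Idomain.dvdpP; exists (q`_0, r%:P) => //=.
by rewrite e {2}(size1_polyC sq) mul_polyC.
Qed.

End PolyUFD.

Lemma ufd_iso (R S : idomainType) (f : {rmorphism R -> S}) (g : {rmorphism S -> R}) :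
  cancel f g -> cancel g f -> ufd S -> ufd R.
Proof.
move=> fg gf [len [lenM len0 divp]].
have f0 a : (f a == 0) = (a == 0).
  by rewrite -[0 in LHS](rmorph0 f) (can_eq fg).
have fu a : (f a \is a GRing.unit) = (a \is a GRing.unit).
  by apply/idP/idP => h; [rewrite -[a]fg; apply: rmorph_unit | apply: rmorph_unit].
have fd a b : dvdr (f a) (f b) -> dvdr a b.
  by case=> c e; exists (g c); rewrite -[b]fg e rmorphM fg.
exists (fun a => len (f a)); split.
- by move=> a b a0 b0; rewrite rmorphM lenM ?f0.
- by move=> a a0 /len0; rewrite f0 fu; apply.
move=> a a0 nua; have [||p [p0 nup pM] dp] := divp (f a); rewrite ?f0 ?fu //.
exists (g p); last by apply: fd; rewrite gf.
split; [by rewrite -f0 gf | by rewrite -fu gf | move=> x y [c e]].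
have : dvdr p (f x * f y) by rewrite -rmorphM e rmorphM gf; exists (f c).
by case/pM => h; [left|right]; apply: fd; rewrite gf.
Qed.

Lemma field_ufd (F : fieldType) : ufd F.
Proof. by exists (fun=> 0%N); split=> // a; rewrite unitfE // => ->. Qed.

(** * Nullstellensatz *)

Lemma ideal_preim (A B : comNzRingType) (f : {rmorphism A -> B}) (I : B -> Prop) :
  is_ideal I -> is_ideal (fun a => I (f a)).
Proof.
case=> I0 ID IM; split=> [|a b Ia Ib|a b Ib]; first by rewrite rmorph0.
  by rewrite rmorphD; apply: ID.
by rewrite rmorphM; apply: IM.
Qed.

(** Multiply the relations by the adjugate; this is the device behind Cayley-Hamilton. *)
Lemma det_trick (A : comNzRingType) (I : A -> Prop) e (M : 'M[A]_e) (X : 'I_e -> A) :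
  is_ideal I -> (forall i, I (\sum_j M i j * X j)) -> forall i, I (\det M * X i).
Proof.
move=> II h i.
have -> : \det M * X i = \sum_k \adj M i k * \sum_j M k j * X j.
  transitivity (\sum_j (\adj M *m M) i j * X j).
    rewrite mul_adj_mx (bigD1 i) //= !mxE eqxx mulr1n big1 ?addr0 // => j ji.
    by rewrite !mxE eq_sym (negPf ji) mulr0n mul0r.
  rewrite (eq_bigr (fun j => \sum_k \adj M i k * (M k j * X j))); last first.
    by move=> j _; rewrite !mxE mulr_suml; apply: eq_bigr => k _; rewrite mulrA.
  by rewrite exchange_big; apply: eq_bigr => k _; rewrite mulr_sumr.
by apply: ideal_sum => // k _; apply: idealMl.
Qed.

(** [M] is the matrix of multiplication by [g] on the free module [R[X]/(f)], in the basis of powers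
    of [X]. *)
Lemma mul_matrix_mod_monic (R : comNzRingType) (f g : {poly R}) e :
  f \is monic -> size f = e.+1 -> exists M : 'M[R]_e,
  forall i : 'I_e, dvdr f (g * 'X^i - \sum_j (M i j)%:P * 'X^j).
Proof.
move=> mf sf; pose r i : {poly R} := Pdiv.Ring.rmodp (g * 'X^i) f.
pose M : 'M[R]_e := \matrix_(i, j) (r i)`_j; exists M => i.
exists (Pdiv.Ring.rdivp (g * 'X^i) f); rewrite {1}(Pdiv.RingMonic.rdivp_eq mf (g * 'X^i)) -/(r i).
have -> : \sum_j (M i j)%:P * 'X^j = r i.
  apply/polyP => k; rewrite coef_sum.
  rewrite (eq_bigr (fun j : 'I_e => (r i)`_j * (k == j)%:R)); last first.
    by move=> j _; rewrite mxE coefCM coefXn.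
  have [ke|ek] := ltnP k e.
    rewrite (bigD1 (Ordinal ke)) //= eqxx mulr1 big1 ?addr0 // => j hj.
    case: eqP => [h|_]; last by rewrite mulr0.
    by case/eqP: hj; apply/val_inj.
  rewrite big1 ?nth_default //.
    by apply: leq_trans ek; rewrite -ltnS -sf Pdiv.Ring.ltn_rmodpN0 // monic_neq0.
  move=> j _; case: eqP => [h|]; last by rewrite mulr0.
  by have := ltn_ord j; rewrite -h ltnNge ek.
by rewrite addrK.
Qed.

Section Projection.
Variables (F : fieldType) (n : nat).
Local Notation R := {mpoly F[n]}.
Local Notation S := {mpoly F[n.+1]}.

(* [rho v] rewrites a polynomial in [n.+1] variables as a polynomial in the last
   one along the direction [(v, 1)]; [unrho v] is its inverse. *)
Definition rho_var (v : 'I_n -> F) (j : 'I_n.+1) : {poly R} :=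
  if unlift ord_max j is Some k then ('X_k)%:P + ((v k)%:MP)%:P * 'X else 'X.

Definition rho v : {rmorphism S -> {poly R}} :=
  mmap (polyC \o @mpolyC n F) (rho_var v).

Definition unrho_var (v : 'I_n -> F) (k : 'I_n) : S :=
  'X_(lift ord_max k) - (v k)%:MP * 'X_ord_max.

Definition unrho v : {rmorphism {poly R} -> S} :=
  horner_eval 'X_ord_max \o map_poly (cmp (unrho_var v)).

Definition dirvec (v : 'I_n -> F) (j : 'I_n.+1) : F :=
  if unlift ord_max j is Some k then v k else 1.

Lemma rhoC v c : rho v c%:MP = c%:MP%:P.
Proof. exact: mmapC. Qed.

Lemma rhoX v j : rho v 'X_j = rho_var v j.
Proof. by rewrite /= mmap_XU. Qed.

Lemma unrhoC v r : unrho v r%:P = cmp (unrho_var v) r.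
Proof. by rewrite /= /horner_eval map_polyC hornerC. Qed.

Lemma unrhoX v : unrho v 'X = 'X_ord_max.
Proof. by rewrite /= /horner_eval map_polyX hornerX. Qed.

Lemma rhoK v : cancel (rho v) (unrho v).
Proof.
move=> p; have /= := @rmorph_mpolyP _ _ _ (unrho v \o rho v) idfun _ _ p; apply.
  by move=> c; rewrite /= [mmap _ _ _]rhoC -[LHS]/(unrho v _) unrhoC mmapC.
move=> j; rewrite /= [mmap _ _ _]rhoX -[LHS]/(unrho v _) /rho_var.
case: unliftP => [k ->|->]; last by rewrite unrhoX.
by rewrite rmorphD rmorphM !unrhoC mmapC mmap_XU unrhoX subrK.
Qed.

Lemma unrhoK v : cancel (unrho v) (rho v).
Proof.
have hC r : rho v (unrho v r%:P) = r%:P.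
  rewrite unrhoC.
  have /= := @rmorph_mpolyP _ _ _ (rho v \o cmp (unrho_var v)) polyC _ _ r; apply.
    by move=> c; rewrite /= mmapC -[LHS]/(rho v _) rhoC.
  move=> k; rewrite /= mmap_XU -[LHS]/(rho v _) /unrho_var rmorphB rmorphM rhoC !rhoX /rho_var.
  by rewrite liftK unlift_none addrK.
move=> p; rewrite -[p]coefK poly_def !rmorph_sum; apply: eq_bigr => i _.
by rewrite -mul_polyC !rmorphM hC !rmorphXn unrhoX rhoX /rho_var unlift_none.
Qed.

Lemma meval_rho v (x : 'I_n -> F) t p :
  (map_poly (meval x) (rho v p)).[t] =
  p.@[fun j => if unlift ord_max j is Some k then x k + v k * t else t].
Proof.
have /= := @rmorph_mpolyP _ _ _ (horner_eval t \o map_poly (meval x) \o rho v)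
  (meval (fun j => if unlift ord_max j is Some k then x k + v k * t else t)) _ _ p; apply.
  by move=> c; rewrite /= mevalC [mmap _ _ _]rhoC /horner_eval map_polyC /= mevalC hornerC.
move=> j; rewrite /= mevalXU [mmap _ _ _]rhoX /rho_var /horner_eval.
case: unliftP => [k _|_]; last by rewrite map_polyX hornerX.
by rewrite rmorphD rmorphM /= !map_polyC map_polyX !hornerE /= mevalC mevalXU.
Qed.

Let toppair e (p : {poly R}) (c : F) := (size p <= e.+1)%N /\ p`_e = c%:MP.

Let toppairM a b p q c d : toppair a p c -> toppair b q d -> toppair (a + b) (p * q) (c * d).
Proof.
move=> [sp pc] [sq qd]; split.
  by apply: leq_trans (size_polyMleq _ _) _; lia.
have ha : (a < (a + b).+1)%N by lia.
rewrite coefM (bigD1 (Ordinal ha)) //= pc addKn qd mpolyCM big1 ?addr0 // => i hi.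
have [lt|gt|eq] := ltngtP i a.
- by rewrite [q`__]nth_default ?mulr0 //; apply: leq_trans sq _; have := ltn_ord i; lia.
- by rewrite nth_default ?mul0r //; apply: leq_trans sp _.
- by case/eqP: hi; apply/val_inj.
Qed.

Lemma rho_top_monomial v (m : 'X_{1..n.+1}) :
  (size (rho v 'X_[m]) <= (mdeg m).+1)%N /\
  (rho v 'X_[m])`_(mdeg m) = (\prod_j dirvec v j ^+ m j)%:MP.
Proof.
rewrite -/(toppair _ _ _) mpolyXE_id rmorph_prod mdegE.
apply: (big_rec3 (fun a p c => toppair a p c)).
  by split; rewrite ?size_poly1 // coef1.
move=> j a p c _ h; apply: toppairM => //; rewrite rmorphXn rhoX.
elim: (m j) => [|k IH]; first by split; rewrite ?size_poly1 // coef1.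
rewrite !exprS -add1n; apply: toppairM => //; rewrite /rho_var /dirvec.
case: unliftP => [i _|_]; last by split; rewrite ?size_polyX // coefX.
split; last by rewrite coefD coefC coefMX coefC add0r.
apply: leq_trans (size_polyD _ _) _; rewrite geq_max size_polyC.
apply/andP; split; first by case: (_ != _).
by apply: leq_trans (size_polyMleq _ _) _; rewrite size_polyX size_polyC; case: (_ != _).
Qed.

(** The coefficient of [X^e] is a constant, the value of the part of degree [e] in the direction
    [(v, 1)]. A direction off the zeros of that part makes [p] monic up to a scalar, as in Noether
    normalisation. *)
Lemma rho_top v e p : (msize p <= e.+1)%N ->
  (size (rho v p) <= e.+1)%N /\ (rho v p)`_e = ((pihomog mdeg e p).@[dirvec v])%:MP.
Proof.
move=> hp; have hm m : m \in msupp p -> (mdeg m <= e)%N.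
  by move/msize_mdeg_lt => h; rewrite -ltnS (leq_trans h hp).
split.
  rewrite [p]mpolyE rmorph_sum; apply: leq_trans (size_sum _ _ _) _; apply/bigmax_leqP_seq => m /hm h _.
  rewrite -mul_mpolyC rmorphM rhoC mul_polyC.
  apply: leq_trans (size_scale_leq _ _) _; have [s _] := rho_top_monomial v m.
  by apply: leq_trans s _.
rewrite {1}[p]mpolyE rmorph_sum coef_sum pihomogE (raddf_sum (meval _)) (raddf_sum (@mpolyC n F)).
rewrite [RHS]big_mkcond /= big_seq [RHS]big_seq.
apply: eq_bigr => m /hm h.
rewrite -mul_mpolyC rmorphM rhoC coefCM.
have [s t] := rho_top_monomial v m.
case: eqP => [he|hne]; first by rewrite -he t mevalM mevalC mevalX mpolyCM.
by rewrite [_`_e]nth_default ?mulr0 ?meval0 //; apply: leq_trans s _; lia.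
Qed.

Lemma rho_top_homog v e p : p \is e.-homog ->
  (size (rho v p) <= e.+1)%N /\ (rho v p)`_e = (p.@[dirvec v])%:MP.
Proof.
move=> hp; have := @rho_top v e p; rewrite (pihomog_dE hp); apply.
by rewrite msizeE; apply/bigmax_leqP_seq => m /(dhomog_mf hp) ->.
Qed.

End Projection.

#[global] Opaque rho unrho.

Lemma mcoeff_pihomog n (R : comNzRingType) e (p : {mpoly R[n]}) m :
  (pihomog mdeg e p)@_m = if mdeg m == e then p@_m else 0.
Proof.
rewrite pihomogE (raddf_sum (mcoeff m)) big_mkcond /= [in RHS](mpolyE p) (raddf_sum (mcoeff m)) /=.
have [hm|hm] := eqP.
  apply: eq_bigr => m' _; rewrite !mcoeffZ mcoeffX; case: (eqVneq m' m) => [->|].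
    by rewrite hm eqxx.
  by rewrite mulr0 if_same.
rewrite big1 // => m' _; case: eqP => // hm'; rewrite mcoeffZ mcoeffX; case: eqP => [h|].
  by case: hm; rewrite -h.
by rewrite mulr0.
Qed.

Lemma mmap_homog_scale n (R S : comNzRingType) (f : R -> S) (t : S) (h : 'I_n -> S) e p :
  p \is e.-homog -> mmap f (fun j => t * h j) p = t ^+ e * mmap f h p.
Proof.
move=> hp; rewrite /mmap mulr_sumr big_seq [RHS]big_seq; apply: eq_bigr => m hm.
have he : mdeg m = e := dhomog_mf hp hm.
rewrite [RHS]mulrCA; congr (_ * _); rewrite -he mdegE /mmap1.
by rewrite -prodrXr -big_split; apply: eq_bigr => j _; rewrite exprMn.
Qed.

Lemma mpoly_ufd (F : fieldType) n : ufd {mpoly F[n]}.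
Proof.
elim: n => [|n IH].
  apply: (ufd_iso (f := mcoeff 0%MM) (g := @mpolyC 0 F)) (field_ufd F).
    exact: mpolyKC.
  exact: mpolyCK.
exact: ufd_iso (rhoK (fun=> 0)) (unrhoK (fun=> 0)) (poly_ufd IH).
Qed.

Lemma ufd_irreducible_prime (R : idomainType) (q : R) :
  ufd R -> q != 0 -> q \isn't a GRing.unit ->
  (forall a b, q = a * b -> a \is a GRing.unit \/ b \is a GRing.unit) -> primer q.
Proof.
move=> [len [_ _ divp]] q0 nq irr; have [p [p0 np pM] [c ec]] := divp q q0 nq.
case: (irr _ _ ec) => h; last by rewrite h in np.
split=> // a b [d ed]; have : dvdr p (a * b) by rewrite ed ec mulrA; exists (d * c).
have red x : dvdr p x -> dvdr q x.
  by move=> [z ->]; exists (z * c^-1); rewrite ec mulrA mulrVK.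
by case/pM => /red; [left|right].
Qed.

Section Nullstellensatz.
Variable F : closedFieldType.

Lemma nonzero_eval n (p : {mpoly F[n]}) : p != 0 -> exists x, p.@[x] != 0.
Proof.
elim: n p => [|n IH] p p0.
  exists (fun=> 0); apply: contraNneq p0; rewrite [p]nvar0_mpolyC mevalC => ->.
  by rewrite mpolyC0.
have l0 : lead_coef (rho (fun=> 0) p) != 0.
  by rewrite lead_coef_eq0 -(rmorph0 (rho (fun=> 0))) (can_eq (rhoK _)).
have [x hx] := IH _ l0.
have m0 : map_poly (meval x) (rho (fun=> 0) p) != 0.
  apply: contraNneq hx => h; have := congr1 (fun q : {poly F} => q`_(size (rho (fun=> 0) p)).-1) h.
  by rewrite coef_map coef0 /= -lead_coefE => ->.
have/closed_nonrootP [t ht] := m0.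
by eexists; move: ht; rewrite /root meval_rho; apply.
Qed.

Lemma poly_ideal_root (Q : {poly F} -> Prop) :
  is_ideal Q -> ~ Q 1 -> exists t, forall q, Q q -> root q t.
Proof.
move=> QI nQ1; have [[q Qq q0]|allz] := classic (exists2 q, Q q & q != 0); last first.
  exists 0 => q Qq; have [->|q0] := eqVneq q 0; first exact: root0.
  by case: allz; exists q.
have [b [Qb b0 bmin]] : exists b, [/\ Q b, b != 0 & forall c, Q c -> (size c < size b)%N -> c = 0].
  move: {2}(size q) (leqnn (size q)) => k; elim: k q Qq q0 => [|k IH] q Qq q0 hk.
    by move: hk; rewrite leqn0 size_poly_eq0 (negPf q0).
  have [[c [Qc c0 sc]]|h] := classic (exists c, [/\ Q c, c != 0 & (size c < size q)%N]).
    by apply: (IH c) => //; lia.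
  exists q; split=> // c Qc sc; apply/eqP; apply: contraT => c0; case: h; by exists c.
have/closed_rootP [t ht] : size b != 1%N.
  apply/eqP => sb; apply: nQ1; have/eqP/size_poly1P [c c0 ec] := sb.
  have -> : 1 = (c^-1)%:P * b by rewrite ec -polyCM mulVf.
  exact: idealMl.
exists t => c Qc; have db : b %| c.
  apply/eqP; apply: bmin; last by rewrite ltn_modp.
  have -> : c %% b = c - (c %/ b) * b by rewrite {2}(divp_eq c b) addrC addKr.
  by apply: idealB => //; apply: idealMl.
by case/dvdpP: db => d ->; rewrite rootM ht orbT.
Qed.

(** A linear change of coordinates makes some element [f] of [I] monic in the last variable. The
    elimination ideal [I'] has a zero [a] by induction, and [I] specialised at [a] stays a proper
    ideal of polynomials in one variable, which has a root. *)
Theorem nullstellensatz n (I : {mpoly F[n]} -> Prop) :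
  is_ideal I -> ~ I 1 -> exists x, forall p, I p -> p.@[x] = 0.
Proof.
elim: n I => [|n IH] I II nI1.
  exists (fun=> 0) => p Ip; rewrite [p]nvar0_mpolyC mevalC; apply/eqP; apply: contraT => c0.
  case: nI1; have -> : 1 = (p@_0)^-1%:MP * p by rewrite {2}[p]nvar0_mpolyC -mpolyCM mulVf.
  exact: idealMl.
have [[p Ip p0]|allz] := classic (exists2 p, I p & p != 0); last first.
  exists (fun=> 0) => p Ip; have [->|p0] := eqVneq p 0; first exact: meval0.
  by case: allz; exists p.
pose e := (msize p).-1.
have se : msize p = e.+1 by rewrite /e prednK // lt0n msize_poly_eq0.
pose h := pihomog mdeg e p.
have h0 : h != 0.
  apply/eqP => /(congr1 (mcoeff (mlead p))); rewrite mcoeff_pihomog mcoeff0 -eqSS mlead_deg //.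
  by rewrite se eqxx; apply/eqP; rewrite mleadc_eq0.
have [x] : exists x, (h * 'X_ord_max).@[x] != 0.
  by apply: nonzero_eval; rewrite mulf_neq0 // -msize_poly_eq0 msizeX.
rewrite mevalM mevalXU mulf_eq0 negb_or => /andP[hx xm].
pose v (k : 'I_n) := (x ord_max)^-1 * x (lift ord_max k).
have hv : h.@[dirvec v] != 0.
  have -> : h.@[dirvec v] = h.@[fun j => (x ord_max)^-1 * x j].
    apply: meval_eq => j; rewrite /dirvec; case: unliftP => [k ->|->] //.
    by rewrite mulVf.
  by rewrite /meval (mmap_homog_scale _ _ _ (pihomogP _ _ _)) mulf_neq0 // expf_neq0 // invr_eq0.
have [sf cf] := rho_top v (eq_leq se); rewrite -/h in cf.
pose u : {mpoly F[n]} := (h.@[dirvec v])^-1%:MP.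
pose f := u%:P * rho v p.
have cfe : f`_e = 1 by rewrite coefCM cf -mpolyCM mulVf.
have sfe : size f = e.+1.
  apply/eqP; rewrite eqn_leq; apply/andP; split.
    by rewrite /f mul_polyC; apply: leq_trans (size_scale_leq _ _) sf.
  by rewrite ltnNge; apply/negP => s; move/eqP: cfe; rewrite nth_default // eq_sym oner_eq0.
have mf : f \is monic by rewrite monicE lead_coefE sfe cfe.
have If : I (unrho v f) by rewrite rmorphM rhoK; apply: idealMl.
clearbody f.
pose I' r := I (unrho v r%:P).
have II' : is_ideal I' := ideal_preim (unrho v \o polyC) II.
have [a ha] : exists a, forall p, I' p -> p.@[a] = 0 by apply: IH => //; rewrite /I' !rmorph1.
pose img g := map_poly (meval a) (rho v g).
(* Otherwise the determinant of multiplication by [g] modulo [f] lies in the elimination ideal by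
   [det_trick], so it vanishes at [a]; but at [a] the matrix becomes the identity. *)
have no1 g : I g -> img g <> 1.
  move=> Ig g1; have [M hM] := mul_matrix_mod_monic (rho v g) mf sfe.
  case ee: e M hM => [|e'] M hM.
    have f1 : f = 1.
      by rewrite [f]size1_polyC ?sfe ?ee //; move: cfe; rewrite ee => ->.
    by apply: nI1; rewrite -(rmorph1 (unrho v)) -f1.
  pose I2 q := I (unrho v q).
  have II2 : is_ideal I2 := ideal_preim (unrho v) II.
  have Ig2 : I2 (rho v g) by rewrite /I2 rhoK.
  have hI i : I2 (\sum_j (map_mx polyC M) i j * 'X^j).
    have [c hc] := hM i.
    have -> : \sum_j (map_mx polyC M) i j * 'X^j = rho v g * 'X^i - c * f.
      by rewrite -hc opprB addrC subrK; apply: eq_bigr => j _; rewrite mxE.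
    by apply: (idealB II2); [apply: (idealMr II2) | apply: (idealMl II2)].
  have := det_trick II2 hI ord0; rewrite expr0 mulr1 det_map_mx => /ha.
  suff e1 : map_mx (meval a) M = 1%:M.
    by rewrite -det_map_mx e1 det1 => /eqP; rewrite oner_eq0.
  apply/matrixP => i j; rewrite !mxE; have [c hc] := hM i.
  have g1' : map_poly (meval a) (rho v g) = 1 := g1.
  have := congr1 (map_poly (meval a)) hc; rewrite rmorphB [X in X - _]rmorphM [in RHS]rmorphM /= g1' mul1r => hc'.
  set L := map_poly _ (\sum_j _) in hc'.
  have hL k : L`_k = \sum_j (M i j).@[a] * (k == j)%:R.
    rewrite /L coef_map coef_sum (raddf_sum (meval a)); apply: eq_bigr => l _ /=.
    by rewrite coefCM coefXn mevalM -mpolyC_nat mevalC.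
  have sL : (size L <= e'.+1)%N.
    apply/leq_sizeP => k hk; rewrite hL big1 // => l _; case: eqP => [h1|]; last by rewrite mulr0.
    by have := ltn_ord l; rewrite -h1 ltnNge hk.
  have eL : 'X^i = L.
    rewrite map_polyXn in hc'; apply/eqP; rewrite -subr_eq0 hc'.
    have fa : map_poly (meval a) f \is monic by rewrite monic_map.
    have [->|nc] := eqVneq (map_poly (meval a) c) 0; first by rewrite mul0r.
    have : (size ('X^i - L)%R < size (map_poly (meval a) f))%N.
      rewrite size_map_poly_id0 ?(monicP mf) ?meval1 ?oner_eq0 // sfe ee ltnS.
      by apply: leq_trans (size_polyD _ _) _; rewrite size_polyN size_polyXn geq_max sL andbT.
    rewrite hc' size_Mmonic // ltnNge => /negP[].
    by move: nc; rewrite -size_poly_eq0 -lt0n; case: (size (map_poly _ c)) => // k _; rewrite /= leq_addl.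
  have := congr1 (fun q : {poly F} => q`_j) eL; rewrite hL coefXn (bigD1 j) //= eqxx mulr1.
  rewrite big1 ?addr0 => [<-|l lj]; first by rewrite eq_sym.
  by case: eqP => [h1|]; rewrite ?mulr0 //; case/eqP: lj; apply/val_inj.
have [t ht] : exists t, forall g, I g -> root (img g) t.
  have [|[g Ig g1]|t ht] := @poly_ideal_root (fun q => exists2 g, I g & q = img g).
  - split; first by exists 0; [exact: ideal0 | rewrite /img !rmorph0].
      move=> b c [g Ig ->] [g' Ig' ->]; exists (g + g'); first exact: idealD.
      by rewrite /img !rmorphD.
    move=> b c [g Ig ->]; exists (unrho v (map_poly (@mpolyC n F) b) * g); first exact: idealMl.
    rewrite /img rmorphM unrhoK rmorphM; congr (_ * _).
    by apply/polyP => i; rewrite !coef_map /= mevalC.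
  - exact: (no1 g).
  by exists t => g Ig; apply: ht; exists g.
by eexists => g /ht; rewrite /root meval_rho => /eqP; apply.
Qed.

End Nullstellensatz.

(** * The fraction field of the quotient by a prime element *)

Section QuotientField.
Variables (R : idomainType) (J : R) (pJ : primer J).

Definition multiples : R -> bool := fun p => excluded_middle_informative (dvdr J p).

Lemma multiplesP p : reflect (dvdr J p) (p \in multiples).
Proof. by rewrite unfold_in /multiples; case: excluded_middle_informative => h; constructor. Qed.

Lemma multiples_zmod : zmod_closed multiples.
Proof.
split; first by apply/multiplesP; apply: ideal0 (dvdr_ideal J).
by move=> x y /multiplesP hx /multiplesP hy; apply/multiplesP; apply: (idealB (dvdr_ideal J)).
Qed.

Lemma multiples_proper : 1 \notin multiples /\
  (forall a, {in multiples, forall u, a * u \in multiples}).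
Proof.
have [_ nu _] := pJ; split.
  by apply/multiplesP => -[c e]; case/negP: nu; apply/unitrPr; exists c; rewrite mulrC -e.
by move=> a x /multiplesP h; apply/multiplesP; apply: dvdr_mull.
Qed.

Lemma multiples_prime : prime_idealr_closed multiples.
Proof.
have [_ _ pM] := pJ; move=> x y /multiplesP/pM h.
by apply/orP; case: h => h; [left|right]; apply/multiplesP.
Qed.

HB.instance Definition _ := GRing.isZmodClosed.Build R multiples multiples_zmod.
HB.instance Definition _ := isProperIdeal.Build R multiples multiples_proper.
HB.instance Definition _ := isPrimeIdealrClosed.Build R multiples multiples_prime.

Definition residue_ring := {ideal_quot (multiples : prime_idealr R)}.

HB.instance Definition _ := GRing.ComNzRing.on residue_ring.

(** The fraction field is formed over an integral domain equipped with a unit predicate and an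
    inverse; both are supplied by classical choice. *)
Definition residue_unit : {pred residue_ring} :=
  fun x => excluded_middle_informative (exists y, y * x = 1).

Definition residue_inv (x : residue_ring) : residue_ring :=
  if excluded_middle_informative (exists y, y * x = 1) is left h
  then proj1_sig (constructive_indefinite_description _ h) else x.

Lemma residue_mulVr : {in residue_unit, left_inverse 1 residue_inv *%R}.
Proof.
move=> x; rewrite unfold_in /residue_unit /residue_inv.
case: excluded_middle_informative => // h _; by case: constructive_indefinite_description.
Qed.

Lemma residue_unitP (x y : residue_ring) : y * x = 1 -> residue_unit x.
Proof.
by move=> h; rewrite /residue_unit; case: excluded_middle_informative => // -[]; exists y.
Qed.

Lemma residue_inv_out : {in [predC residue_unit], residue_inv =1 id}.
Proof.
by move=> x; rewrite !inE unfold_in /residue_unit /residue_inv; case: excluded_middle_informative.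
Qed.

HB.instance Definition _ :=
  GRing.ComNzRing_hasMulInverse.Build residue_ring residue_mulVr residue_unitP residue_inv_out.

Lemma residue_integral (x y : residue_ring) : x * y = 0 -> (x == 0) || (y == 0).
Proof. exact: Quotient.rquot_IdomainAxiom. Qed.

HB.instance Definition _ := GRing.ComUnitRing_isIntegral.Build residue_ring residue_integral.

Definition residue : {rmorphism R -> residue_ring} := \pi_(residue_ring)%qT.

Lemma prime_quotient_field : exists (K : fieldType) (phi : {rmorphism R -> K}),
  forall p, phi p = 0 <-> dvdr J p.
Proof.
exists {fraction residue_ring}, (@tofrac residue_ring \o residue) => p /=.
have -> : (tofrac (residue p) = 0) <-> residue p == residue 0.
  by rewrite rmorph0 -tofrac_eq0; split=> [/eqP|/eqP].
by rewrite /residue /= -Quotient.idealrBE subr0; split=> /multiplesP.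
Qed.

End QuotientField.

Definition gen (R : comNzRingType) (T : finType) (g : T -> R) p :=
  exists A : T -> R, p = \sum_t A t * g t.

Lemma gen_ideal (R : comNzRingType) (T : finType) (g : T -> R) : is_ideal (gen g).
Proof.
split; first by exists (fun=> 0); rewrite big1 // => t _; rewrite mul0r.
  move=> a b [A ->] [B ->]; exists (fun t => A t + B t).
  by rewrite -big_split; apply: eq_bigr => t _; rewrite mulrDl.
move=> a b [B ->]; exists (fun t => a * B t); rewrite mulr_sumr.
by apply: eq_bigr => t _; rewrite mulrA.
Qed.

Lemma gen_mem (R : comNzRingType) (T : finType) (g : T -> R) t : gen g (g t).
Proof.
exists (fun s => (s == t)%:R); rewrite (bigD1 t) //= eqxx mul1r big1 ?addr0 // => s /negPf->.
by rewrite mul0r.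
Qed.

(** * Homogeneous components *)

Section HomogeneousComponents.
Variables (n : nat) (R : idomainType).
Implicit Types p g : {mpoly R[n]}.

Lemma homog_msize_le e p : p \is e.-homog -> (msize p <= e.+1)%N.
Proof.
by move=> hp; rewrite msizeE; apply/bigmax_leqP_seq => m /(dhomog_mf hp) ->.
Qed.

Lemma pihomog_large k p : (msize p <= k)%N -> pihomog mdeg k p = 0.
Proof.
move=> hk; apply/mpolyP => m; rewrite mcoeff_pihomog mcoeff0; case: eqP => // hm.
by apply: memN_msupp_eq0; apply: msize_mdeg_ge; rewrite hm.
Qed.

Lemma pihomog_homog k e p : p \is e.-homog -> pihomog mdeg k p = if e == k then p else 0.
Proof.
move=> hp; apply/mpolyP => m; rewrite mcoeff_pihomog.
have [hm|hm] := eqVneq (mdeg m) e.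
  by rewrite hm; case: ifP => _ //; rewrite mcoeff0.
rewrite (dhomog_nemf_coeff hp) //; by case: ifP => _; case: ifP => _; rewrite ?mcoeff0 // (dhomog_nemf_coeff hp).
Qed.

Lemma pihomog_mulr d k g p : g \is d.-homog ->
  pihomog mdeg k (p * g) = if (d <= k)%N then pihomog mdeg (k - d) p * g else 0.
Proof.
move=> hg; elim/mpolyind: p => [|c m p _ _ IH].
  by rewrite mul0r !pihomog0 mul0r if_same.
rewrite mulrDl pihomogD IH pihomogD.
have hX : c *: 'X_[m] \is (mdeg m).-homog by apply: dhomogZ; rewrite dhomogX.
have -> : pihomog mdeg k (c *: 'X_[m] * g) =
  if (d <= k)%N then pihomog mdeg (k - d) (c *: 'X_[m]) * g else 0.
  rewrite (pihomog_homog k (dhomogM hX hg)) (pihomog_homog _ hX).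
  case: (leqP d k) => hk.
    have -> : (mdeg m + d == k)%N = (mdeg m == k - d)%N by lia.
    by case: ifP; rewrite ?mul0r.
  by have -> : (mdeg m + d == k)%N = false by lia.
by case: ifP => _; rewrite ?addr0 // mulrDl.
Qed.

Lemma gen_pihomog (T : finType) (g : T -> {mpoly R[n]}) (d : T -> nat) k p :
  (forall t, g t \is (d t).-homog) -> gen g p -> gen g (pihomog mdeg k p).
Proof.
move=> hg [A ->]; exists (fun t => if (d t <= k)%N then pihomog mdeg (k - d t) (A t) else 0).
rewrite raddf_sum; apply: eq_bigr => t _ /=; rewrite (pihomog_mulr _ _ (hg t)).
by case: ifP; rewrite ?mul0r.
Qed.

Lemma dvdr_pihomog k d g p : g \is d.-homog -> dvdr g p -> dvdr g (pihomog mdeg k p).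
Proof.
move=> hg [a ->]; rewrite (pihomog_mulr _ _ hg); case: ifP => _.
  by exists (pihomog mdeg (k - d) a).
exact: ideal0 (dvdr_ideal g).
Qed.

End HomogeneousComponents.

(** Once the full powers of [X] are taken out of [p] and [q], both cofactors have a nonzero constant
    term and their product is a constant, so each is a constant. *)
Lemma monomial_factor (A : idomainType) (p q : {poly A}) z c :
  z != 0 -> p * q = z%:P * 'X^c -> exists i z', p = z'%:P * 'X^i.
Proof.
move=> z0 e.
have pq0 : p * q != 0 by rewrite e mulf_neq0 ?polyC_eq0 // -size_poly_eq0 size_polyXn.
have [p0 q0] : p != 0 /\ q != 0 by move: pq0; rewrite mulf_eq0 negb_or => /andP.
have [i [a ra ea]] := multiplicity_XsubC p 0.
have [j [b rb eb]] := multiplicity_XsubC q 0.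
rewrite p0 /= in ra; rewrite q0 /= in rb; rewrite subr0 in ea eb.
have e1 : a * b * 'X^(i + j) = z%:P * 'X^c by rewrite -e ea eb exprD; ring.
have ab0 : (a * b)`_0 != 0 by rewrite coef0M mulf_neq0 // -horner_coef0.
have eij : (i + j = c)%N.
  apply/eqP; apply: contraT => nij.
  have := congr1 (fun w : {poly A} => w`_(i + j)) e1.
  by rewrite coefCM coefXn (negPf nij) mulr0 coefMXn ltnn subnn => /eqP; rewrite (negPf ab0).
have sa : (size a <= 1)%N.
  have : a * b = z%:P.
    by apply: (mulIf (x := 'X^c)); rewrite -?size_poly_eq0 ?size_polyXn // -{1}eij.
  move=> /(congr1 (fun w : {poly _} => size w)); rewrite size_polyC z0 /=.
  have a0 : a != 0 by apply: contraNneq ra => ->; rewrite root0.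
  have b0 : b != 0 by apply: contraNneq rb => ->; rewrite root0.
  rewrite size_mul //; move: a0 b0; rewrite -!size_poly_eq0.
  by move: (size a) (size b) => u w; lia.
by exists i, a`_0; rewrite ea {1}(size1_polyC sa).
Qed.

(* The homogeneous components of [p], as the coefficients of [p(t x)] in [t]. *)
Definition components n (R : idomainType) : {rmorphism {mpoly R[n]} -> {poly {mpoly R[n]}}} :=
  mmap (polyC \o @mpolyC n R) (fun j => 'X * ('X_j)%:P).

Section Components.
Variables (n : nat) (R : idomainType).
Implicit Types p q : {mpoly R[n]}.

Lemma components_homog e p : p \is e.-homog -> components n R p = 'X^e * p%:P.
Proof.
move=> hp; transitivity (mmap (polyC \o @mpolyC n R) (fun j => 'X * ('X_j)%:P) p) => //.
rewrite (mmap_homog_scale _ _ _ hp); congr (_ * _).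
by rewrite -{2}[p]mmap_id rmorph_mmap.
Qed.

Opaque components.

Lemma components_coef p k : (components n R p)`_k = pihomog mdeg k p.
Proof.
have hmono c m : (components n R (c *: 'X_[m]))`_k = pihomog mdeg k (c *: 'X_[m]).
  have hX : c *: 'X_[m] \is (mdeg m).-homog by apply: dhomogZ; rewrite dhomogX.
  rewrite (pihomog_homog _ hX) (components_homog hX) coefXnM coefC.
  case: ltngtP => [||->]; rewrite ?subnn //.
  by move=> h; rewrite subn_eq0 leqNgt h.
elim/mpolyind: p => [|c m p _ _ IH]; first by rewrite rmorph0 coef0 pihomog0.
rewrite [components _ _ _]rmorphD coefD [X in X + _]hmono [X in _ + X]IH.
exact/esym/pihomogD.
Qed.

(** [p(t x) q(t x)] is a monomial in [t], hence so is [p(t x)], which is to say that [p] has a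
    single component. *)
Lemma homog_factor c p q : p * q != 0 -> p * q \is c.-homog -> exists e, p \is e.-homog.
Proof.
move=> pq0 hc; have t0 r : r != 0 -> components n R r != 0.
  move=> r0; apply: contra_neq r0 => h; apply/mpolyP => m.
  have := congr1 (fun w : {poly {mpoly R[n]}} => (w`_(mdeg m))@_m) h.
  by rewrite components_coef mcoeff_pihomog eqxx coef0 mcoeff0.
have et : components n R p * components n R q = (p * q)%:P * 'X^c.
  rewrite -rmorphM; apply/polyP => k; rewrite components_coef (pihomog_homog _ hc) coefCM coefXn eq_sym.
  by case: eqP => _; rewrite ?mulr1 ?mulr0.
have [p0 q0] : p != 0 /\ q != 0 by move: pq0; rewrite mulf_eq0 negb_or => /andP.
have [i [z ez]] := monomial_factor pq0 et.
exists i; rewrite homog_piE; apply/eqP/mpolyP => m; rewrite mcoeff_pihomog.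
case: eqP => // hm.
have := components_coef p (mdeg m); rewrite ez coefCM coefXn.
rewrite (introF eqP hm) mulr0 => /(congr1 (mcoeff m)).
by rewrite mcoeff0 mcoeff_pihomog eqxx.
Qed.

End Components.

(** * Common zeros of forms *)

Section ProjectiveNullstellensatz.
Variable F : closedFieldType.

(** The auxiliary variable of Rabinowitsch's trick is avoided: as [E] is a form of positive degree,
    the ideal of [g] and [E - 1] has no zero, so [1 = a + b (E - 1)] with [a] in the ideal of [g].
    Comparing components, the part of [b] of degree [j s] is congruent to [- E^j]; it is zero for
    large [j]. *)
Lemma hilbert_forms n (T : finType) (g : T -> {mpoly F[n]}) (d : T -> nat) E s :
  (forall t, g t \is (d t).-homog) -> E \is s.-homog -> (0 < s)%N ->
  (forall x, (forall t, (g t).@[x] = 0) -> E.@[x] = 0) -> exists N, gen g (E ^+ N).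
Proof.
move=> hg hE s0 van.
pose Q p := exists a b, gen g a /\ p = a + b * (E - 1).
have QI : is_ideal Q.
  split.
  - by exists 0, 0; split; [exact: ideal0 (gen_ideal g) | rewrite mul0r addr0].
  - move=> p q [a [b [ga ->]]] [a' [b' [ga' ->]]]; exists (a + a'), (b + b').
    by split; [exact: (idealD (gen_ideal g)) | ring].
  move=> p q [a [b [ga ->]]]; exists (p * a), (p * b).
  by split; [exact: (idealMl (gen_ideal g)) | ring].
have [a [b [ga e1]]] : Q 1.
  apply: NNPP => nQ; have [x hx] := nullstellensatz QI nQ.
  have gx t : (g t).@[x] = 0.
    by apply: hx; exists (g t), 0; split; [exact: gen_mem | rewrite mul0r addr0].
  have : (E - 1).@[x] = 0.
    by apply: hx; exists 0, 1; split; [exact: ideal0 (gen_ideal g) | rewrite mul1r add0r].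
  by rewrite mevalB (van x gx) meval1 sub0r => /eqP; rewrite oppr_eq0 oner_eq0.
have eb : b = a + b * E - 1 by rewrite {1}e1; ring.
have h1 : (1 : {mpoly F[n]}) \is 0.-homog by apply: dhomog1.
have hj j : gen g (pihomog mdeg (j * s) b + E ^+ j).
  elim: j => [|j IH].
    rewrite mul0n expr0 eb pihomogB pihomogD (pihomog_mulr _ _ hE) leqNgt s0 /= addr0.
    by rewrite (pihomog_homog _ h1) eqxx subrK; apply: (gen_pihomog _ hg ga).
  rewrite eb pihomogB pihomogD (pihomog_mulr _ _ hE) (pihomog_homog _ h1).
  have -> : (0 == j.+1 * s)%N = false by lia.
  have -> : (s <= j.+1 * s)%N by lia.
  have -> : (j.+1 * s - s = j * s)%N by lia.
  rewrite subr0 exprS -addrA [E * _]mulrC -mulrDl.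
  apply: (idealD (gen_ideal g)) => //; first exact: gen_pihomog hg ga.
  exact: (idealMr (gen_ideal g)).
exists (msize b); have := hj (msize b); rewrite pihomog_large ?add0r //.
by rewrite leq_pmulr.
Qed.

(** A monomial of large degree contains a high power of some variable, and such a power lies in the
    ideal. Taking the component of degree [M] gives the coefficients their exact degrees; the bound
    [d t <= M0] keeps [M - d t] from being truncated. *)
Lemma projective_nullstellensatz n (T : finType) (g : T -> {mpoly F[n]}) (d : T -> nat) :
  (forall t, g t \is (d t).-homog) ->
  (forall x, (forall t, (g t).@[x] = 0) -> forall j, x j = 0) ->
  exists M0, (forall t, d t <= M0)%N /\ forall M (m : 'X_{1..n}), (M0 <= M)%N -> mdeg m = M ->
    exists A, (forall t, A t \is (M - d t).-homog) /\ 'X_[m] = \sum_t A t * g t.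
Proof.
move=> hg van.
have hX i : exists N, gen g ('X_i ^+ N).
  apply: (hilbert_forms (s := 1) hg) => //; first by rewrite dhomogX /= mdeg1.
  by move=> x hx; rewrite mevalXU van.
have [N hN] := fin_all_exists hX.
pose N0 := \max_i N i.
exists (maxn (n * N0).+1 (\max_t d t)); split.
  by move=> t; rewrite leq_max leq_bigmax orbT.
move=> M m hM dm.
have [A eA] : gen g 'X_[m].
  have [i hi] : exists i, (N0 <= m i)%N.
    apply/existsP; apply: contraT; rewrite negb_exists => /forallP h.
    have : (mdeg m <= n * N0)%N.
      rewrite mdegE -[X in (_ <= X * _)%N]card_ord -sum_nat_const; apply: leq_sum => i _.
      by rewrite ltnW // ltnNge h.
    by move: hM; rewrite geq_max dm; lia.
  have -> : m = ((m - U_(i) *+ N i) + U_(i) *+ N i)%MM.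
    apply/mnmP => j; rewrite mnmDE mnmBE mulmnE mnm1E.
    case: eqP => [<-|_]; rewrite /= ?mul1n ?mul0n ?subn0 ?addn0 // subnK //.
    by apply: leq_trans hi; apply: leq_bigmax.
  by rewrite mpolyXD -mpolyXn; apply: (idealMl (gen_ideal g)).
exists (fun t => pihomog mdeg (M - d t) (A t)); split=> [t|]; first exact: pihomogP.
have := congr1 (pihomog mdeg M) eA.
have hm : ('X_[m] : {mpoly F[n]}) \is M.-homog by rewrite dhomogX /= dm.
rewrite (pihomog_homog _ hm) eqxx raddf_sum => ->; apply: eq_bigr => t _ /=.
rewrite (pihomog_mulr _ _ (hg t)) ifT //.
by apply: leq_trans hM; rewrite leq_max leq_bigmax orbT.
Qed.

(** Without a common zero, all monomials of some degree would be combinations of the [k] forms, and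
    [dependent_mod] would make the [n + 1] variables algebraically dependent. *)
Lemma forms_common_zero n k (g : 'I_k -> {mpoly F[n.+1]}) (d : 'I_k -> nat) :
  (k <= n)%N -> (forall t, g t \is (d t).-homog) -> (forall t, 0 < d t)%N ->
  exists x, (exists j, x j != 0) /\ forall t, (g t).@[x] = 0.
Proof.
move=> kn hg d0; apply: NNPP => no.
have van x : (forall t, (g t).@[x] = 0) -> forall j, x j = 0.
  move=> hx j; apply/eqP; apply: contraT => xj; case: no; exists x; split=> //; by exists j.
have [M0 [dM hM]] := projective_nullstellensatz hg van.
have I0 : is_ideal (fun p : {mpoly F[n.+1]} => p = 0).
  by split=> // [a b -> ->|a b ->]; rewrite ?addr0 ?mulr0.
have HM m : mdeg m = M0 -> exists B : 'I_k -> {mpoly F[n.+1]},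
    (forall j, msize (B j) <= M0)%N /\ 'X_[m] - \sum_j B j * g j = 0.
  move=> dm; have [A [hA eA]] := hM M0 m (leqnn _) dm; exists A; split; last by rewrite eA subrr.
  move=> j; apply: leq_trans (homog_msize_le (hA j)) _; have := d0 j; have := dM j; lia.
have [Phi [nz e]] := dependent_mod I0 HM (fun i : 'I_n.+1 => 'X_i) kn.
by move: nz; rewrite mmap_id in e; rewrite e eqxx.
Qed.

(** In a factorisation [J = A B] both factors are forms. If neither is a unit, then [A], [B] and the
    [n - 2] coordinates from [x_3] on are [n] forms of positive degree, so they share a point of the
    plane; there [J] and all its partial derivatives vanish. *)
Lemma form_prime n (J : {mpoly F[n.+1]}) c :
  (2 <= n)%N -> (0 < c)%N -> J != 0 -> J \is c.-homog ->
  (forall x, (forall j : 'I_n.+1, (3 <= j)%N -> x j = 0) -> (exists j, x j != 0) ->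
     J.@[x] = 0 -> exists j, (J^`M(j)).@[x] != 0) -> primer J.
Proof.
move=> n2 c0 J0 hJ smooth; apply: ufd_irreducible_prime => //; first exact: mpoly_ufd.
  apply/unitrPr => -[q e]; have q0 : q != 0.
    by apply/eqP => h; move/eqP: e; rewrite h mulr0 eq_sym oner_eq0.
  have := congr1 (fun w : {mpoly F[n.+1]} => msize w) e; rewrite msizeM // msize1 => sJ.
  have : (0 < msize J)%N by rewrite lt0n msize_poly_eq0.
  have : (0 < msize q)%N by rewrite lt0n msize_poly_eq0.
  move=> sq sJ0; have/msize1_polyC eJ : (msize J <= 1)%N.
    by move: sJ sq sJ0; move: (msize J) (msize q) => u w; lia.
  have h0 : J \is 0.-homog by rewrite eJ -[_%:MP]mulr1 mul_mpolyC; apply/dhomogZ/dhomog1.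
  by move: c0; rewrite (dhomog_uniq J0 hJ h0).
move=> A B eAB.
have [a hA] : exists e, A \is e.-homog by apply: (@homog_factor _ _ c _ B); rewrite -eAB.
have [b hB] : exists e, B \is e.-homog by apply: (@homog_factor _ _ c _ A); rewrite mulrC -eAB.
have hu (p : {mpoly F[n.+1]}) : p != 0 -> p \is 0.-homog -> p \is a GRing.unit.
  move=> p0 /homog_msize_le/msize1_polyC ep; apply/unitrPr; exists ((p@_0)^-1)%:MP.
  rewrite {1}ep -mpolyCM divff //; by apply: contraNneq p0 => h; rewrite ep h mpolyC0.
have [A0 B0] : A != 0 /\ B != 0.
  by move: J0; rewrite eAB mulf_eq0 negb_or => /andP.
have [ea|a0] := posnP a; first by left; apply: hu => //; rewrite ea in hA.
have [eb|b0] := posnP b; first by right; apply: hu => //; rewrite eb in hB.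
pose g (i : 'I_n) : {mpoly F[n.+1]} :=
  if val i == 0%N then A else if val i == 1%N then B else 'X_(inord i.+1).
pose dg (i : 'I_n) := if val i == 0%N then a else if val i == 1%N then b else 1%N.
have [|||x [[j xj] hx]] := @forms_common_zero n n g dg.
- by [].
- move=> i; rewrite /g /dg; case: ifP => // _; case: ifP => // _; by rewrite dhomogX /= mdeg1.
- by move=> i; rewrite /dg; case: ifP => // _; case: ifP.
have Ax : A.@[x] = 0 by have := hx (Ordinal (ltnW n2)).
have Bx : B.@[x] = 0 by have := hx (Ordinal n2).
have [|||k] := smooth x.
- move=> i hi; have hi1 : (i.-1 < n)%N by have := ltn_ord i; lia.
  have := hx (Ordinal hi1); rewrite /g /= ifN ?ifN; try lia.
  by rewrite prednK ?mevalXU ?inord_val //; lia.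
- by exists j.
- by rewrite eAB mevalM Ax mul0r.
by rewrite eAB mderivM mevalD !mevalM Ax Bx mulr0 mul0r addr0 eqxx.
Qed.

Lemma form_vanish_dvd n (J : {mpoly F[n]}) c E s :
  primer J -> J \is c.-homog -> E \is s.-homog -> (0 < s)%N ->
  (forall x, J.@[x] = 0 -> E.@[x] = 0) -> dvdr J E.
Proof.
move=> pJ hJ hE s0 van.
have [||N [A]] := @hilbert_forms n unit (fun=> J) (fun=> c) E s _ hE s0; first by [].
  by move=> x hx; apply: van; apply: (hx tt).
rewrite (bigD1 tt) //= big1 ?addr0 => [|[]] // e.
have : dvdr J (E ^+ N) by exists (A tt).
have [_ nu pM] := pJ; elim: N {e} => [|N IH]; last by rewrite exprS => /pM[].
by case=> u e; case/negP: nu; apply/unitrPr; exists u; rewrite mulrC -e.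
Qed.

End ProjectiveNullstellensatz.

(** * Normality of the critical cone *)

Lemma mpoly_ring_ind n (R : comNzRingType) (P : {mpoly R[n]} -> Prop) :
  (forall c, P c%:MP) -> (forall i, P 'X_i) ->
  (forall p q, P p -> P q -> P (p + q)) -> (forall p q, P p -> P q -> P (p * q)) ->
  forall p, P p.
Proof.
move=> hC hX hD hM; elim/mpolyind => [|c m p _ _ IH]; first by rewrite -mpolyC0.
apply: (hD) => //; rewrite -mul_mpolyC; apply: (hM) => //; rewrite mpolyXE_id.
apply: (big_ind P) => //; first by rewrite -mpolyC1.
by move=> i _; elim: (m i) => [|k IHk]; rewrite ?exprS ?expr0 -?mpolyC1 //; apply: hM.
Qed.

Lemma derivation_eq n (R S : comNzRingType) (h : {mpoly R[n]} -> S) (D1 D2 : {mpoly R[n]} -> S) :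
  (forall p q, D1 (p + q) = D1 p + D1 q) -> (forall p q, D2 (p + q) = D2 p + D2 q) ->
  (forall p q, D1 (p * q) = D1 p * h q + h p * D1 q) ->
  (forall p q, D2 (p * q) = D2 p * h q + h p * D2 q) ->
  (forall c, D1 c%:MP = D2 c%:MP) -> (forall i, D1 'X_i = D2 'X_i) -> D1 =1 D2.
Proof.
move=> a1 a2 m1 m2 hC hX; elim/mpoly_ring_ind => // p q ep eq.
  by rewrite a1 a2 ep eq.
by rewrite m1 m2 ep eq.
Qed.

Lemma mderivXU n (R : comNzRingType) (i j : 'I_n) :
  ('X_i)^`M(j) = (i == j)%:R :> {mpoly R[n]}.
Proof.
rewrite mderivX mnm1E; case: eqP => [->|_]; last by rewrite scale0r.
have -> : (U_(j) - U_(j))%MM = 0%MM by apply/mnmP => k; rewrite mnmBE mnm0E subnn.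
by rewrite scale1r mpolyX0.
Qed.

Lemma deriv_rho (F : fieldType) n (v : 'I_n -> F) (p : {mpoly F[n.+1]}) :
  (rho v p)^`() = rho v (\sum_j (dirvec v j)%:MP * p^`M(j)).
Proof.
move: p; apply: (derivation_eq (h := rho v)).
- by move=> p q; rewrite rmorphD derivD.
- move=> p q; rewrite -rmorphD -big_split; congr (rho v _); apply: eq_bigr => j _.
  by rewrite mderivD mulrDr.
- by move=> p q; rewrite rmorphM derivM.
- move=> p q.
  have -> : \sum_j (dirvec v j)%:MP * (p * q)^`M(j) =
    (\sum_j (dirvec v j)%:MP * p^`M(j)) * q + p * (\sum_j (dirvec v j)%:MP * q^`M(j)).
    rewrite mulr_suml mulr_sumr -big_split; apply: eq_bigr => j _ /=.
    by rewrite mderivM; ring.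
  by rewrite rmorphD !rmorphM.
- by move=> c; rewrite rhoC derivC big1 ?rmorph0 // => j _; rewrite mderivC mulr0.
move=> i; rewrite rhoX (bigD1 i) //= mderivXU eqxx mulr1 big1 ?addr0; last first.
  by move=> j ji; rewrite mderivXU eq_sym (negPf ji) mulr0.
rewrite rhoC /rho_var /dirvec; case: unliftP => [k _|_]; last by rewrite derivX mpolyC1 polyC1.
by rewrite derivD derivC add0r derivM derivC derivX mul0r add0r mulr1.
Qed.

Section Shifts.
Variables (F : closedFieldType) (n : nat).

Let shift (i : 'I_n) : {rmorphism {mpoly F[n]} -> {poly {mpoly F[n]}}} :=
  mmap (polyC \o @mpolyC n F) (fun k => ('X_k)%:P + (k == i)%:R * 'X).

Let shift_eval i p x t : (map_poly (meval x) (shift i p)).[t] =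
  p.@[fun k => x k + (k == i)%:R * t].
Proof.
have /= := @rmorph_mpolyP _ _ _ (horner_eval t \o map_poly (meval x) \o shift i)
  (meval (fun k => x k + (k == i)%:R * t)) _ _ p; apply.
  by move=> c; rewrite /= mevalC mmapC /= /horner_eval map_polyC /= mevalC hornerC.
move=> j; rewrite /= mevalXU mmap_XU /horner_eval rmorphD rmorphM /= map_polyC map_polyX /=.
by rewrite mevalXU rmorph_nat hornerD hornerM hornerC hornerX -polyC_natr hornerC.
Qed.

Let shift_size1 i p : (size (shift i p) <= 1)%N ->
  forall x t, p.@[fun k => x k + (k == i)%:R * t] = p.@[x].
Proof.
move=> s x t; rewrite -shift_eval; transitivity (map_poly (meval x) (shift i p)).[0].
  by rewrite (size1_polyC s) map_polyC !hornerC.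
by rewrite shift_eval; apply: meval_eq => k; rewrite mulr0 addr0.
Qed.

(** A divisor of a nonzero polynomial free of [X_i] is itself free of [X_i]: translate [X_i] by a
    new variable and compare degrees in it. *)
Lemma dvdr_free_const (p : {mpoly F[n]}) :
  (forall i, exists2 Phi : {mpoly F[n.-1]}, Phi != 0 &
     dvdr p (cmp (fun k => 'X_(lift i k)) Phi)) -> p != 0 -> p \is a GRing.unit.
Proof.
move=> h p0.
have hs i : (size (shift i p) <= 1)%N.
  have [Phi Phi0 [q e]] := h i; set Psi := mmap _ _ _ in e.
  have Psi0 : Psi != 0.
    have [x hx] := nonzero_eval Phi0; apply/eqP => h0; move/eqP: hx; apply.
    have := congr1 (meval (fun k => if unlift i k is Some l then x l else 0)) h0.
    rewrite meval0 /Psi /meval rmorph_mmap /= => <-; apply: mmap_ext => [c|k] /=.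
      by rewrite mmapC.
    by rewrite mmap_XU liftK.
  have ePsi : shift i Psi = Psi%:P.
    rewrite /Psi [shift i _]rmorph_mmap [RHS]rmorph_mmap; apply: mmap_ext => [c|k] /=.
      by rewrite mmapC.
    by rewrite mmap_XU eq_sym (negPf (neq_lift _ _)) mul0r addr0.
  have : shift i q * shift i p = Psi%:P by rewrite -rmorphM -e.
  move: (shift i q) (shift i p) => a b eab.
  have ab0 : a * b != 0 by rewrite eab polyC_eq0.
  have [a0 b0] : a != 0 /\ b != 0 by move: ab0; rewrite mulf_eq0 negb_or => /andP.
  have := size_polyC Psi; rewrite -eab size_mul // Psi0 /=.
  by move: a0 b0; rewrite -!size_poly_eq0; move: (size a) (size b) => u w; lia.
have inv x : p.@[x] = p.@[fun=> 0].
  have step k : (k <= n)%N -> p.@[fun j : 'I_n => if (j < k)%N then x j else 0] = p.@[fun=> 0].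
    elim: k => [|k IH] hk; first exact: meval_eq.
    rewrite -IH; last exact: ltnW.
    rewrite -[RHS](shift_size1 (hs (Ordinal hk)) _ (x (Ordinal hk))); apply: meval_eq => j.
    rewrite -val_eqE /= ltnS leq_eqVlt; case: eqP => [ej|_] /=; last by rewrite mul0r addr0.
    by rewrite ej ltnn add0r mul1r; congr x; apply/val_inj.
  rewrite -(step n) //; apply: meval_eq => j; by rewrite ltn_ord.
have ep : p = (p.@[fun=> 0])%:MP.
  apply/eqP; rewrite -subr_eq0; apply: contraT => /nonzero_eval [x].
  by rewrite mevalB mevalC inv subrr eqxx.
apply/unitrPr; exists ((p.@[fun=> 0])^-1)%:MP; rewrite {1}ep -mpolyCM divff //.
by apply: contraNneq p0 => h0; rewrite ep h0 mpolyC0.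
Qed.

(** A prime factor of [q] that does not divide [w] would divide a nonzero polynomial free of [X_i]
    for every [i], hence be a constant. This is the two-codimensional extension property of
    polynomial rings. *)
Lemma dvdr_of_free_multiples (q : {mpoly F[n]}) (w : {poly {mpoly F[n]}}) : q != 0 ->
  (forall i, exists2 Phi : {mpoly F[n.-1]}, Phi != 0 &
     dvdr q%:P ((cmp (fun k => 'X_(lift i k)) Phi)%:P * w)) -> dvdr q%:P w.
Proof.
move=> q0; have := ufd_factors (mpoly_ufd F n) q0; move=> fq.
elim: fq w {q0} => [u uu|p q' pp _ IH] w h.
  by exists ((u^-1)%:P * w); rewrite mulrC mulrA -polyCM divrr // mul1r.
have [p0 nup _] := pp; have [_ _ pM] := primer_polyC pp.
have p0' : p%:P != 0 by rewrite polyC_eq0.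
have [[w' ew]|ndw] := classic (dvdr p%:P w).
  have [i|w'' ew''] := IH w'.
    have [Phi Phi0 [z ez]] := h i; exists Phi => //; exists z; apply: (mulfI p0').
    by rewrite polyCM in ez; rewrite mulrCA [_ * w']mulrC -ew ez; ring.
  by exists w''; rewrite ew ew'' polyCM; ring.
case/negP: nup; apply: dvdr_free_const => // i.
have [Phi Phi0 [z ez]] := h i; exists Phi => //.
have : dvdr p%:P ((cmp (fun k => 'X_(lift i k)) Phi)%:P * w).
  by rewrite ez polyCM; exists (z * q'%:P); ring.
case/pM => // -[y ey]; exists y`_0.
by have := congr1 (fun r : {poly _} => r`_0) ey; rewrite /= coefC eqxx coefMC.
Qed.

End Shifts.

(** Here [m] stands for the norm of [a] and [s] for the cofactor with [m = s a] modulo [J]; each of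
    the four terms on the right is divisible by [J] where the identity is applied. *)
Lemma depth_two_identity (A : comNzRingType) (p w m e u s b a : A) :
  p * w - m * e = - (p * (u * s - w)) + s * (p * u - b * a) + m * (b - e) - b * (m - s * a).
Proof. by ring. Qed.

Lemma depth_two_identity' (A : comNzRingType) (m u s q a : A) :
  s * (u - q * a) = u * s - q * m + q * (m - s * a).
Proof. by ring. Qed.

Section LineProjection.
Variables (F : closedFieldType) (n c : nat) (J : {mpoly F[n.+1]}) (v : 'I_n -> F).
Hypotheses (pJ : primer J) (hJ : J \is c.-homog) (c0 : (0 < c)%N) (Jv : J.@[dirvec v] != 0).

Lemma rho_dvdr p q : dvdr (rho v p) (rho v q) <-> dvdr p q.
Proof.
split=> -[a e]; last by exists (rho v a); rewrite e rmorphM.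
by exists (unrho v a); rewrite -[q](rhoK v) e rmorphM rhoK.
Qed.

Lemma size_rho_form : size (rho v J) = c.+1.
Proof.
have [s t] := rho_top_homog v hJ; apply/eqP; rewrite eqn_leq s ltnNge; apply/negP => h.
by move/eqP: t; rewrite nth_default // eq_sym mpolyC_eq0 (negPf Jv).
Qed.

Definition monic_form := ((J.@[dirvec v])^-1%:MP)%:P * rho v J.

Lemma size_monic_form : size monic_form = c.+1.
Proof.
by rewrite /monic_form mul_polyC size_scale ?size_rho_form // mpolyC_eq0 invr_eq0.
Qed.

Lemma monic_monic_form : monic_form \is monic.
Proof.
have [_ t] := rho_top_homog v hJ.
by rewrite monicE lead_coefE size_monic_form coefCM t -mpolyCM mulVf.
Qed.

Lemma dvdr_monic_form q : dvdr monic_form q <-> dvdr (rho v J) q.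
Proof.
split=> -[a ->]; first by exists (a * ((J.@[dirvec v])^-1%:MP)%:P); rewrite -mulrA.
exists (a * ((J.@[dirvec v])%:MP)%:P).
have e : ((J.@[dirvec v])%:MP)%:P * ((J.@[dirvec v])^-1%:MP)%:P = 1 :> {poly {mpoly F[n]}}.
  by rewrite -polyCM -mpolyCM divff.
by rewrite -mulrA /monic_form [_ * (_ * rho v J)]mulrA e mul1r.
Qed.

Lemma primer_rho : primer (rho v J).
Proof.
have [J0 nu pM] := pJ; split.
- by rewrite -size_poly_eq0 size_rho_form.
- by rewrite poly_unitE size_rho_form; case: (c) c0.
move=> a b; rewrite -[a](unrhoK v) -[b](unrhoK v) -rmorphM => /rho_dvdr/pM.
by case=> h; [left|right]; apply/rho_dvdr.
Qed.

Lemma small_multiple_rho q : dvdr (rho v J) q -> (size q <= c)%N -> q = 0.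
Proof.
move=> [a ->] s; have [->|a0] := eqVneq a 0; first by rewrite mul0r.
have r0 : rho v J != 0 by rewrite -size_poly_eq0 size_rho_form.
move: s; rewrite size_mul // size_rho_form; move: a0; rewrite -size_poly_eq0.
by move: (size a) => k; lia.
Qed.

Lemma reduce_mod_form p : exists2 w : {poly {mpoly F[n]}}, (size w <= c)%N & dvdr (rho v J) (p - w).
Proof.
exists (Pdiv.Ring.rmodp p monic_form).
  by rewrite -ltnS -size_monic_form Pdiv.Ring.ltn_rmodpN0 // monic_neq0 // monic_monic_form.
apply/dvdr_monic_form; exists (Pdiv.Ring.rdivp p monic_form).
by rewrite {1}(Pdiv.RingMonic.rdivp_eq monic_monic_form p) addrK.
Qed.

(** [N] is the norm of [a], the determinant of multiplication by [a] on the free module S/(J). It is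
    a multiple of [a] by [det_trick]. It is nonzero because a vector in the kernel of the matrix
    would be a polynomial [W] of degree below [c] with [J] dividing [W a]. *)
Lemma norm_mod_form a : ~ dvdr J a -> exists (N : {mpoly F[n]}) b, N != 0 /\
  dvdr (rho v J) (N%:P - b * rho v a).
Proof.
move=> nJa.
have [M hM] := mul_matrix_mod_monic (rho v a) monic_monic_form size_monic_form.
pose I p := exists b, dvdr (rho v J) (p - b * rho v a).
have II : is_ideal I.
  split; first by exists 0; rewrite mul0r subrr; apply: ideal0 (dvdr_ideal _).
    move=> p q [b hb] [b' hb']; exists (b + b'); rewrite mulrDl opprD addrACA.
    exact: (idealD (dvdr_ideal _)).
  by move=> p q [b hb]; exists (p * b); rewrite -mulrA -mulrBr; apply: dvdr_mull.
have hI i : I (\sum_j (map_mx polyC M) i j * 'X^j).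
  exists 'X^i; have/dvdr_monic_form h := hM i.
  rewrite -[X in dvdr _ X]opprK opprB; apply: (idealN (dvdr_ideal _)); rewrite mulrC.
  by rewrite (eq_bigr (fun j => (M i j)%:P * 'X^j)) // => j _; rewrite mxE.
have := det_trick II hI (Ordinal c0); rewrite expr0 mulr1 det_map_mx => -[b hb].
exists (\det M), b; split=> //; apply/negP => /det0P [w w0 wM].
have [_ _ pM] := primer_rho.
pose W : {poly {mpoly F[n]}} := \sum_i (w 0 i)%:P * 'X^i.
have Wk (k : 'I_c) : W`_k = w 0 k.
  rewrite /W coef_sum (bigD1 k) //= coefCM coefXn eqxx mulr1 big1 ?addr0 // => i ik.
  by rewrite coefCM coefXn [_ == _ :> nat]eq_sym val_eqE (negPf ik) mulr0.
have : dvdr (rho v J) (W * rho v a).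
  have -> : W * rho v a = \sum_i (w 0 i)%:P * (rho v a * 'X^i - \sum_j (M i j)%:P * 'X^j).
    rewrite (eq_bigr (fun i => (w 0 i)%:P * (rho v a * 'X^i) -
        \sum_j (w 0 i * M i j)%:P * 'X^j)); last first.
      move=> i _; rewrite mulrBr; congr (_ - _); rewrite mulr_sumr.
      by apply: eq_bigr => j _; rewrite polyCM mulrA.
    rewrite sumrB [X in _ - X]exchange_big [X in _ - X]big1 ?subr0.
      by rewrite /W mulr_suml; apply: eq_bigr => i _; ring.
    move=> j _; rewrite -mulr_suml -rmorph_sum /=.
    have := congr1 (fun r : 'rV_ _ => r 0 j) wM; rewrite !mxE => ->.
    by rewrite polyC0 mul0r.
  apply: (ideal_sum (dvdr_ideal _)) => i _; apply: dvdr_mull; exact/dvdr_monic_form.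
case/pM => [hW|/rho_dvdr //].
case/negP: w0; apply/eqP/rowP => k; rewrite mxE -Wk (small_multiple_rho hW) ?coef0 //.
apply: leq_trans (size_sum _ _ _) _; apply/bigmax_leqP => i _.
by rewrite mul_polyC; apply: leq_trans (size_scale_leq _ _) _; rewrite size_polyXn.
Qed.

(* [S/(J)] is free over the coordinate ring of the hyperplane, so a fraction
   whose denominators have no common prime divisor is regular. *)
Lemma depth_two K (y : 'I_K -> {mpoly F[n.+1]}) M u a :
  ~ dvdr J a -> (K < n.-1)%N ->
  (forall m : 'X_{1..n.+1}, mdeg m = M -> exists B : 'I_K -> {mpoly F[n.+1]},
     (forall j, msize (B j) <= M)%N /\
     exists b, dvdr J (('X_[m] - \sum_j B j * y j) * u - b * a)) ->
  exists b, dvdr J (u - b * a).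
Proof.
move=> nJa Kn HM.
pose Q p := exists b, dvdr J (p * u - b * a).
have QI : is_ideal Q.
  split; first by exists 0; rewrite !mul0r subrr; apply: ideal0 (dvdr_ideal _).
    move=> p q [b hb] [b' hb']; exists (b + b').
    by rewrite !mulrDl opprD addrACA; apply: (idealD (dvdr_ideal _)).
  by move=> p q [b hb]; exists (p * b); rewrite -!mulrA -mulrBr; apply: dvdr_mull.
have [N [ast [N0 hN]]] := norm_mod_form nJa.
have [w sw hw] := reduce_mod_form (rho v u * ast).
have dI := dvdr_ideal (rho v J).
(* On the cone [u / a] equals [w / N]. The [n - 1] coordinates of the hyperplane other than the
   [i]-th satisfy a relation [Phi] modulo [Q], so [Phi w / N] is regular; as S/(J) is free, [N]
   divides [Phi w] itself. *)
have hi (i : 'I_n) : exists2 Phi : {mpoly F[n.-1]}, Phi != 0 &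
    dvdr N%:P ((cmp (fun k => 'X_(lift i k)) Phi)%:P * w).
  have [Phi [Phi0 [b hb]]] := dependent_mod QI HM
    (fun k : 'I_n.-1 => unrho v ('X_(lift i k))%:P) Kn.
  exists Phi => //; set P := mmap _ _ Phi.
  have eP : cmp (fun k => unrho v ('X_(lift i k))%:P) Phi = unrho v P%:P.
    rewrite /P -[unrho v _]/((unrho v \o polyC) _) rmorph_mmap; apply: mmap_ext => [z|k] //=.
    by rewrite unrhoC mmapC.
  rewrite eP in hb; move/rho_dvdr: hb; rewrite rmorphB !rmorphM unrhoK => hb.
  have [B sB hB] := reduce_mod_form (rho v b).
  suff e : P%:P * w - N%:P * B = 0.
    by exists B; rewrite mulrC; apply/eqP; rewrite -subr_eq0 [B * _]mulrC [w * _]mulrC e.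
  apply: small_multiple_rho; last first.
    apply: leq_trans (size_polyD _ _) _; rewrite size_polyN geq_max !mul_polyC.
    by rewrite !(leq_trans (size_scale_leq _ _)).
  rewrite (depth_two_identity _ _ _ _ (rho v u) ast (rho v b) (rho v a)).
  apply: (idealB dI); last exact: dvdr_mull.
  apply: (idealD dI); last exact: dvdr_mull.
  apply: (idealD dI); last exact: dvdr_mull.
  apply: (idealN dI); exact: dvdr_mull.
have [s es] := dvdr_of_free_multiples N0 hi.
exists (unrho v s); apply/rho_dvdr; rewrite rmorphB rmorphM unrhoK.
have [_ _ pM] := primer_rho.
have : dvdr (rho v J) (ast * (rho v u - s * rho v a)).
  have -> : ast * (rho v u - s * rho v a) = (rho v u * ast - w) + s * (N%:P - ast * rho v a).
    by rewrite es; apply: depth_two_identity'.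
  apply: (idealD dI) => //; exact: dvdr_mull.
case/pM => // hast; case/negP: N0; apply/eqP.
have h : dvdr (rho v J) N%:P.
  rewrite -[N%:P](subrK (ast * rho v a)); apply: (idealD dI) => //; exact: dvdr_mulr.
have := small_multiple_rho h; rewrite size_polyC => h'.
by apply/eqP; rewrite -polyC_eq0; apply/eqP; apply: h'; case: (_ != _).
Qed.

End LineProjection.

(** [X] is an eigenvector for [y], normalised by [X i0 = 1], so that the determinant trick kills the
    characteristic polynomial itself and not only a multiple of it. *)
Lemma charpoly_root (A B : comNzRingType) (f : {rmorphism A -> B}) e (M : 'M[A]_e)
    (y : B) (X : 'I_e -> B) i0 :
  X i0 = 1 -> (forall i, y * X i = \sum_j f (M i j) * X j) ->
  (map_poly f (char_poly M)).[y] = 0.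
Proof.
move=> X1 hX; rewrite map_char_poly /char_poly.
rewrite -[LHS]/(horner_eval y _) -det_map_mx -[LHS]mulr1 -X1.
have I0 : is_ideal (fun p : B => p = 0).
  by split=> // [a b -> ->|a b ->]; rewrite ?addr0 ?mulr0.
apply: (det_trick I0) => i.
rewrite (eq_bigr (fun j => (y *+ (i == j)) * X j - f (M i j) * X j)); last first.
  move=> j _; rewrite /char_poly_mx !mxE rmorphB /= /horner_eval hornerC -mulrBl; congr ((_ - _) * _).
  by case: eqP => _; rewrite ?mulr1n ?hornerX // mulr0n horner0.
rewrite sumrB -hX (bigD1 i) //= eqxx mulr1n big1 ?addr0 ?subrr // => j ji.
by rewrite eq_sym (negPf ji) mulr0n mul0r.
Qed.

(** [xi] acts as a minimal polynomial. A relation [eta] that it does not divide over the fraction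
    field would be coprime to it there, and Bezout would send a nonzero constant to zero. *)
Lemma prime_size_le (A B : idomainType) (ev : {rmorphism {poly A} -> B}) (xi eta : {poly A}) :
  (forall c, ev c%:P = 0 -> c = 0) -> primer xi -> ev xi = 0 -> ev eta = 0 -> eta != 0 ->
  (size xi <= size eta)%N.
Proof.
move=> inj [xi0 nu pM] exi eeta eta0.
have [d|nd] := boolP (xi %| eta); first exact: dvdp_leq.
have/Pdiv.Idomain.dvdpP [[r q] /= r0 e] := dvdp_gcdl xi eta.
have g0 : gcdp xi eta != 0 by rewrite gcdp_eq0 (negPf xi0).
have dv a : dvdr xi a -> xi %| a by case=> b ->; apply: dvdp_mull.
have : dvdr xi (q * gcdp xi eta) by rewrite -e -mul_polyC; exists r%:P.
case/pM => h; last first.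
  by case/negP: nd; apply: dvdp_trans (dv _ h) (dvdp_gcdr _ _).
have q0 : q != 0.
  apply/eqP => h0; move/eqP: e; rewrite h0 mul0r -mul_polyC mulf_eq0 polyC_eq0.
  by rewrite (negPf r0) (negPf xi0).
have sq := dvdp_leq q0 (dv _ h).
have := congr1 (fun w : {poly A} => size w) e; rewrite /= size_scale // size_mul // => es.
have sg : size (gcdp xi eta) = 1%N.
  move: g0 q0; rewrite -!size_poly_eq0; move: es sq.
  move: (size q) (size xi) (size (gcdp xi eta)) => a b k; lia.
have [[u1 u2] /= hb] := Bezoutp xi eta.
have sz : size (u1 * xi + u2 * eta) = 1%N by rewrite (eqp_size hb).
have/eqP/size_poly1P [z z0 ez] := sz.
case/eqP: z0; apply: inj; rewrite -ez rmorphD !rmorphM exi eeta !mulr0 addr0 //.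
Qed.

(** * The derivative of the equation as a conductor *)

Section Slices.
Variables (R K : comNzRingType) (f : {rmorphism R -> K}) (x t : K).

(** The coefficients of [q] are polynomials in an auxiliary variable [l]; the slice keeps the
    coefficient of [l^k] in each. *)
Definition slice k (q : {poly {poly R}}) : {poly R} := \poly_(i < size q) (q`_i)`_k.

Lemma coef_slice k q i : (slice k q)`_i = (q`_i)`_k.
Proof. by rewrite coef_poly; case: ltnP => // h; rewrite [q`_i]nth_default ?coef0. Qed.

Lemma slice_coef01 (q : {poly {poly R}}) (e := (map_poly (map_poly f) q).[x%:P + t%:P * 'X]) :
  e`_0 = (map_poly f (slice 0 q)).[x] /\
  e`_1 = (map_poly f (slice 1 q)).[x] + t * ((map_poly f (slice 0 q))^`()).[x].
Proof.
rewrite {}/e; elim/poly_ind: q => [|q c [IH0 IH1]].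
  have s0 k : slice k 0 = 0 by apply/polyP => i; rewrite coef_slice !coef0.
  by rewrite !s0 !rmorph0 deriv0 !horner0 !coef0 mulr0 addr0.
have sl k : slice k (q * 'X + c%:P) = slice k q * 'X + (c`_k)%:P.
  apply/polyP => i; rewrite coef_slice !coefD !coefMX !coefC coef_slice.
  by case: (i == 0)%N; rewrite ?coef0 // coefD.
have em : map_poly (map_poly f) (q * 'X + c%:P) =
    map_poly (map_poly f) q * 'X + (map_poly f c)%:P.
  by rewrite rmorphD rmorphM /= map_polyX map_polyC.
have es k : map_poly f (slice k q * 'X + (c`_k)%:P) =
    map_poly f (slice k q) * 'X + (f c`_k)%:P.
  by rewrite rmorphD rmorphM /= map_polyX map_polyC.
rewrite !sl em !es !hornerMXaddC; set E := _.[_] in IH0 IH1 *.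
have E0 : (E * (x%:P + t%:P * 'X))`_0 = E`_0 * x.
  by rewrite coef0M coefD coefC coefCM coefX mulr0 addr0.
have E1 : (E * (x%:P + t%:P * 'X))`_1 = E`_1 * x + E`_0 * t.
  rewrite mulrDr coefD coefMC mulrA coefMX coefMC //.
rewrite !coefD E0 E1 !coef_map IH0 IH1; split=> //.
rewrite derivD derivC addr0 derivM derivX mulr1 hornerD hornerM hornerX /=; ring.
Qed.

End Slices.

Section Conductor.
Variables (F : closedFieldType) (n c : nat) (J : {mpoly F[n.+1]}) (v : 'I_n -> F).
Hypotheses (pJ : primer J) (hJ : J \is c.-homog) (c0 : (0 < c)%N) (Jv : J.@[dirvec v] != 0).
Variables (K : fieldType) (phi : {rmorphism {mpoly F[n.+1]} -> K}).
Hypothesis kerphi : forall p, phi p = 0 <-> dvdr J p.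

Local Notation R := {mpoly F[n]}.
Let iota : {rmorphism R -> K} := phi \o unrho v \o polyC.
Let x : K := phi 'X_ord_max.

Let phi_unrho (q : {poly R}) : phi (unrho v q) = (map_poly iota q).[x].
Proof.
elim/poly_ind: q => [|q r IH]; first by rewrite !rmorph0 horner0.
rewrite rmorphD rmorphM [in LHS]rmorphD [in LHS]rmorphM unrhoX IH.
have -> : map_poly iota (q * 'X + r%:P) = map_poly iota q * 'X + (iota r)%:P.
  by rewrite rmorphD rmorphM /= map_polyX map_polyC.
by rewrite hornerMXaddC.
Qed.

Let iota_inj r : iota r = 0 -> r = 0.
Proof.
move/kerphi/rho_dvdr => /(_ v); rewrite unrhoK => h.
have := small_multiple_rho hJ c0 Jv h; rewrite size_polyC => h'.
by apply/eqP; rewrite -polyC_eq0; apply/eqP; apply: h'; case: (_ != _).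
Qed.

Let int_x : integralOver iota x.
Proof.
exists (monic_form J v); first exact: monic_monic_form hJ Jv.
rewrite /root -phi_unrho; apply/eqP/kerphi/(rho_dvdr v); rewrite unrhoK.
by exists (((J.@[dirvec v])^-1%:MP)%:P).
Qed.

Let int_phi p : integralOver iota (phi p).
Proof.
rewrite -[p](rhoK v) phi_unrho; apply: integral_horner int_x.
by apply/integral_poly => i; rewrite coef_map; apply: integral_id.
Qed.

Let int_lift z : integralOver iota z -> integralOver (map_poly iota) z%:P.
Proof.
case=> p mp rp; exists (map_poly polyC p); first exact: monic_map.
have -> : map_poly (map_poly iota) (map_poly polyC p) = map_poly polyC (map_poly iota p).
  by apply/polyP => i; rewrite !coef_map /= map_polyC.
by rewrite /root horner_map (eqP rp).
Qed.

(** [s0] vanishes on the cone and has degree at most [c], so it is a constant multiple of [J], and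
    the constant is a unit because one coefficient of [s0] is. Its derivative is then that unit
    times the directional derivative of [J], and the second relation expresses [t] times the latter
    by [s1]. *)
Let conductor_of_relation (s0 s1 : {poly R}) t m :
  phi (unrho v s0) = 0 -> phi (unrho v s1) + t * phi (unrho v s0^`()) = 0 ->
  (size s0 <= c.+1)%N -> s0`_m \is a GRing.unit ->
  exists w, phi w = t * phi (\sum_j (dirvec v j)%:MP * J^`M(j)).
Proof.
move=> h0 h1 ss0 um.
have [k ek] : exists k : {poly R}, s0 = k * rho v J.
  have : dvdr (rho v J) s0 by rewrite -[s0](unrhoK v); apply/rho_dvdr/kerphi.
  by case=> k ek; exists k.
have s00 : s0 != 0.
  by apply/eqP => h; move: um; rewrite h coef0 unitr0.
have k0 : k != 0 by apply/eqP => h; case/eqP: s00; rewrite ek h mul0r.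
have rJ0 : rho v J != 0 by rewrite -size_poly_eq0 (size_rho_form hJ Jv).
have sk : size k = 1%N.
  have := size_mul k0 rJ0; rewrite -ek (size_rho_form hJ Jv) => es.
  by move: ss0 k0; rewrite es -size_poly_eq0; move: (size k) => p; lia.
have ek0 : k = (k`_0)%:P by apply: size1_polyC; rewrite sk.
have uk : k`_0 \is a GRing.unit.
  have es0 : s0 = (k`_0)%:P * rho v J by rewrite -ek0.
  by move: um; rewrite es0 coefCM unitrM => /andP[].
have ed : s0^`() = (k`_0)%:P * (rho v J)^`() by rewrite ek {1}ek0 derivM derivC mul0r add0r.
rewrite ed deriv_rho rmorphM rhoK rmorphM in h1.
exists (- unrho v (((k`_0)^-1)%:P * s1)).
rewrite rmorphN rmorphM rmorphM; move/eqP: h1; rewrite addr_eq0 => /eqP ->.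
set d := phi (\sum_j _); rewrite mulrN opprK mulrCA mulrA.
have e1 : phi (unrho v ((k`_0)^-1)%:P) * phi (unrho v (k`_0)%:P) = 1.
  have -> : 1 = phi (unrho v (((k`_0)^-1)%:P * (k`_0)%:P)) by rewrite -polyCM mulVr // !rmorph1.
  by rewrite [unrho v (_ * _)]rmorphM rmorphM.
by rewrite -mulrA [_ * (_ * d)]mulrA e1 mul1r.
Qed.

(* Dedekind's theorem that the derivative of the defining polynomial lies in the
   conductor: with [xi] the minimal polynomial of [x + l t] over [R[l]], compare
   the coefficients of [l] in [xi (x + l t) = 0]. *)
Lemma conductor t u a :
  integralOver phi t -> ~ dvdr J a -> t * phi a = phi u ->
  exists w, phi w = t * phi (\sum_j (dirvec v j)%:MP * J^`M(j)).
Proof.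
move=> [P0 mP0 rP0] nJa hta.
have int_t : integralOver iota t.
  apply: (integral_root_monic (p := map_poly phi P0)) rP0 _; first exact: monic_map.
  by apply/integral_poly => i; rewrite coef_map; apply: int_phi.
pose iotal : {rmorphism {poly R} -> {poly K}} := map_poly iota.
pose z : {poly K} := x%:P + t%:P * 'X.
have [P mP rP] : integralOver iotal z.
  apply: integral_add; first exact: int_lift.
  apply: integral_mul; first exact: int_lift.
  by rewrite -(map_polyX iota); apply: (integral_id iotal).
pose ev : {rmorphism {poly {poly R}} -> {poly K}} := horner_eval z \o map_poly iotal.
have evE q : ev q = (map_poly (map_poly iota) q).[z] by [].
have [xi pxi [[eP eeP] exi]] : exists2 xi, primer xi & dvdr xi P /\ ev xi = 0.
  apply: prime_divides_factor; last by rewrite evE; apply/eqP.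
  by apply: ufd_factors (monic_neq0 mP); apply/poly_ufd/poly_ufd/mpoly_ufd.
have [xi0 _ _] := pxi.
have ulead : lead_coef xi \is a GRing.unit.
  by apply/unitrPr; exists (lead_coef eP); rewrite mulrC -lead_coefM -eeP (monicP mP).
have inj_ev s : ev s%:P = 0 -> s = 0.
  rewrite evE map_polyC hornerC => h; apply/polyP => i; rewrite coef0; apply: iota_inj.
  by have := congr1 (fun w : {poly K} => w`_i) h; rewrite coef_map coef0.
(* With [N] the norm of [a], the element [N t] is the value of a polynomial [w0], so
   [N z = N x + l N t] is the value of [G]. Multiplication by [G] modulo the equation, which has
   degree [c], has a characteristic polynomial of degree [c], and it gives a relation for [z] of
   that degree. *)
have sxi : (size xi <= c.+1)%N.
  have [N [b [N0 hN]]] := norm_mod_form pJ hJ c0 Jv nJa.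
  pose w0 := unrho v b * u.
  have hw0 : iota N * t = phi w0.
    have : phi (unrho v (N%:P - b * rho v a)) = 0.
      by apply/kerphi/(rho_dvdr v); rewrite unrhoK.
    rewrite !rmorphB !rmorphM rhoK => /eqP; rewrite subr_eq0 => /eqP h.
    by rewrite -[iota N]/(phi (unrho v N%:P)) h -hta [t * _]mulrC mulrA.
  clearbody w0.
  pose G : {poly {poly R}} := (N%:P)%:P * 'X + 'X%:P * map_poly polyC (rho v w0).
  pose fA : {poly {poly R}} := map_poly polyC (monic_form J v).
  have mfA : fA \is monic by apply: monic_map; apply: monic_monic_form hJ Jv.
  have sfA : size fA = c.+1.
    by rewrite size_map_inj_poly ?polyC0 ?(size_monic_form hJ Jv) //; apply: polyC_inj.
  have [M hM] := mul_matrix_mod_monic G mfA sfA.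
  pose ex (q : {poly {poly R}}) := (map_poly iotal q).[x%:P].
  have exC (q : {poly R}) : ex (map_poly polyC q) = (phi (unrho v q))%:P.
    rewrite /ex phi_unrho -horner_map; congr (_.[_]).
    by apply/polyP => i; rewrite !coef_map /= map_polyC.
  have exfA : ex fA = 0.
    rewrite exC; apply/eqP; rewrite polyC_eq0; apply/eqP/kerphi/(rho_dvdr v); rewrite unrhoK.
    by exists (((J.@[dirvec v])^-1%:MP)%:P).
  have exD p q : ex (p + q) = ex p + ex q by rewrite /ex rmorphD hornerD.
  have exM p q : ex (p * q) = ex p * ex q by rewrite /ex rmorphM hornerM.
  have exK s : ex s%:P = iotal s by rewrite /ex map_polyC hornerC.
  have exX : ex 'X = x%:P by rewrite /ex map_polyX hornerX.
  have exXn i : ex 'X^i = x%:P ^+ i by rewrite /ex map_polyXn hornerXn.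
  have iotalX : iotal 'X = 'X by rewrite /iotal /= map_polyX.
  have iotalC s : iotal s%:P = (iota s)%:P by rewrite /iotal /= map_polyC.
  clearbody ex.
  have exG : ex G = iotal N%:P * z.
    rewrite /G exD !exM exX !exK exC rhoK -hw0 iotalX iotalC /z polyCM mulrDr; congr (_ + _).
    by rewrite mulrC -mulrA.
  have hmul (i : 'I_c) : ex G * x%:P ^+ i = \sum_j iotal (M i j) * x%:P ^+ j.
    have [q hq] := hM i; have := congr1 ex (congr1 (+%R^~ (\sum_j (M i j)%:P * 'X^j)) hq).
    rewrite subrK exD !exM exfA mulr0 add0r exXn => ->.
    have ex0 : ex 0 = 0 by have := exD 0 0; rewrite addr0 -{1}[ex 0]addr0 => /addrI.
    rewrite (big_morph ex exD ex0); apply: eq_bigr => j _.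
    by rewrite exM exK exXn.
  have hr := @charpoly_root _ _ iotal c M (ex G) (fun i => x%:P ^+ i) (Ordinal c0)
    (expr0 _) hmul.
  pose NX : {poly {poly R}} := (N%:P)%:P * 'X.
  have sNX : size NX = 2.
    by rewrite /NX mul_polyC size_scale ?size_polyX // polyC_eq0.
  have seta : size (char_poly M \Po NX) = c.+1.
    by rewrite size_comp_poly2 // size_char_poly.
  rewrite -seta; apply: (prime_size_le inj_ev pxi exi); last by rewrite -size_poly_eq0 seta.
  rewrite evE map_comp_poly horner_comp; rewrite exG in hr; rewrite -[RHS]hr; congr (_.[_]).
  by rewrite rmorphM /= map_polyC map_polyX hornerM hornerC hornerX.
have [h0 h1] := slice_coef01 iota x t xi.
rewrite -/z -evE exi !coef0 in h0 h1.
apply: (conductor_of_relation (s0 := slice 0 xi) (s1 := slice 1 xi) (m := (size xi).-1)).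
- by rewrite phi_unrho.
- by rewrite !phi_unrho -deriv_map.
- by apply: leq_trans sxi; apply: size_poly.
- by move: ulead; rewrite poly_unitE coef_slice -lead_coefE => /andP[].
Qed.

End Conductor.

Lemma exists_direction (F : closedFieldType) n (J : {mpoly F[n.+1]}) c :
  J \is c.-homog -> J != 0 -> exists v, J.@[dirvec v] != 0.
Proof.
move=> hJ J0; have [x] : exists x, (J * 'X_ord_max).@[x] != 0.
  by apply: nonzero_eval; rewrite mulf_neq0 // -msize_poly_eq0 msizeX.
rewrite mevalM mevalXU mulf_eq0 negb_or => /andP[hx xm].
pose v (k : 'I_n) := (x ord_max)^-1 * x (lift ord_max k); exists v.
have -> : J.@[dirvec v] = J.@[fun j => (x ord_max)^-1 * x j].
  apply: meval_eq => j; rewrite /dirvec; case: unliftP => [k ->|->] //.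
  by rewrite mulVf.
by rewrite /meval (mmap_homog_scale _ _ _ hJ) mulf_neq0 // expf_neq0 // invr_eq0.
Qed.

Section Normality.
Variables (F : closedFieldType) (n c : nat) (J : {mpoly F[n.+1]}).
Hypotheses (pJ : primer J) (hJ : J \is c.-homog) (c0 : (0 < c)%N).
Variables (K : fieldType) (phi : {rmorphism {mpoly F[n.+1]} -> K}).
Hypothesis kerphi : forall p, phi p = 0 <-> dvdr J p.

(** The forms [g], [y] and [J] have no common zero, so they generate all monomials of large degree.
    The multiples of [g] and of [J] multiply [u] into the ideal of [a], which leaves exactly the
    hypothesis of [depth_two] on the [y j]. *)
Lemma colon_trivial (T : finType) (g : T -> {mpoly F[n.+1]}) (dg : T -> nat)
    k (y : 'I_k -> {mpoly F[n.+1]}) (dy : 'I_k -> nat) u a :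
  (forall t, g t \is (dg t).-homog) -> (forall j, y j \is (dy j).-homog) ->
  (forall j, 0 < dy j)%N -> (k < n.-1)%N -> ~ dvdr J a ->
  (forall t, exists b, dvdr J (g t * u - b * a)) ->
  (forall x, J.@[x] = 0 -> (forall t, (g t).@[x] = 0) -> (forall j, (y j).@[x] = 0) ->
     forall j, x j = 0) ->
  exists b, dvdr J (u - b * a).
Proof.
move=> hg hy dy0 kn nJa hQ van; have [J0 _ _] := pJ; have [v Jv] := exists_direction hJ J0.
pose f (s : T + ('I_k + unit)) : {mpoly F[n.+1]} :=
  match s with inl t => g t | inr (inl j) => y j | inr (inr _) => J end.
pose df (s : T + ('I_k + unit)) : nat :=
  match s with inl t => dg t | inr (inl j) => dy j | inr (inr _) => c end.
have hf s : f s \is (df s).-homog by case: s => [t|[j|[]]] /=.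
have [|M [dM hM]] := projective_nullstellensatz hf.
  move=> x hx; apply: van; first exact: (hx (inr (inr tt))).
    by move=> t; apply: (hx (inl t)).
  by move=> j; apply: (hx (inr (inl j))).
apply: (depth_two pJ hJ c0 Jv (y := y) (M := M) nJa kn) => m dm.
have [A [hA eA]] := hM M m (leqnn _) dm.
exists (fun j => A (inr (inl j))); split.
  move=> j; apply: leq_trans (homog_msize_le (hA _)) _ => /=.
  by have := dy0 j; have := dM (inr (inl j)); rewrite /=; lia.
have QI : is_ideal (fun p => exists b, dvdr J (p * u - b * a)).
  split; first by exists 0; rewrite !mul0r subrr; apply: ideal0 (dvdr_ideal _).
    move=> p q [b hb] [b' hb']; exists (b + b').
    by rewrite !mulrDl opprD addrACA; apply: (idealD (dvdr_ideal _)).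
  by move=> p q [b hb]; exists (p * b); rewrite -!mulrA -mulrBr; apply: dvdr_mull.
rewrite eA !big_sumType /=.
have -> : \sum_t A (inl t) * g t + (\sum_j A (inr (inl j)) * y j +
    \sum_i A (inr (inr i)) * J) - \sum_j A (inr (inl j)) * y j =
    \sum_t A (inl t) * g t + \sum_i A (inr (inr i)) * J by ring.
apply: (idealD QI); apply: (ideal_sum QI) => t _; apply: (idealMl QI) => //.
by exists 0; rewrite mul0r subr0; apply/dvdr_mulr/dvdrr.
Qed.

Hypothesis n3 : (3 <= n)%N.
Hypothesis smooth : forall x, (forall j : 'I_n.+1, (3 <= j)%N -> x j = 0) ->
  (exists j, x j != 0) -> J.@[x] = 0 -> exists j, (J^`M(j)).@[x] != 0.

(** The conductor makes [t] times the derivative of [J] regular along every direction off the cone.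
    Two such directions that differ in one coordinate yield that partial derivative, so all partials
    lie in [Q]. By smoothness they and the [n - 2] coordinates from [x_3] on have no common zero on
    the cone, and [n - 2 < n - 1] is what [colon_trivial] asks. *)
Lemma normal_cone t u a :
  integralOver phi t -> ~ dvdr J a -> t * phi a = phi u -> exists w, phi w = t.
Proof.
move=> it nJa hta.
pose Q p := exists b, dvdr J (p * u - b * a).
have QI : is_ideal Q.
  split; first by exists 0; rewrite !mul0r subrr; apply: ideal0 (dvdr_ideal _).
    move=> p q [b hb] [b' hb']; exists (b + b').
    by rewrite !mulrDl opprD addrACA; apply: (idealD (dvdr_ideal _)).
  by move=> p q [b hb]; exists (p * b); rewrite -!mulrA -mulrBr; apply: dvdr_mull.
have hv v : J.@[dirvec v] != 0 -> Q (\sum_j (dirvec v j)%:MP * J^`M(j)).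
  move=> Jv; have [w hw] := conductor pJ hJ c0 Jv kerphi it nJa hta.
  exists w; apply/kerphi; rewrite rmorphB [phi (_ * u)]rmorphM [phi (w * a)]rmorphM hw -hta.
  by rewrite mulrCA mulrA subrr.
have [J0 _ _] := pJ; have [v Jv] := exists_direction hJ J0.
have hk (k : 'I_n) : Q J^`M(lift ord_max k).
  pose vs s (i : 'I_n) := v i + s * (i == k)%:R.
  pose q : {poly F} := mmap polyC (fun j => (dirvec v j)%:P + (j == lift ord_max k)%:R *: 'X) J.
  have qE s : q.[s] = J.@[dirvec (vs s)].
    rewrite /q -[LHS]/(horner_eval s _) rmorph_mmap; apply: mmap_ext => [z|j] /=.
      by rewrite /horner_eval hornerC.
    rewrite /horner_eval hornerD hornerC hornerZ hornerX /dirvec /vs.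
    case: unliftP => [i ->|->].
      by rewrite (inj_eq lift_inj) mulrC.
    by rewrite (negPf (neq_lift _ _)) mul0r addr0.
  have : q * 'X != 0.
    rewrite mulf_neq0 ?polyX_eq0 //; apply: contraNneq Jv => q0.
    have := qE 0; rewrite q0 horner0 => e; apply/eqP; rewrite e.
    by apply: meval_eq => j; rewrite /dirvec /vs; case: unlift => // i; rewrite mul0r addr0.
  case/closed_nonrootP => s; rewrite /root hornerM hornerX mulf_eq0 negb_or qE => /andP[Js s0].
  have := idealB QI (hv _ Js) (hv _ Jv); rewrite -sumrB (bigD1 (lift ord_max k)) //= big1 ?addr0.
    rewrite /dirvec liftK /vs eqxx mulr1 -mulrBl -mpolyCB addrC addKr => h.
    have -> : J^`M(lift ord_max k) = s^-1%:MP * (s%:MP * J^`M(lift ord_max k)).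
      by rewrite mulrA -mpolyCM mulVf // mul1r.
    exact: (idealMl QI).
  move=> j; rewrite /dirvec /vs; case: unliftP => [i ->|-> _]; last by rewrite subrr.
  by rewrite (inj_eq lift_inj) => /negPf ->; rewrite mulr0 addr0 subrr.
have hj (j : 'I_n.+1) : Q J^`M(j).
  case: (unliftP ord_max j) => [k ->|->] //.
  have -> : J^`M(ord_max) = \sum_j (dirvec v j)%:MP * J^`M(j) -
      \sum_(j | j != ord_max) (dirvec v j)%:MP * J^`M(j).
    by rewrite (bigD1 ord_max) //= {1}/dirvec unlift_none mpolyC1 mul1r addrK.
  apply: (idealB QI); first exact: hv.
  apply: (ideal_sum QI) => i; case: (unliftP ord_max i) => [k -> _|->]; last by rewrite eqxx.
  exact: (idealMl QI).
have [|||||||b hb] := @colon_trivial _ (fun j : 'I_n.+1 => J^`M(j)) (fun=> c.-1)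
  (n - 2) (fun j => 'X_(inord (j + 3))) (fun=> 1%N) u a.
- move=> j; apply/dhomogP => m; rewrite mcoeff_msupp mcoeff_deriv => h.
  have : J@_(m + U_(j)) != 0 by apply: contraNneq h => ->; rewrite mul0rn.
  rewrite -mcoeff_msupp => /(dhomog_mf hJ); rewrite /= mdegD mdeg1; lia.
- by move=> j; rewrite dhomogX /= mdeg1.
- by [].
- lia.
- exact: nJa.
- exact: hj.
- move=> x Jx dJ yx j; apply/eqP; apply: contraT => xj.
  have [||k] := smooth _ _ Jx; last by rewrite dJ eqxx.
    move=> i hi; have hi3 : (i - 3 < n - 2)%N by have := ltn_ord i; lia.
    by have := yx (Ordinal hi3); rewrite mevalXU /= subnK // inord_val.
  by exists j.
exists b; move/kerphi: hb; rewrite rmorphB rmorphM -hta => /eqP; rewrite subr_eq0 => /eqP h.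
have a0 : phi a != 0 by apply/eqP => /kerphi.
by apply: (mulIf a0).
Qed.

End Normality.

(** * Differentials along the critical cone *)

Section Adjugates.

Lemma adj_mul_reg (R : idomainType) m (A B : 'M[R]_m) :
  \det A != 0 -> \det B != 0 -> \adj (A *m B) = \adj B *m \adj A.
Proof.
move=> a0 b0; have d0 : \det (A *m B) != 0 by rewrite det_mulmx mulf_neq0.
have e : (\adj (A *m B) - \adj B *m \adj A) *m (A *m B) = 0.
  rewrite mulmxBl mul_adj_mx mulmxA -[_ *m \adj A *m A]mulmxA mul_adj_mx mul_mx_scalar -scalemxAl.
  by rewrite mul_adj_mx det_mulmx scale_scalar_mx subrr.
have := congr1 (mulmx^~ (\adj (A *m B))) e; rewrite mul0mx -mulmxA mul_mx_adj mul_mx_scalar.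
move/matrixP => h; apply/matrixP => i j; have := h i j; rewrite !mxE => /eqP.
by rewrite mulf_eq0 (negPf d0) subr_eq0 => /eqP.
Qed.

(** The singular case follows from the regular one for [X + A] and [X + B], whose determinants are
    monic in [X], by setting [X = 0]. *)
Lemma adj_mul (K : fieldType) m (A B : 'M[K]_m) : \adj (A *m B) = \adj B *m \adj A.
Proof.
pose up (C : 'M[K]_m) : 'M[{poly K}]_m := char_poly_mx (- C).
have upK C : map_mx (horner_eval 0) (up C) = C.
  apply/matrixP => i j; rewrite /up /char_poly_mx !mxE rmorphB /= /horner_eval hornerC opprK.
  by case: (i == j); rewrite ?mulr1n ?mulr0n ?hornerX ?horner0 add0r.
have up0 C : \det (up C) != 0 by apply: monic_neq0; apply: char_poly_monic.
have := congr1 (map_mx (horner_eval 0)) (adj_mul_reg (up0 A) (up0 B)).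
by rewrite map_mxM !map_mx_adj map_mxM !upK.
Qed.

Variables (R : comNzRingType) (m : nat).
Implicit Types (M : 'M[R]_m) (r g : 'rV[R]_m).

Definition replace_row M b r : 'M[R]_m := \matrix_(i, j) if i == b then r 0 j else M i j.

Lemma det_replace_row M b r : \det (replace_row M b r) = (r *m \adj M) 0 b.
Proof.
rewrite (expand_det_row _ b) mxE; apply: eq_bigr => j _; rewrite !mxE eqxx; congr (_ * _).
rewrite /cofactor; congr (_ * \det _); apply/matrixP => i k; rewrite !mxE.
by rewrite eq_sym (negPf (neq_lift _ _)).
Qed.

Lemma det_replace_row1 b g : \det (replace_row 1%:M b g) = g 0 b.
Proof. by rewrite det_replace_row adj1 mulmx1. Qed.

(** Entry [b] is the determinant with row [b] replaced by [r]; adding multiples of that row to the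
    others does not change it. *)
Lemma wedge_congr M (h : 'cV[R]_m) r : r *m \adj (M + h *m r) = r *m \adj M.
Proof.
apply/rowP => b; rewrite -!det_replace_row.
pose g : 'rV[R]_m := \row_j (if j == b then 1 else h j 0).
have -> : replace_row (M + h *m r) b r = (replace_row 1%:M b g)^T *m replace_row M b r.
  apply/matrixP => i j; rewrite !mxE; have [->|ib] := eqVneq i b.
    rewrite (bigD1 b) //= !mxE !eqxx mul1r big1 ?addr0 // => k kb.
    by rewrite !mxE (negPf kb) mulr0n mul0r.
  rewrite (bigD1 b) //= !mxE !eqxx (negPf ib) (bigD1 i) //= !mxE (negPf ib) eqxx mulr1n mul1r.
  rewrite big_ord1 [X in _ + (_ + X)]big1 ?addr0; first by rewrite addrC.
  by move=> k /andP[kb ki]; rewrite !mxE (negPf kb) (negPf ki) mulr0n mul0r.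
by rewrite det_mulmx det_tr det_replace_row1 mxE eqxx mul1r.
Qed.

(** With [r] in row [b], the relation turns [g_a] times row [a] into [- g_b] times row [b] of [M],
    up to rows already present. The two rows then stand in each other's place, and the sign of the
    exchange cancels the minus sign. *)
Lemma wedge_parallel M r g q a b : g *m M = q *: r ->
  g 0 a * (r *m \adj M) 0 b = g 0 b * (r *m \adj M) 0 a.
Proof.
move=> e; have [->//|ab] := eqVneq a b; rewrite -!det_replace_row.
pose g' : 'rV[R]_m := \row_j (if j == b then - q else g 0 j).
have ga : g' 0 a = g 0 a by rewrite mxE (negPf ab).
have row_b : row b M = row b (replace_row M a r).
  by apply/rowP => j; rewrite !mxE eq_sym (negPf ab).
have -> : g 0 a * \det (replace_row M b r) = \det (replace_row (replace_row M b r) a (- g 0 b *: row b M)).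
  rewrite -ga -det_replace_row1 -det_mulmx; congr (\det _); apply/matrixP => i j; rewrite !mxE.
  have [->|ia] := eqVneq i a; last first.
    rewrite (bigD1 i) //= !mxE (negPf ia) eqxx mulr1n mul1r big1 ?addr0 // => k ki.
    by rewrite !mxE (negPf ia) eq_sym (negPf ki) mulr0n mul0r.
  have := congr1 (fun w : 'rV_ _ => w 0 j) e; rewrite !mxE (bigD1 b) //= => eb.
  rewrite (bigD1 b) //= !mxE !eqxx mulNr -eb opprD -addrA -mulNr.
  rewrite [X in _ + X](_ : _ = 0) ?addr0 // addrC; apply/eqP; rewrite subr_eq0; apply/eqP.
  by apply: eq_bigr => k kb; rewrite !mxE eqxx (negPf kb).
rewrite det_replace_row -scalemxAl mxE -det_replace_row mulNr -mulrN; congr (_ * _).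
have -> : replace_row (replace_row M b r) a (row b M) = xrow a b (replace_row M a r).
  apply/matrixP => i j; rewrite !mxE.
  have [->|ia] := eqVneq i a.
    by rewrite tpermL eq_sym (negPf ab).
  have [->|ib] := eqVneq i b; first by rewrite tpermR eqxx.
  by rewrite tpermD ?(negPf ia) // eq_sym.
by rewrite xrowE det_mulmx det_perm odd_tperm ab mulN1r opprK.
Qed.

End Adjugates.

Lemma det_one_plus_rank1 (R : comNzRingType) m (u : 'cV[R]_m) (v : 'rV[R]_m) :
  \det (1%:M + u *m v) = 1 + (v *m u) 0 0.
Proof.
have e : block_mx 1%:M 0 v 1%:M *m block_mx (1%:M + u *m v) u 0 (1%:M : 'M_1) *m
    block_mx 1%:M 0 (- v) 1%:M = block_mx 1%:M u 0 (1%:M + v *m u).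
  rewrite !mulmx_block !(mul0mx, mulmx0, mul1mx, mulmx1, addr0, add0r) mulmxN addrK.
  congr block_mx; last by rewrite addrC.
  rewrite mulmxDr mulmx1 mulmxN mulmxDl mul1mx mulmxA.
  by apply/eqP; rewrite subr_eq0 addrC.
have := congr1 (fun M : 'M_(m + 1) => \det M) e.
rewrite /= !det_mulmx !det_lblock !det_ublock !det1 !(mul1r, mulr1) => ->.
by rewrite det_mx11 !mxE.
Qed.

Section Differentials.
Variables (F : fieldType) (n : nat).
Local Notation S := {mpoly F[n.+1]}.
Implicit Types (q g : 'I_n.+1 -> S) (J : S).

Definition diffmx q : 'M[S]_n.+1 := \matrix_(i, j) (q i)^`M(j).
Definition jac q : S := \det (diffmx q).
Definition grad J : 'rV[S]_n.+1 := \row_j J^`M(j).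

Lemma mderiv_cmp m (q : 'I_m -> S) (p : {mpoly F[m]}) j :
  (cmp q p)^`M(j) = \sum_i cmp q (p^`M(i)) * (q i)^`M(j).
Proof.
move: p; apply: (derivation_eq (h := cmp q)).
- by move=> p r; rewrite mmapD mderivD.
- move=> p r; rewrite -big_split; apply: eq_bigr => i _ /=.
  by rewrite mderivD mmapD mulrDl.
- by move=> p r; rewrite rmorphM mderivM.
- move=> p r; rewrite mulr_suml mulr_sumr -big_split; apply: eq_bigr => i _ /=.
  by rewrite mderivM mmapD !rmorphM /=; ring.
- by move=> c; rewrite mmapC mderivC big1 // => i _; rewrite mderivC mmap0 mul0r.
move=> i; rewrite mmap_XU (bigD1 i) //= mderivXU eqxx rmorph1 mul1r big1 ?addr0 // => k ki.
by rewrite mderivXU eq_sym (negPf ki) rmorph0 mul0r.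
Qed.

Lemma diffmx_comp q g : diffmx (fun i => cmp q (g i)) = map_mx (cmp q) (diffmx g) *m diffmx q.
Proof.
apply/matrixP => i j; rewrite !mxE mderiv_cmp; apply: eq_bigr => k _; by rewrite !mxE.
Qed.

Lemma euler e (p : S) : p \is e.-homog -> \sum_j 'X_j * p^`M(j) = p *+ e.
Proof.
move=> hp; rewrite {2}[p]mpolyE -sumrMnl.
transitivity (\sum_j \sum_(m <- msupp p) p@_m *: ('X_[m] *+ m j)).
  apply: eq_bigr => j _; rewrite {1}[p]mpolyE raddf_sum mulr_sumr; apply: eq_bigr => m _ /=.
  rewrite mderivZ mderivX -scalerAr; congr (_ *: _); rewrite -scalerAr scaler_nat.
  have [->|mj] := posnP (m j); first by rewrite !mulr0n.
  by rewrite -mpolyXD; congr ('X_[_] *+ _); rewrite addmC submK // lep1mP -lt0n.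
rewrite exchange_big big_seq [RHS]big_seq; apply: eq_bigr => m /(dhomog_mf hp) /= em.
by rewrite -scaler_sumr sumrMnr -mdegE em scalerMnr.
Qed.

Lemma homog_mderiv e (p : S) j : p \is e.-homog -> p^`M(j) \is e.-1.-homog.
Proof.
move=> hp; apply/dhomogP => m; rewrite mcoeff_msupp mcoeff_deriv => h.
have : p@_(m + U_(j)) != 0 by apply: contraNneq h => ->; rewrite mul0rn.
by rewrite -mcoeff_msupp => /(dhomog_mf hp); rewrite /= mdegD mdeg1; lia.
Qed.

Lemma homog_prod_ord m (p : 'I_m -> S) (e : 'I_m -> nat) : (forall i, p i \is (e i).-homog) ->
  \prod_i p i \is (\sum_i e i).-homog.
Proof.
elim: m p e => [|m IH] p e hp; first by rewrite !big_ord0; apply: dhomog1.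
by rewrite !big_ord_recl; apply: dhomogM => //; apply: IH => i; apply: hp.
Qed.

Lemma homog_sum (T : Type) (r : seq T) (P : pred T) (p : T -> S) e :
  (forall i, P i -> p i \is e.-homog) -> \sum_(i <- r | P i) p i \is e.-homog.
Proof.
by move=> h; elim/big_ind: _ => //; [exact: dhomog0 | move=> x y; exact: dhomogD].
Qed.

Lemma homog_det m (M : 'M[S]_m) e : (forall i j, M i j \is e.-homog) ->
  \det M \is (m * e).-homog.
Proof.
move=> hM; apply: homog_sum => s _; rewrite -signr_odd.
have h : \prod_i M i (s i) \is (m * e).-homog.
  by rewrite -[m in (m * e)%N]card_ord -sum_nat_const; apply: homog_prod_ord.
by case: (odd _); rewrite ?expr1 ?expr0 ?mul1r // mulN1r dhomogN.
Qed.

Lemma homog_adj m (M : 'M[S]_m) e i j : (forall i j, M i j \is e.-homog) ->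
  \adj M i j \is (m.-1 * e).-homog.
Proof.
move=> hM; rewrite mxE /cofactor -signr_odd.
have h : \det (row' j (col' i M)) \is (m.-1 * e).-homog.
  by apply: homog_det => k l; rewrite !mxE.
by case: (odd _); rewrite ?expr1 ?expr0 ?mul1r // mulN1r dhomogN.
Qed.

Lemma homog_jac q d : (forall i, q i \is d.-homog) -> jac q \is (n.+1 * d.-1).-homog.
Proof. by move=> hq; apply: homog_det => i j; rewrite mxE homog_mderiv. Qed.

Lemma homog_cmp m (q : 'I_m -> S) e d (p : {mpoly F[m]}) :
  (forall i, q i \is d.-homog) -> p \is e.-homog -> cmp q p \is (e * d).-homog.
Proof.
move=> hq hp; rewrite /mmap big_seq; apply: homog_sum => k /(dhomog_mf hp) /= ek.
rewrite mul_mpolyC; apply: dhomogZ; rewrite /mmap1 -ek mdegE big_distrl /=.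
by apply: homog_prod_ord => i; rewrite mulnC; apply: dhomogMn.
Qed.

End Differentials.

Section Wedge.
Variables (F : fieldType) (n : nat) (J : {mpoly F[n.+1]}).
Variables (K : fieldType) (phi : {rmorphism {mpoly F[n.+1]} -> K}).
Hypothesis kerphi : forall p, phi p = 0 <-> dvdr J p.
Local Notation S := {mpoly F[n.+1]}.
Implicit Types (q g : 'I_n.+1 -> S).

(* Entry [b] is the Jacobian determinant of [q] with row [b] replaced by the
   gradient of [J]: the wedge vanishes iff [q] restricted to the cone [J = 0] has
   a degenerate differential. *)
Definition wedge q : 'rV[K]_n.+1 := map_mx phi (grad J) *m \adj (map_mx phi (diffmx q)).

Lemma wedgeE q b : wedge q 0 b = phi ((grad J *m \adj (diffmx q)) 0 b).
Proof. by rewrite /wedge -map_mx_adj -map_mxM mxE. Qed.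

Lemma wedge_comp q g : wedge (fun i => cmp q (g i)) =
  wedge q *m \adj (map_mx phi (map_mx (cmp q) (diffmx g))).
Proof. by rewrite /wedge diffmx_comp map_mxM adj_mul mulmxA. Qed.

Lemma wedge_ext q g : q =1 g -> wedge q = wedge g.
Proof.
by move=> e; rewrite /wedge; congr (_ *m \adj (map_mx phi _)); apply/matrixP => i j; rewrite !mxE e.
Qed.

(** A change of [q] by a multiple of [J] alters its differential on the cone by a column times the
    gradient of [J], to which the wedge is blind. *)
Lemma wedge_eqmod q g : (forall i, phi (q i) = phi (g i)) -> wedge q = wedge g.
Proof.
move=> e; have [h hh] : exists h : 'I_n.+1 -> S, forall i, q i - g i = h i * J.
  apply: (fin_all_exists (P := fun i (z : S) => q i - g i = z * J)) => i.
  by apply/kerphi; rewrite rmorphB e subrr.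
have J0 : phi J = 0 by apply/kerphi/dvdrr.
rewrite /wedge -[RHS](wedge_congr _ (\col_i phi (h i)) (map_mx phi (grad J))).
congr (_ *m \adj _); apply/matrixP => i j; rewrite !mxE big_ord1 !mxE.
have -> : q i = g i + h i * J by rewrite -hh addrC subrK.
by rewrite mderivD mderivM !rmorphD !rmorphM J0 mulr0 add0r.
Qed.

(** Differentiating [E o q = Q J] on the cone gives the gradient of [E] along [q], times the
    differential of [q], as a multiple of the gradient of [J]. So the wedge is parallel to the
    gradient of any relation satisfied by the image. *)
Lemma wedge_relation q (E : S) a b : dvdr J (cmp q E) ->
  phi (cmp q E^`M(a)) * wedge q 0 b = phi (cmp q E^`M(b)) * wedge q 0 a.
Proof.
case=> Q eQ; have J0 : phi J = 0 by apply/kerphi/dvdrr.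
pose g : 'rV[K]_n.+1 := \row_i phi (cmp q E^`M(i)).
have h : g *m map_mx phi (diffmx q) = phi Q *: map_mx phi (grad J).
  apply/rowP => j; rewrite !mxE.
  have := congr1 (fun p : S => phi p^`M(j)) eQ; rewrite mderiv_cmp mderivM rmorphD !rmorphM J0.
  rewrite mulr0 add0r rmorph_sum => <-; apply: eq_bigr => i _.
  by rewrite !mxE rmorphM.
by have := wedge_parallel a b h; rewrite !mxE.
Qed.

Lemma phi_const_neq0 c : c != 0 -> phi c%:MP != 0.
Proof.
move=> c0; apply/eqP => h; have : phi (c%:MP * c^-1%:MP) = 0 by rewrite rmorphM h mul0r.
by rewrite -mpolyCM divff // rmorph1 => /eqP; rewrite oner_eq0.
Qed.

Hypothesis charF0 : [pchar F] =i pred0.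

Lemma natr_neq0F k : (0 < k)%N -> k%:R != 0 :> F.
Proof. by move=> k0; rewrite ((pcharf0P F).1 charF0) -lt0n. Qed.

Lemma natr_neq0K k : (0 < k)%N -> k%:R != 0 :> K.
Proof.
move=> k0; have := phi_const_neq0 (natr_neq0F k0).
by rewrite mpolyC_nat rmorph_nat.
Qed.

(** Compares two affine lifts of one projective map. By Euler, [q] is [1/e] times its differential
    applied to [X], so the differential of [mu q] is that of [q] times a matrix [B]. Again by Euler,
    the gradient of [J] kills [X] on the cone, so it is an eigenvector of [B], and the factor is
    [det B / mu]. *)
Lemma wedge_scale q mu e k c : J \is c.-homog -> (forall i, q i \is e.-homog) -> (0 < e)%N ->
  mu \is k.-homog -> phi mu != 0 ->
  wedge (fun i => mu * q i) = (phi mu ^+ n * (1 + k%:R / e%:R)) *: wedge q.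
Proof.
move=> hJ hq e0 hmu m0; have J0 : phi J = 0 by apply/kerphi/dvdrr.
have eK := natr_neq0K e0.
pose X : 'cV[K]_n.+1 := \col_j phi 'X_j.
pose gm : 'rV[K]_n.+1 := map_mx phi (grad mu).
pose r := map_mx phi (grad J); pose M := map_mx phi (diffmx q).
have eu (p : S) s : p \is s.-homog -> \sum_j phi p^`M(j) * X j 0 = s%:R * phi p.
  move/euler/(congr1 phi); rewrite rmorphMn rmorph_sum /= mulr_natl => <-.
  by apply: eq_bigr => j _; rewrite mxE rmorphM mulrC.
have MX : M *m X = e%:R *: \col_i phi (q i).
  apply/colP => i; rewrite !mxE -(eu _ _ (hq i)); apply: eq_bigr => j _; by rewrite !mxE.
have rX : r *m X = 0.
  apply/matrixP => i j; rewrite !ord1 !mxE.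
  transitivity (c%:R * phi J); last by rewrite J0 mulr0.
  by rewrite -(eu _ _ hJ); apply: eq_bigr => k' _; rewrite !mxE.
have gX : gm *m X = (k%:R * phi mu)%:M.
  apply/matrixP => i j; rewrite !ord1 !mxE eqxx mulr1n.
  by rewrite -(eu _ _ hmu); apply: eq_bigr => k' _; rewrite !mxE.
pose B : 'M[K]_n.+1 := (phi mu)%:M + e%:R^-1 *: (X *m gm).
have eB : map_mx phi (diffmx (fun i => mu * q i)) = M *m B.
  rewrite /B mulmxDr -scalemxAr mulmxA MX -scalemxAl scalerA mulVf // scale1r.
  rewrite mul_mx_scalar; apply/matrixP => i j; rewrite !mxE big_ord1 !mxE mderivM rmorphD !rmorphM.
  by rewrite addrC [phi _ * phi (q i)]mulrC.
have detB : \det B = phi mu ^+ n.+1 * (1 + k%:R / e%:R).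
  have -> : B = phi mu *: (1%:M + ((phi mu)^-1 * e%:R^-1) *: X *m gm).
    rewrite /B scalerDr scale_scalar_mx mulr1 -scalemxAl scalerA mulrA mulfV // mul1r.
    by [].
  rewrite detZ det_one_plus_rank1 -scalemxAr gX !mxE eqxx mulr1n; congr (_ * (1 + _)).
  by move: (phi mu) m0 => z z0; field; rewrite ?z0 ?eK.
have rB : r *m B = phi mu *: r.
  by rewrite /B mulmxDr -scalemxAr mulmxA rX mul0mx scaler0 addr0 mul_mx_scalar.
have radj : r *m \adj B = (phi mu ^+ n * (1 + k%:R / e%:R)) *: r.
  apply: (scalerI m0); rewrite scalerA mulrA -exprS -detB -[RHS]mul_mx_scalar -mul_mx_adj mulmxA rB.
  by rewrite -scalemxAl.
by rewrite /wedge eB adj_mul mulmxA radj -scalemxAl.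
Qed.

Lemma homog_wedge_entry q e c b : J \is c.-homog -> (forall i, q i \is e.-homog) ->
  (grad J *m \adj (diffmx q)) 0 b \is (c.-1 + n * e.-1).-homog.
Proof.
move=> hJ hq; rewrite mxE; apply: homog_sum => j _; apply: dhomogM.
  by rewrite mxE homog_mderiv.
by apply: homog_adj => i k; rewrite mxE homog_mderiv.
Qed.

End Wedge.

(** * Degree comparison for a self-map of the hypersurface *)

Section KeyLemma.
Variables (F : closedFieldType) (charF0 : [pchar F] =i pred0).
Variables (n c : nat) (J : {mpoly F[n.+1]}).
Hypotheses (pJ : primer J) (hJ : J \is c.-homog) (hc : (n.+1 < c)%N) (n3 : (3 <= n)%N).
Hypothesis smooth : forall x, (forall j : 'I_n.+1, (3 <= j)%N -> x j = 0) ->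
  (exists j, x j != 0) -> J.@[x] = 0 -> exists j, (J^`M(j)).@[x] != 0.
Variables (K : fieldType) (phi : {rmorphism {mpoly F[n.+1]} -> K}).
Hypothesis kerphi : forall p, phi p = 0 <-> dvdr J p.
Variables (q e : nat) (theta : K) (kappa : 'I_n.+1 -> K).
Variable beta : 'I_n.+1 -> 'I_n.+1 -> {mpoly F[n.+1]}.
Hypotheses (q0 : (0 < q)%N) (qe : (q.+1 < e)%N).
Hypothesis hbeta : forall l i, beta l i \is e.-homog.
Hypothesis phib : forall l i, phi (beta l i) = theta * kappa l ^+ q * kappa i.
Hypothesis Jkappa : mmap (phi \o @mpolyC _ F) kappa J = 0.
Hypothesis nv : forall x, J.@[x] = 0 -> (forall l i, (beta l i).@[x] = 0) -> forall j, x j = 0.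

(** The degree of the canonical sheaf. The hypotheses say that [kappa] sends the hypersurface into
    itself and pulls O(q+1) back to O(e): each [beta l] is a lift of [kappa] by forms of degree [e],
    and on the cone they have no common zero. *)
Let g := (c.-1 - n)%N.
Let Jk a := mmap (phi \o @mpolyC _ F) kappa J^`M(a).
Let w l := wedge J phi (beta l).
Let wp l a := (grad J *m \adj (diffmx (beta l))) 0 a.
(** [U / P] is, up to a power of [theta], the power [q + 1] of [w_a / (kappa_l^(q n) Jk_a)], the
    Jacobian of [kappa] between canonical sheaves, and does not depend on the index [al = (a, l)].
    The power is taken because [kappa_l] is not represented by a form, whereas [theta kappa_l^(q+1)]
    is, by [beta l l]. *)
Let P (al : 'I_n.+1 * 'I_n.+1) := cmp (beta al.2) J^`M(al.1) ^+ q.+1.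
Let U (al : 'I_n.+1 * 'I_n.+1) := wp al.2 al.1 ^+ q.+1 * beta al.2 al.2 ^+ (q * g).

Let c0 : (0 < c)%N. Proof. lia. Qed.

Let dmono p x : dvdr J p -> J.@[x] = 0 -> p.@[x] = 0.
Proof. by move=> [a ->] Jx; rewrite mevalM Jx mulr0. Qed.

Let phi_cmp l p s : p \is s.-homog ->
  phi (cmp (beta l) p) = (theta * kappa l ^+ q) ^+ s * mmap (phi \o @mpolyC _ F) kappa p.
Proof.
move=> hp; rewrite rmorph_mmap -(mmap_homog_scale _ _ _ hp).
by apply: mmap_ext => // i /=; rewrite phib.
Qed.

Let Jbeta l : dvdr J (cmp (beta l) J).
Proof. by apply/kerphi; rewrite (phi_cmp l hJ) Jkappa mulr0. Qed.

Let hP al : P al \is (c.-1 * e * q.+1).-homog.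
Proof.
apply: dhomogMn; apply: homog_cmp; last exact: homog_mderiv.
by move=> i; apply: hbeta.
Qed.

Let hU al : U al \is ((c.-1 + n * e.-1) * q.+1 + e * (q * g)).-homog.
Proof.
apply: dhomogM; apply: dhomogMn; last exact: hbeta.
by apply: homog_wedge_entry.
Qed.

(** Otherwise some [beta l] maps [x] to a nonzero point where [J] and its gradient vanish. That
    point lies in the plane, since [beta_lj^(q+1) = beta_jj beta_ll^q] on the cone. *)
Let P_zero x : J.@[x] = 0 -> (forall al, (P al).@[x] = 0) ->
  (forall j : 'I_n.+1, (3 <= j)%N -> (beta j j).@[x] = 0) -> forall j, x j = 0.
Proof.
move=> Jx Px yx; apply: nv => // l i; apply/eqP; apply: contraT => bi.
pose z k := (beta l k).@[x].
have meval_cmp p : (cmp (beta l) p).@[x] = p.@[z].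
  by rewrite /meval rmorph_mmap; apply: mmap_ext => // t /=; rewrite mmapC.
have [|||j] := smooth (x := z).
- move=> j j3; suff: z j ^+ q.+1 = 0 by move/eqP; rewrite expf_eq0 => /andP[_ /eqP].
  have : dvdr J (beta l j ^+ q.+1 - beta j j * beta l l ^+ q).
    apply/kerphi; rewrite rmorphB rmorphXn rmorphM rmorphXn !phib; apply/eqP; rewrite subr_eq0.
    by apply/eqP; rewrite !exprMn !exprS; ring.
  move/dmono => /(_ x Jx); rewrite mevalB mevalM yx // mul0r subr0 => h.
  by rewrite -h rmorphXn.
- by exists i.
- by rewrite -meval_cmp; apply: dmono (Jbeta l) Jx.
have := Px (j, l); rewrite /P /= rmorphXn /= meval_cmp => /eqP.
by rewrite expf_eq0 /= => /eqP ->; rewrite eqxx.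
Qed.

Let zero_w l : kappa l = 0 -> w l = 0.
Proof.
move=> kl; rewrite /w (@wedge_eqmod _ _ J _ phi kerphi _ (fun=> 0)).
  rewrite /wedge (_ : map_mx phi (diffmx _) = 0 *: 1%:M); last first.
    by apply/matrixP => i j; rewrite !mxE mderiv0 rmorph0 mul0r.
  rewrite adjZ expr0n (_ : (n.+1.-1 == 0)%N = false); last by rewrite /=; lia.
  by rewrite scale0r mulmx0.
by move=> i; rewrite phib kl expr0n eqn0Ngt q0 mulr0 mul0r rmorph0.
Qed.

Let nonzero : theta != 0 /\ exists t, kappa t != 0.
Proof.
have [x [[j xj] Jx]] := @forms_common_zero F n 1 (fun=> J) (fun=> c) (leq_trans (isT : (1 <= 3)%N) n3)
  (fun=> hJ) (fun=> c0).
have [[l [i h]]|no] := classic (exists l i, phi (beta l i) != 0).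
  move: h; rewrite phib !mulf_eq0 !negb_or => /andP[/andP[t0 _] ki]; split=> //.
  by exists i.
case/eqP: xj; apply: nv (Jx ord0) _ j => l i; apply: dmono (Jx ord0); apply/kerphi/eqP.
by apply: contraT => h; case: no; exists l, i.
Qed.

Let parallel l a b : Jk a * w l 0 b = Jk b * w l 0 a.
Proof.
have [t0 _] := nonzero.
have [kl|kl] := eqVneq (kappa l) 0; first by rewrite zero_w // !mxE !mulr0.
have := wedge_relation kerphi a b (Jbeta l).
rewrite !(phi_cmp l (homog_mderiv _ hJ)) -!mulrA => /mulfI; apply.
by rewrite expf_neq0 // mulf_neq0 // expf_neq0.
Qed.

(** [beta l] and [beta l'] lift the same rational map: multiplied by [beta l' t] and [beta l t] they
    agree on the cone, and [wedge_scale] compares the factors. *)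
Let cross l l' : kappa l' ^+ (q * n) *: w l = kappa l ^+ (q * n) *: w l'.
Proof.
have [t0 [t kt]] := nonzero.
have qn0 : (q * n == 0)%N = false by lia.
have [kl|kl] := eqVneq (kappa l) 0.
  by rewrite zero_w // kl expr0n qn0 scaler0 scale0r.
have [kl'|kl'] := eqVneq (kappa l') 0.
  by rewrite [w l']zero_w // kl' expr0n qn0 scaler0 scale0r.
have e0 : (0 < e)%N by lia.
have m0 s : kappa s != 0 -> phi (beta s t) != 0.
  by move=> ks; rewrite phib !mulf_neq0 // expf_neq0.
have := @wedge_eqmod _ _ J _ phi kerphi (fun i => beta l' t * beta l i) (fun i => beta l t * beta l' i).
rewrite !(wedge_scale kerphi charF0 hJ (hbeta _) e0 (hbeta _ _)) ?m0 // => h.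
have {}h : (phi (beta l' t) ^+ n * (1 + e%:R / e%:R)) *: w l =
    (phi (beta l t) ^+ n * (1 + e%:R / e%:R)) *: w l'.
  by apply: h => i; rewrite !rmorphM !phib; ring.
have eK := natr_neq0K phi charF0 e0; rewrite divff // !phib in h.
have s0 : theta ^+ n * kappa t ^+ n * (1 + 1) != 0.
  by rewrite !mulf_neq0 ?expf_neq0 // (natr_neq0K phi charF0 (isT : (0 < 2)%N)).
apply: (scalerI s0); rewrite !scalerA.
have ek s : theta ^+ n * kappa t ^+ n * (1 + 1) * kappa s ^+ (q * n) =
    (theta * kappa s ^+ q * kappa t) ^+ n * (1 + 1).
  by rewrite !exprMn -exprM; ring.
by rewrite !ek.
Qed.

Let cross3 a l b l' : w l 0 a * kappa l' ^+ (q * n) * Jk b = w l' 0 b * kappa l ^+ (q * n) * Jk a.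
Proof.
have h : kappa l' ^+ (q * n) * w l 0 a = kappa l ^+ (q * n) * w l' 0 a.
  by have := congr1 (fun r : 'rV_ _ => r 0 a) (cross l l'); rewrite mxE [in RHS]mxE.
rewrite [w l 0 a * _]mulrC h -mulrA [w l' 0 a * _]mulrC -(parallel l' a b).
by move: (kappa _ ^+ _) (Jk a) (w l' 0 b) => x y z; ring.
Qed.

Let phiP al : phi (P al) = ((theta * kappa al.2 ^+ q) ^+ c.-1 * Jk al.1) ^+ q.+1.
Proof. by rewrite /P rmorphXn (phi_cmp _ (homog_mderiv _ hJ)). Qed.

Let phiU al : phi (U al) =
  w al.2 0 al.1 ^+ q.+1 * (theta * kappa al.2 ^+ q * kappa al.2) ^+ (q * g).
Proof. by rewrite /U rmorphM !rmorphXn phib /w wedgeE. Qed.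

Let phiPU al bl : phi (P bl * U al) = theta ^+ (c.-1 * q.+1 + q * g) *
  ((w al.2 0 al.1 * kappa bl.2 ^+ (q * n) * Jk bl.1) *
   (kappa al.2 * kappa bl.2) ^+ (q * g)) ^+ q.+1.
Proof.
rewrite rmorphM phiP phiU; move: (kappa al.2) (kappa bl.2) (w al.2 0 al.1) (Jk bl.1) => A B x y.
have hA : (A ^+ q * A) ^+ (q * g) = (A ^+ (q * g)) ^+ q.+1.
  by rewrite -exprSr -!exprM mulnC.
have hB : (B ^+ q) ^+ c.-1 = B ^+ (q * n) * B ^+ (q * g).
  by rewrite -exprM -exprD -mulnDr; congr (_ ^+ (_ * _)); rewrite /g; lia.
rewrite -(mulrA theta (A ^+ q) A) [(theta * B ^+ q) ^+ c.-1]exprMn hB exprD [theta ^+ (_ * _)]exprM.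
by rewrite [(theta * (A ^+ q * A)) ^+ (q * g)]exprMn hA !exprMn; ring.
Qed.

Let PU al bl : phi (P bl * U al) = phi (P al * U bl).
Proof. by rewrite !phiPU (cross3 al.1 al.2 bl.1 bl.2) [kappa al.2 * _]mulrC. Qed.

(* [C] is of general type while [kappa] would pull back [O(1)] to a multiple of it:
   comparing the degrees of the two sides of [PU] shows that [kappa] is not dominant. *)
Lemma key_lemma l : wedge J phi (beta l) = 0.
Proof.
have e0 : (0 < e)%N by lia.
have y3 (j : 'I_(n - 2)) : (j + 3 < n.+1)%N by have := ltn_ord j; lia.
pose y (j : 'I_(n - 2)) := beta (Ordinal (y3 j)) (Ordinal (y3 j)).
have yx x : (forall j, (y j).@[x] = 0) ->
    forall j : 'I_n.+1, (3 <= j)%N -> (beta j j).@[x] = 0.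
  move=> hx j j3; have hj : (j - 3 < n - 2)%N by have := ltn_ord j; lia.
  have := hx (Ordinal hj); rewrite /y (_ : Ordinal _ = j) //; apply/val_inj => /=; lia.
have [[a0 l0] nP] : exists al, ~ dvdr J (P al).
  apply: NNPP => no.
  have dP al : dvdr J (P al) by apply: NNPP => h; apply: no; exists al.
  pose f (j : 'I_(n - 2).+1) := if unlift ord0 j is Some i then y i else J.
  pose df (j : 'I_(n - 2).+1) := if unlift ord0 j is Some i then e else c.
  have [|||x [[j xj] hx]] := @forms_common_zero F n (n - 2).+1 f df.
  - lia.
  - by move=> j; rewrite /f /df; case: unlift => [i|]; [apply: hbeta | apply: hJ].
  - by move=> j; rewrite /df; case: unlift.
  have Jx : J.@[x] = 0 by have := hx ord0; rewrite /f unlift_none.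
  case/eqP: xj; apply: P_zero (Jx) _ _ j; first by move=> al; apply: (dmono (dP al) Jx).
  by apply: yx => i; have := hx (lift ord0 i); rewrite /f liftK.
have [|||||||b hb] := @colon_trivial F n c J pJ hJ c0 _ P (fun=> (c.-1 * e * q.+1)%N)
  (n - 2) y (fun=> e) (U (a0, l0)) (P (a0, l0)).
- exact: hP.
- by move=> j; apply: hbeta.
- by [].
- lia.
- exact: nP.
- move=> bl; exists (U bl); apply/kerphi; rewrite rmorphB PU [U bl * _]mulrC; exact: subrr.
- by move=> x Jx Px hx; apply: P_zero => //; apply: yx.
set dU := ((c.-1 + n * e.-1) * q.+1 + e * (q * g))%N.
(* The difference of the two degrees is [g (e - (q + 1))], where both factors are positive. *)
have lt : (dU < c.-1 * e * q.+1)%N.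
  rewrite /dU; have -> : c.-1 = (n + g)%N by rewrite /g; lia.
  have g0 : (0 < g)%N by rewrite /g; lia.
  have [e' ee] : exists e', e = (q.+2 + e')%N by exists (e - q.+2)%N; lia.
  rewrite ee /=; have -> : ((n + g) * (q.+2 + e') * q.+1 =
      (n + g + n * (q + e').+1) * q.+1 + (q.+2 + e') * (q * g) + g * e'.+1)%N by ring.
  by rewrite -[X in (X < _)%N]addn0 ltn_add2l muln_gt0 g0.
have : dvdr J (U (a0, l0)).
  have := dvdr_pihomog dU hJ hb; rewrite raddfB /= (pihomog_homog _ (hU _)) eqxx.
  by rewrite (pihomog_mulr _ _ (hP _)) leqNgt lt /= subr0.
move/kerphi; rewrite phiU /= => /eqP.
have/eqP : phi (P (a0, l0)) <> 0 by move/kerphi.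
rewrite phiP /= expf_eq0 /= mulf_eq0 negb_or => /andP[hk hJa].
have [t0 _] := nonzero.
have kl0 : kappa l0 != 0.
  apply: contraNneq hk => ->; rewrite expr0n eqn0Ngt q0 mulr0 expr0n.
  by rewrite (_ : (c.-1 == 0)%N = false) //; lia.
rewrite mulf_eq0 expf_eq0 /= expf_eq0 !mulf_eq0 (negPf t0) expf_eq0 (negPf kl0) !andbF orbF => /eqP wa.
apply/rowP => b'; rewrite [in RHS]mxE.
have := cross3 a0 l0 b' l; rewrite wa !mul0r => /esym/eqP.
by rewrite !mulf_eq0 (negPf hJa) expf_eq0 (negPf kl0) andbF !orbF => /eqP.
Qed.

End KeyLemma.

(** * Critical orbits *)

Section Iterates.
Variables (F : closedFieldType) (n d : nat) (f : 'I_n.+1 -> {mpoly F[n.+1]}).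
Local Notation S := {mpoly F[n.+1]}.
Hypotheses (hf : forall i, f i \is d.-homog)
  (nf : forall x, (forall i, (f i).@[x] = 0) -> forall j, x j = 0).

Fixpoint iterate k (i : 'I_n.+1) : S :=
  if k is k'.+1 then cmp (iterate k') (f i) else 'X_i.

Lemma meval_cmp m (q : 'I_m -> S) (p : {mpoly F[m]}) x :
  (cmp q p).@[x] = p.@[fun i => (q i).@[x]].
Proof. by rewrite /meval rmorph_mmap; apply: mmap_ext => // t /=; rewrite mmapC. Qed.

Lemma iterate_eval k x i : (iterate k i).@[x] = iter k (fapply f) x i.
Proof.
elim: k i => [|k IH] i /=; first by rewrite mevalXU.
by rewrite meval_cmp /fapply; apply: meval_eq => j; apply: IH.
Qed.

Lemma iterate_homog k i : iterate k i \is (d ^ k).-homog.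
Proof.
elim: k i => [|k IH] i /=; first by rewrite dhomogX /= mdeg1.
by rewrite expnS; apply: homog_cmp.
Qed.

Lemma iterate_nondegenerate k x : (forall i, (iterate k i).@[x] = 0) -> forall j, x j = 0.
Proof.
elim: k => [|k IH] h j; first by have := h j; rewrite /= mevalXU.
by apply: IH; apply: (nf (x := fun i => (iterate k i).@[x])) => l; rewrite -meval_cmp; apply: h.
Qed.

Lemma iterate1 : iterate 1 =1 f.
Proof. by move=> i /=; apply: mmap_id. Qed.

Lemma jac_eval x : (jac f).@[x] = jacdet f x.
Proof.
by rewrite /jac /jacdet -det_map_mx; congr (\det _); apply/matrixP => i j; rewrite !mxE.
Qed.

Lemma pihomog_cmp m e (q : 'I_m -> S) r (p : {mpoly F[m]}) : (0 < r)%N ->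
  (forall i, q i \is r.-homog) -> pihomog mdeg (e * r) (cmp q p) = cmp q (pihomog mdeg e p).
Proof.
move=> r0 hq; elim/mpolyind: p => [|c k p _ _ IH]; first by rewrite mmap0 !pihomog0 mmap0.
rewrite mmapD pihomogD IH pihomogD mmapD; congr (_ + _).
have hX : c *: 'X_[k] \is (mdeg k).-homog by apply: dhomogZ; rewrite dhomogX.
rewrite (pihomog_homog _ hX) (pihomog_homog _ (homog_cmp hq hX)) eqn_pmul2r //.
by case: eqP => // _; rewrite mmap0.
Qed.

Variables (c : nat) (pJ : primer (jac f)) (hJ : jac f \is c.-homog) (d0 : (0 < d)%N).
Variables (k : nat) (hk : iter_crit_sub f k).

(** A form vanishing on [f (C)] vanishes at every point of [f^k (C)], and the Nullstellensatz for
    the prime [J] turns this into divisibility. Constants are treated apart because the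
    Nullstellensatz is applied in positive degree. *)
Lemma return_homog e (E : S) : E \is e.-homog -> dvdr (jac f) (cmp f E) ->
  dvdr (jac f) (cmp (iterate k) E).
Proof.
move=> hE dE; have [e0|e0] := posnP e.
  have -> : cmp (iterate k) E = cmp f E; last by [].
  rewrite e0 in hE; have/msize1_polyC -> := homog_msize_le hE; by rewrite !mmapC.
apply: (form_vanish_dvd pJ hJ (homog_cmp (iterate_homog k) hE)); first by rewrite muln_gt0 e0 expn_gt0 d0.
move=> x Jx; have [[j xj]|x0] := classic (nonzero_vec x); last first.
  have -> : (cmp (iterate k) E).@[x] = (cmp (iterate k) E).@[fun j => 0 * x j].
    apply: meval_eq => j; rewrite mul0r; apply/eqP; apply: contraT => xj.
    by case: x0; exists j.
  rewrite /meval (mmap_homog_scale _ _ _ (homog_cmp (iterate_homog k) hE)) expr0n.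
  by rewrite (_ : (_ == 0)%N = false) ?mul0r //; apply/negbTE; rewrite -lt0n muln_gt0 e0 expn_gt0 d0.
have [y [[_ Jy] [l [l0 hl]]]] : exists y, in_crit f y /\ proj_eq (fapply f y) (iter k (fapply f) x).
  by apply: hk; split; [exists j | rewrite -jac_eval].
rewrite meval_cmp (@meval_eq _ _ _ (fun i => l * (f i).@[y])); last first.
  by move=> i; rewrite iterate_eval hl.
rewrite /meval (mmap_homog_scale _ _ _ hE) -/(meval _ _) -meval_cmp.
by case: dE => a ->; rewrite mevalM jac_eval Jy !mulr0.
Qed.

Lemma return_ideal (E : S) : dvdr (jac f) (cmp f E) -> dvdr (jac f) (cmp (iterate k) E).
Proof.
move=> dE; rewrite (pihomog_partitionE (mf := mdeg) (leqnn (msize E))) raddf_sum /=.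
apply: (ideal_sum (dvdr_ideal _)) => e _; apply: (return_homog (e := e)).
  exact: pihomogP.
by rewrite -(pihomog_cmp _ _ d0 hf); apply: dvdr_pihomog hJ dE.
Qed.

End Iterates.

(** The cone has dimension [n]: [J] and [n] linear forms that cut out a line off the cone have no
    common zero, so S/(J) is finite over these linear forms. *)
Lemma form_dependent (F : closedFieldType) n (J : {mpoly F[n.+1]}) c (p : 'I_n.+1 -> {mpoly F[n.+1]}) :
  J \is c.-homog -> J != 0 -> exists Phi : {mpoly F[n.+1]}, Phi != 0 /\ dvdr J (cmp p Phi).
Proof.
move=> hJ J0; have [v Jv] := exists_direction hJ J0.
pose y (k : 'I_n) : {mpoly F[n.+1]} := 'X_(lift ord_max k) - (v k)%:MP * 'X_ord_max.
pose g (s : 'I_n + unit) := if s is inl k then y k else J.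
pose dg (s : 'I_n + unit) := if s is inl k then 1%N else c.
have hg s : g s \is (dg s).-homog.
  case: s => [k|[]] //=; rewrite rpredB ?dhomogX /= ?mdeg1 // mul_mpolyC.
  by apply: dhomogZ; rewrite dhomogX /= mdeg1.
have [|M [dM hM]] := projective_nullstellensatz hg.
  move=> x hx.
  have ex : forall j, x j = x ord_max * dirvec v j.
    move=> j; rewrite /dirvec; case: unliftP => [k ->|->]; last by rewrite mulr1.
    have /= := hx (inl k); rewrite mevalB mevalM mevalC !mevalXU => /eqP.
    by rewrite subr_eq0 => /eqP ->; rewrite mulrC.
  have := hx (inr tt); rewrite /= (meval_eq _ ex) /meval (mmap_homog_scale _ _ _ hJ) => /eqP.
  rewrite mulf_eq0 (negPf Jv) orbF expf_eq0 => /andP[_ /eqP x0] j.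
  by rewrite ex x0 mul0r.
have HM m : mdeg m = M -> exists B : 'I_n -> {mpoly F[n.+1]},
    (forall j, msize (B j) <= M)%N /\ dvdr J ('X_[m] - \sum_j B j * y j).
  move=> dm; have [A [hA ->]] := hM M m (leqnn _) dm; exists (fun j => A (inl j)); split.
    move=> j; apply: leq_trans (homog_msize_le (hA (inl j))) _ => /=.
    by have := dM (inl j); rewrite /=; lia.
  rewrite big_sumType /= addrAC subrr add0r; apply: (ideal_sum (dvdr_ideal J)) => i _.
  exact/dvdr_mull/dvdrr.
have [Phi h] := dependent_mod (dvdr_ideal J) HM p (ltnSn n).
by exists Phi.
Qed.

Section PolynomialHelpers.
Variables (F : fieldType) (n : nat).
Local Notation S := {mpoly F[n]}.

Definition kill i (p : S) : S := cmp (fun j => if j == i then 0 else 'X_j) p.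

Lemma kill_congr i p : dvdr 'X_i (p - kill i p).
Proof.
elim/mpoly_ring_ind: p => [c|j|p q hp hq|p q hp hq].
- by rewrite /kill mmapC subrr; apply: ideal0 (dvdr_ideal _).
- rewrite /kill mmap_XU; case: eqP => [->|_]; first by rewrite subr0; apply: dvdrr.
  by rewrite subrr; apply: ideal0 (dvdr_ideal _).
- by rewrite /kill mmapD opprD addrACA; apply: (idealD (dvdr_ideal _)).
have -> : p * q - kill i (p * q) = (p - kill i p) * q + kill i p * (q - kill i q).
  by rewrite /kill [cmp _ (p * q)]rmorphM /= mulrBl mulrBr addrA subrK.
by apply: (idealD (dvdr_ideal _)); [apply: dvdr_mulr | apply: dvdr_mull].
Qed.

Lemma kill_deriv i p : (kill i p)^`M(i) = 0.
Proof.
elim/mpoly_ring_ind: p => [c|j|p q hp hq|p q hp hq]; rewrite /kill.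
- by rewrite mmapC mderivC.
- by rewrite mmap_XU; case: eqP => [_|/eqP/negPf ji]; rewrite ?mderiv0 // mderivXU ji.
- by rewrite mmapD mderivD hp hq addr0.
by rewrite [cmp _ _]rmorphM mderivM hp hq mulr0 mul0r addr0.
Qed.

Lemma extract_variable i p : p != 0 -> exists s q, p = 'X_i ^+ s * q /\ kill i q != 0.
Proof.
move: {2}(msize p) (leqnn (msize p)) => k; elim: k p => [|k IH] p hk p0.
  by move: hk; rewrite leqn0 msize_poly_eq0 (negPf p0).
have [h|h] := eqVneq (kill i p) 0; last by exists 0%N, p; rewrite expr0 mul1r.
have [r er] := kill_congr i p; rewrite h subr0 in er.
have r0 : r != 0 by apply: contraNneq p0 => r0; rewrite er r0 mul0r.
have X0 : 'X_i != 0 :> S by rewrite -msize_poly_eq0 msizeX.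
have [|//|s [q [eq hq]]] := IH r.
  by move: hk; rewrite er msizeM // msizeX mdeg1; move: (msize r) => u; lia.
by exists s.+1, q; split=> //; rewrite er eq exprS; ring.
Qed.

Hypothesis charF0 : [pchar F] =i pred0.

Lemma mderiv_all0 (p : S) : (forall j, p^`M(j) = 0) -> p = (p@_0)%:MP.
Proof.
move=> h; apply/mpolyP => m; rewrite mcoeffC; have [->|m0] := eqVneq m 0%MM.
  by rewrite mulr1.
rewrite mulr0; have [j mj] : exists j, (0 < m j)%N.
  apply/existsP; apply: contraT; rewrite negb_exists => /forallP hm; case/eqP: m0.
  by apply/mnmP => j; rewrite mnm0E; apply/eqP; have := hm j; rewrite -eqn0Ngt.
have em : m = ((m - U_(j)) + U_(j))%MM by rewrite submK // lep1mP -lt0n.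
have := congr1 (mcoeff (m - U_(j))%MM) (h j); rewrite mcoeff_deriv -em mcoeff0 => /eqP.
rewrite -mulr_natr mulf_eq0 ((pcharf0P F).1 charF0) /= orbF => /eqP //.
Qed.

Lemma msize_mderiv j (p : S) : p != 0 -> (msize p^`M(j) < msize p)%N.
Proof.
move=> p0; rewrite msizeE; have s0 : (0 < msize p)%N by rewrite lt0n msize_poly_eq0.
rewrite -(prednK s0) ltnS; apply/bigmax_leqP_seq => m hm _.
have : p@_(m + U_(j)) != 0.
  by move: hm; rewrite mcoeff_msupp mcoeff_deriv; apply: contraNneq => ->; rewrite mul0rn.
rewrite -mcoeff_msupp => /msize_mdeg_lt; rewrite mdegD mdeg1 addn1.
by move: s0; move: (msize p) => u; lia.
Qed.

End PolynomialHelpers.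

Lemma mmap_homog_sum (n : nat) (R S : comNzRingType) (g : {rmorphism R -> S}) (h : 'I_n.+1 -> S)
    (p : {mpoly R[n.+1]}) (e : nat) : p \is e.-homog ->
  mmap g h p = \sum_(s < #|{: monD n e}|)
    g p@_(val (val (enum_val s))) * mmap1 h (val (val (enum_val s))).
Proof.
move=> hp; rewrite (mmapE e.+1); last first.
  by rewrite msizeE; apply/bigmax_leqP_seq => m /(dhomog_mf hp) ->.
rewrite -(big_enum_val (fun s : monD n e => g p@_(val (val s)) * mmap1 h (val (val s)))) /=.
rewrite (bigID (fun m : 'X_{1..n.+1 < e.+1} => mdeg m == e)) /= [X in _ + X]big1 ?addr0; last first.
  by move=> m ne; rewrite (dhomog_nemf_coeff hp ne) rmorph0 mul0r.
rewrite (reindex_omap (val : monD n e -> _) insub); last first.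
  by move=> m em; rewrite insubT.
by apply: eq_bigl => s; rewrite valK eqxx (valP s).
Qed.

(** * Returning critical orbits *)

Section NoReturn.
Variables (F : closedFieldType) (charF0 : [pchar F] =i pred0).
Variables (n q : nat) (n3 : (3 <= n)%N) (q2 : (2 <= q)%N).
Variable f : 'I_n.+1 -> {mpoly F[n.+1]}.
Local Notation S := {mpoly F[n.+1]}.
Local Notation d := q.+1.
Local Notation J := (jac f).
Local Notation c := (n.+1 * q)%N.
Hypotheses (hf : forall i, f i \is d.-homog)
  (nf : forall x, (forall i, (f i).@[x] = 0) -> forall j, x j = 0).
Hypothesis smooth : forall x, (forall j : 'I_n.+1, (3 <= j)%N -> x j = 0) ->
  (exists j, x j != 0) -> J.@[x] = 0 -> exists j, (J^`M(j)).@[x] != 0.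
Hypothesis pJ : primer J.
Variables (K : fieldType) (phi : {rmorphism S -> K}).
Hypothesis kerphi : forall p, phi p = 0 <-> dvdr J p.
Hypothesis fold : wedge J phi f != 0.

Let hJ : J \is c.-homog. Proof. exact: homog_jac hf. Qed.
Let hc : (n.+1 < c)%N. Proof. nia. Qed.
Let c0 : (0 < c)%N. Proof. nia. Qed.
Local Notation it := (iterate f).

Let dmono p x : dvdr J p -> J.@[x] = 0 -> p.@[x] = 0.
Proof. by move=> [a ->] Jx; rewrite mevalM Jx mulr0. Qed.

Let exists_nonzero k : exists l, phi (it k l) != 0.
Proof.
have [x [[j xj] Jx]] := @forms_common_zero F n 1 (fun=> J) (fun=> c)
  (leq_trans (isT : (1 <= 3)%N) n3) (fun=> hJ) (fun=> c0).
apply: NNPP => no; case/eqP: xj; apply: (iterate_nondegenerate nf (k := k)) => l.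
apply: dmono (Jx ord0); apply/kerphi/eqP; apply: contraT => h; by case: no; exists l.
Qed.

Let wedge_scale0 (g : 'I_n.+1 -> S) mu e k : (forall i, g i \is e.-homog) -> (0 < e)%N ->
  mu \is k.-homog -> phi mu != 0 -> wedge J phi (fun i => mu * g i) = 0 -> wedge J phi g = 0.
Proof.
move=> hg e0 hmu m0; rewrite (wedge_scale kerphi charF0 hJ hg e0 hmu m0) => /eqP.
rewrite scaler_eq0 mulf_eq0 expf_eq0 (negPf m0) andbF /=.
have eK := natr_neq0K phi charF0 e0.
have -> : (1 + k%:R / e%:R == 0 :> K) = false.
  rewrite -{1}(divff eK) -mulrDl mulf_eq0 invr_eq0 (negPf eK) orbF -natrD.
  have h : (0 < e + k)%N by rewrite addn_gt0 e0.
  exact: negPf (natr_neq0K phi charF0 h).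
by move/eqP.
Qed.

(** By the chain rule the wedge of [f^(i+1)] is that of [f^i] times the adjugate of the differential
    of [f] along [f^i], which is invertible as long as [J o f^i] does not vanish on [C]. The
    induction starts from [fold]. *)
Let descend i : (0 < i)%N -> (forall j, (0 < j < i)%N -> ~ dvdr J (cmp (it j) J)) ->
  wedge J phi (it i) <> 0.
Proof.
elim: i => // i IH _ h; have [i0|i0] := posnP i.
  by rewrite i0 (wedge_ext J phi (iterate1 f)) => /eqP; rewrite (negPf fold).
move=> w0; apply: IH => // [j /andP[j0 ji]|]; first by apply: h; rewrite j0 ltnW.
have := w0; rewrite wedge_comp; set A := map_mx phi _ => hA.
have dA : \det A != 0.
  rewrite /A !det_map_mx; apply/eqP => /kerphi; apply: h; by rewrite i0 ltnSn.
have := congr1 (mulmx^~ A) hA; rewrite mul0mx -mulmxA mul_adj_mx mul_mx_scalar => /eqP.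
by rewrite scaler_eq0 (negPf dA) => /eqP.
Qed.

(** For the least such [i], the key lemma applies with [theta = 1] to the lifts [(f^i)_l^q f^i] and
    makes the wedge of [f^i] vanish, against [descend]. *)
Lemma no_critical_return i : (0 < i)%N -> ~ dvdr J (cmp (it i) J).
Proof.
elim/ltn_ind: i => i IH i0 di.
apply: (descend i0) => [j /andP[j0 ji]|]; first exact: IH.
have [l kl] := exists_nonzero i.
have hi := iterate_homog hf i.
pose beta l' j := it i l' ^+ q * it i j.
have hb : forall l' j, beta l' j \is (d ^ i * d).-homog.
  by move=> l' j; rewrite /beta mulnS addnC; apply: dhomogM; [apply: dhomogMn | apply: hi].
have w0 : wedge J phi (beta l) = 0.
  apply: (@key_lemma F charF0 n c J pJ hJ hc n3 smooth K phi kerphi q (d ^ i * d)%N 1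
    (fun j => phi (it i j)) beta) => //.
  - by lia.
  - have h1 : (1 < d ^ i)%N by rewrite -{1}(exp1n i) ltn_exp2r //; lia.
    by rewrite -[X in (X < _)%N]mul1n ltn_mul2r.
  - by move=> l' j; rewrite /beta rmorphM rmorphXn mul1r.
  - have/kerphi := di; rewrite rmorph_mmap; apply.
  move=> x Jx bx; apply: (iterate_nondegenerate nf (k := i)) => j.
  have := bx j j; rewrite /beta -exprSr => /eqP.
  by rewrite rmorphXn expf_eq0 => /andP[_ /eqP].
apply: (wedge_scale0 hi _ _ _ w0); first by rewrite expn_gt0.
  exact: dhomogMn (hi l).
by rewrite rmorphXn expf_neq0.
Qed.

Let iterate_wedge i : (0 < i)%N -> wedge J phi (it i) <> 0.
Proof. by move=> i0; apply: descend => // j /andP[j0 _]; apply: no_critical_return. Qed.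

Variables (D : S) (cc : 'I_n.+1 -> S) (delta : nat).
Hypotheses (hD : D \is delta.-homog) (hcc : forall i, cc i \is delta.-homog) (cc0 : cc ord0 = D).
Hypothesis gi : forall i, dvdr J (cmp f D * 'X_i - cmp f (cc i) * 'X_ord0).
Hypothesis nD : ~ dvdr J (cmp f D).
Variables (k : nat) (k2 : (2 <= k)%N) (hk : iter_crit_sub f k).

Let k0 : (0 < k)%N. Proof. lia. Qed.
Let ret := return_ideal hf pJ hJ (ltn0Sn q) hk.

(** As [f^k] is nondegenerate on [C], its image is dense in [f (C)] and cannot lie in [D = 0]. In
    algebra: if it did, there would be for each [i] a nonzero [E], free of [X_i], with [E o f^k = 0]
    on [C]. For [E] of least size some partial derivative does not vanish along [f^k], and
    [wedge_relation] then kills entry [i] of the wedge. *)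
Let Dk_nonzero : phi (cmp (it k) D) != 0.
Proof.
apply/eqP => /kerphi dD; apply: (iterate_wedge k0); apply/rowP => i; rewrite [in RHS]mxE.
have [J0 _ pM] := pJ.
have [E0 [E00 IE0 dE0]] : exists E : S, [/\ E != 0, dvdr J (cmp (it k) E) & E^`M(i) = 0].
  (* [D o f] takes the place of the [i]-th coordinate: after transport to [f^k] it becomes zero, and
     a relation among the other coordinates remains. Powers of [X_i] are divided out beforehand, so
     that the remaining relation is not trivial. *)
  have [Phi [Phi0 dPhi]] := form_dependent (fun j => if j == i then cmp f D else f j) hJ J0.
  have [s [Psi [ePhi Psi0]]] := extract_variable i Phi0.
  exists (kill i Psi); split=> //; last exact: kill_deriv.
  pose sub p : S := cmp (fun j => if j == i then D else 'X_j) p.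
  have esub p : cmp f (sub p) = cmp (fun j => if j == i then cmp f D else f j) p.
    by rewrite /sub mmap_mmap; apply: mmap_ext => // j; case: ifP => // _; rewrite mmap_XU.
  have dPsi : dvdr J (cmp f (sub Psi)).
    rewrite esub; move: dPhi; rewrite ePhi rmorphM rmorphXn /= mmap_XU eqxx.
    elim: s {ePhi} => [|s IH]; first by rewrite expr0 mul1r.
    by rewrite exprS -mulrA => /pM [/nD|/IH].
  have := ret dPsi; apply: (ideal_congr (dvdr_ideal J)).
  have -> : cmp (it k) (kill i Psi) - cmp (it k) (sub Psi) =
      - cmp (it k) (sub (Psi - kill i Psi)).
    have ek : sub (kill i Psi) = kill i Psi.
      rewrite /sub /kill mmap_mmap; apply: mmap_ext => // j; case: ifP => [_|ji].
        by rewrite mmap0.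
      by rewrite mmap_XU ji.
    by rewrite /sub mmapB mmapB -/(sub _) -/(sub _) ek opprB.
  apply: (idealN (dvdr_ideal J)); have [z ->] := kill_congr i Psi.
  by rewrite /sub !rmorphM /= [cmp _ 'X_i]mmap_XU eqxx; apply: dvdr_mull.
have [E [E1 IE dE minE]] : exists E : S, [/\ E != 0, dvdr J (cmp (it k) E), E^`M(i) = 0 &
    forall E', E' != 0 -> dvdr J (cmp (it k) E') -> E'^`M(i) = 0 -> (msize E <= msize E')%N].
  move: {2}(msize E0) (leqnn (msize E0)) => m; elim: m E0 E00 IE0 dE0 => [|m IH] E0 E00 IE0 dE0 hm.
    by move: hm; rewrite leqn0 msize_poly_eq0 (negPf E00).
  have [[E' [h1 h2 h3 h4]]|no] := classic (exists E', [/\ E' != 0, dvdr J (cmp (it k) E'),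
      E'^`M(i) = 0 & (msize E' < msize E0)%N]).
    by apply: (IH E') => //; rewrite -ltnS (leq_trans h4).
  exists E0; split=> // E' h1 h2 h3; rewrite leqNgt; apply/negP => h4; apply: no; by exists E'.
have [a Ea] : exists a, E^`M(a) != 0.
  apply: NNPP => no; have h : forall a, E^`M(a) = 0.
    by move=> a; apply/eqP; apply: contraT => ?; case: no; exists a.
  have eE := mderiv_all0 charF0 h; move: IE; rewrite eE mmapC => /kerphi/eqP.
  apply/negP; apply: phi_const_neq0; by apply: contraNneq E1 => e0; rewrite eE e0 mpolyC0.
have nEa : phi (cmp (it k) E^`M(a)) != 0.
  apply/eqP => /kerphi h; have := minE _ Ea h; rewrite mderiv_comm dE mderiv0 => /(_ erefl).
  by rewrite leqNgt msize_mderiv.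
have := wedge_relation kerphi a i IE; rewrite dE mmap0 rmorph0 mul0r => /eqP.
by rewrite mulf_eq0 (negPf nEa) => /eqP.
Qed.

Let kappa i := phi (cmp (it k) (cc i)) / phi (cmp (it k) D).

Let kappa0 : kappa ord0 = 1. Proof. by rewrite /kappa cc0 divff. Qed.

Let evk p := mmap (phi \o @mpolyC _ F) kappa p.

Let evkM p r : evk (p * r) = evk p * evk r. Proof. exact: rmorphM. Qed.

Let evk_sum (A : 'I_n.+1 -> S) : evk (\sum_t A t) = \sum_t evk (A t).
Proof. exact: rmorph_sum. Qed.

Let phi_itcc p s : p \is s.-homog ->
  phi (cmp (it k) (cmp cc p)) = phi (cmp (it k) D) ^+ s * evk p.
Proof.
move=> hp; rewrite mmap_mmap rmorph_mmap /evk -(mmap_homog_scale _ _ _ hp).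
by apply: mmap_ext => // i /=; rewrite /kappa mulrC divfK.
Qed.

Let phi_fcc p s : p \is s.-homog ->
  phi (cmp f (cmp cc p)) * phi 'X_ord0 ^+ s = phi (cmp f D) ^+ s * phi p.
Proof.
move=> hp; rewrite mmap_mmap rmorph_mmap mulrC -(mmap_homog_scale _ _ _ hp).
have -> : phi p = mmap (phi \o @mpolyC _ F) (fun i => phi 'X_i) p.
  by rewrite -{1}[p]mmap_id rmorph_mmap.
rewrite -(mmap_homog_scale _ _ _ hp).
apply: mmap_ext => // i /=; have/kerphi := gi i; rewrite rmorphB !rmorphM => /eqP.
by rewrite subr_eq0 [phi 'X_ord0 * _]mulrC => /eqP.
Qed.

Let x0_neq0 : phi 'X_ord0 != 0.
Proof.
apply/eqP => /kerphi [a ea].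
have [J0 _ _] := pJ.
have X0 : 'X_ord0 != 0 :> S by rewrite -msize_poly_eq0 msizeX.
have a0 : a != 0 by apply: contraNneq X0 => h; rewrite ea h mul0r.
have := congr1 (fun p : S => msize p) ea; rewrite /= msizeX mdeg1 msizeM // => e.
have sJ : msize J = c.+1.
  have hJ' := dhomog_uniq J0 hJ (dhomog_msize hJ).
  by rewrite hJ' prednK // lt0n msize_poly_eq0.
move: e a0; rewrite sJ -msize_poly_eq0; move: (msize a) hc => u; lia.
Qed.

Let Jkappa : evk J = 0.
Proof.
have : dvdr J (cmp f (cmp cc J)).
  apply/kerphi; have := phi_fcc hJ; have -> : phi J = 0 by apply/kerphi/dvdrr.
  by rewrite mulr0 => /eqP; rewrite mulf_eq0 expf_eq0 (negPf x0_neq0) andbF orbF => /eqP.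
move/ret/kerphi; rewrite (phi_itcc hJ) => /eqP.
by rewrite mulf_eq0 expf_eq0 (negPf Dk_nonzero) andbF => /eqP.
Qed.

(** On [f (C)] the map [f o cc] is proportional to the identity; this is a family of polynomial
    relations, which [ret] carries over to [f^k (C)]. *)
Let fkappa i j : evk (f i) * phi (it k j) = evk (f j) * phi (it k i).
Proof.
have : dvdr J (cmp f (cmp cc (f i) * 'X_j - cmp cc (f j) * 'X_i)).
  apply/kerphi; rewrite rmorphB !rmorphM /= !mmap_XU rmorphB !rmorphM /=.
  apply: (mulIf (expf_neq0 d x0_neq0)).
  rewrite mul0r mulrBl mulrAC (phi_fcc (hf i)) mulrAC [X in _ - X]mulrAC (phi_fcc (hf j)).
  by rewrite -!mulrA [phi (f j) * _]mulrC subrr.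
move/ret => h.
have cM (p r : S) : cmp (it k) (p * r) = cmp (it k) p * cmp (it k) r by exact: rmorphM.
have/kerphi/eqP := h; rewrite mmapB !cM !mmap_XU rmorphB !rmorphM /=.
rewrite (phi_itcc (hf i)) (phi_itcc (hf j)) subr_eq0 -!mulrA => /eqP/mulfI; apply.
by rewrite expf_neq0.
Qed.

Let nss_f : exists M, forall m : 'X_{1..n.+1}, mdeg m = (M + d)%N ->
  exists A, (forall t, A t \is M.-homog) /\ 'X_[m] = \sum_t A t * f t.
Proof.
have [M0 [_ hM]] := projective_nullstellensatz hf nf.
exists M0 => m dm; have [|A [hA eA]] := hM (M0 + d)%N m _ dm; first exact: leq_addr.
by exists A; split=> // t; have := hA t; rewrite addnK.
Qed.

Let exists_fkappa : exists j, evk (f j) != 0.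
Proof.
apply: NNPP => no; have h j : evk (f j) = 0.
  by apply/eqP; apply: contraT => hj; case: no; exists j.
have [M hM] := nss_f; have [|A [_ eA]] := hM (U_(ord0) *+ (M + d))%MM.
  by rewrite mdegMn mdeg1 mul1n.
have := congr1 evk eA; rewrite evk_sum big1; last by move=> t _; rewrite evkM h mulr0.
by rewrite /evk -mpolyXn rmorphXn /= mmap_XU kappa0 expr1n => /eqP; rewrite oner_eq0.
Qed.

Let exists_theta : exists2 theta : K, theta != 0 &
  (forall j, theta * evk (f j) = phi (it k j)) /\
  exists j0, evk (f j0) != 0 /\ theta = phi (it k j0) / evk (f j0).
Proof.
have [j0 h0] := exists_fkappa.
have ht j : phi (it k j0) / evk (f j0) * evk (f j) = phi (it k j).
  by rewrite mulrAC [phi _ * _]mulrC -fkappa mulrAC divff // mul1r.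
exists (phi (it k j0) / evk (f j0)); last by split=> //; exists j0.
have [l kl] := exists_nonzero k.
by apply: contraNneq kl => h; rewrite -ht h mul0r.
Qed.

(** The element [theta kappa^m] is integral over the coordinate ring and is a fraction with
    denominator [f_j0 o cc o f^k], so normality makes it the value of a polynomial; the component of
    degree [d^k] represents it as well. *)
Let regular_monomial theta : (forall j, theta * evk (f j) = phi (it k j)) ->
  (exists j0, evk (f j0) != 0 /\ theta = phi (it k j0) / evk (f j0)) ->
  forall m, mdeg m = d -> exists2 b, b \is (d ^ k).-homog & phi b = theta * mmap1 kappa m.
Proof.
move=> ht [j0 [h0 et]] m dm; set tau := theta * _.
have evkX m' : evk 'X_[m'] = mmap1 kappa m' by rewrite /evk mmapX.
(* Multiplication by [tau] preserves the span of the monomials of degree [M] in [kappa]: a monomial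
   of degree [M + d] is a combination of the [f_t] with coefficients of degree [M], and
   [theta f_t (kappa)] is the polynomial [f^k_t] on [C]. *)
have it_tau : integralOver phi tau.
  have [M hM] := nss_f.
  pose T := monD n M.
  have hT (s : T) : mdeg (m + val (val s))%MM = (M + d)%N.
    by rewrite mdegD dm (eqP (valP s)) addnC.
  have [A hA] := fin_all_exists (fun s : T => hM _ (hT s)).
  pose N : 'M[S]_#|{: T}| := \matrix_(s, s')
    \sum_t ((A (enum_val s) t)@_(val (val (enum_val s'))))%:MP * it k t.
  pose X (s : 'I_#|{: T}|) := mmap1 kappa (val (val (enum_val s))).
  have hmM : (mdeg (U_(ord0 : 'I_n.+1) *+ M)%MM < M.+1)%N by rewrite mdegMn mdeg1 mul1n.
  have hmM' : mdeg (BMultinom hmM) == M by rewrite /= mdegMn mdeg1 mul1n.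
  pose s0 : T := exist _ (BMultinom hmM) hmM'.
  exists (char_poly N); first exact: char_poly_monic.
  apply/eqP; apply: (@charpoly_root _ _ phi _ N tau X (enum_rank s0)).
    rewrite /X enum_rankK /= -evkX /evk -mpolyXn rmorphXn /= mmap_XU kappa0 expr1n //.
  move=> s; set s1 := enum_val s; have [hA1 eA] := hA s1.
  have -> : tau * X s = \sum_t phi (it k t) * evk (A s1 t).
    rewrite /tau /X -mulrA -evkX -evkX -evkM -mpolyXD eA.
    rewrite evk_sum mulr_sumr; apply: eq_bigr => t _.
    by rewrite evkM mulrCA ht mulrC.
  have eAt t : evk (A s1 t) =
      \sum_(s' : 'I_#|{: T}|) phi (((A s1 t)@_(val (val (enum_val s'))))%:MP) * X s'.
    exact: (mmap_homog_sum (phi \o @mpolyC _ F) kappa (hA1 t)).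
  rewrite (eq_bigr (fun t => \sum_s' phi (((A s1 t)@_(val (val (enum_val s'))))%:MP * it k t) * X s')).
    rewrite exchange_big; apply: eq_bigr => s' _; rewrite mxE rmorph_sum mulr_suml.
    by apply: eq_bigr.
  move=> t _; rewrite eAt mulr_sumr; apply: eq_bigr => s' _; rewrite rmorphM; ring.
pose a := cmp (it k) (cmp cc (f j0)).
pose u := it k j0 * cmp (it k) (cmp cc 'X_[m]).
have pa : phi a = phi (cmp (it k) D) ^+ d * evk (f j0) by rewrite /a (phi_itcc (hf j0)).
have nJa : ~ dvdr J a.
  by move/kerphi/eqP; rewrite pa mulf_eq0 expf_eq0 (negPf Dk_nonzero) andbF (negPf h0).
have hm : ('X_[m] : S) \is d.-homog by rewrite dhomogX /= dm.
have eu : tau * phi a = phi u.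
  rewrite /u rmorphM (phi_itcc hm) pa /tau et evkX; move: (mmap1 kappa m) (evk (f j0)) h0 => y z z0.
  by field.
have [w hw] := normal_cone pJ hJ c0 kerphi n3 smooth it_tau nJa eu.
have ha : a \is (d * delta * d ^ k).-homog.
  by apply: homog_cmp; [apply: iterate_homog | apply: homog_cmp].
have hu : u \is (d ^ k + d * delta * d ^ k).-homog.
  apply: dhomogM; first exact: iterate_homog.
  by apply: homog_cmp; [apply: iterate_homog | apply: homog_cmp].
exists (pihomog mdeg (d ^ k) w); first exact: pihomogP.
have : dvdr J (w * a - u) by apply/kerphi; rewrite rmorphB rmorphM hw eu subrr.
move/(dvdr_pihomog (d ^ k + d * delta * d ^ k) hJ); rewrite raddfB /= (pihomog_mulr _ _ ha) leq_addl.
rewrite addnK (pihomog_homog _ hu) eqxx => /kerphi/eqP; rewrite rmorphB rmorphM subr_eq0 -eu => /eqP.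
by apply: mulIf; apply/eqP => /kerphi.
Qed.

(** The forms [beta] have no common zero on the cone: if all [beta i i] vanish at [x], so does every
    [b m], as [b_m^d] is the product of the [beta_ii^(m_i)] on [C], and then [f^k], a combination of
    the [b m], vanishes too. The key lemma makes [beta ord0] degenerate, and
    [f o beta_0 = beta_00^q f^k] on [C] passes this on to [f^k]. *)
Theorem no_return : False.
Proof.
have [theta t0 [ht hj0]] := exists_theta.
have hreg m : exists b, mdeg m = d -> b \is (d ^ k).-homog /\ phi b = theta * mmap1 kappa m.
  have [dm|dm] := eqVneq (mdeg m) d; last by exists 0 => h; rewrite h eqxx in dm.
  by have [b hb eb] := regular_monomial ht hj0 dm; exists b.
pose b m := proj1_sig (constructive_indefinite_description _ (hreg m)).
have hb m : mdeg m = d -> b m \is (d ^ k).-homog /\ phi (b m) = theta * mmap1 kappa m.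
  by rewrite /b; case: constructive_indefinite_description.
clearbody b.
have dm (i l : 'I_n.+1) : mdeg (U_(l) *+ q + U_(i))%MM = d.
  by rewrite mdegD mdegMn !mdeg1 mul1n addn1.
pose beta l i := b (U_(l) *+ q + U_(i))%MM.
have hbeta l i : beta l i \is (d ^ k).-homog by have [] := hb _ (dm i l).
have phib l i : phi (beta l i) = theta * kappa l ^+ q * kappa i.
  have [_ ->] := hb _ (dm i l); rewrite -mulrA; congr (_ * _).
  have evkX m' : evk 'X_[m'] = mmap1 kappa m' by rewrite /evk mmapX.
  by rewrite -evkX mpolyXD -mpolyXn /evk rmorphM rmorphXn /= !mmap_XU.
have nv x : J.@[x] = 0 -> (forall l i, (beta l i).@[x] = 0) -> forall j, x j = 0.
  move=> Jx bx; have bm m : mdeg m = d -> (b m).@[x] = 0.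
    move=> em; have [_ pm] := hb _ em.
    have : dvdr J (b m ^+ d - \prod_i beta i i ^+ m i).
      apply/kerphi; rewrite rmorphB rmorphXn rmorph_prod pm; apply/eqP; rewrite subr_eq0; apply/eqP.
      rewrite (eq_bigr (fun i => theta ^+ m i * (kappa i ^+ m i) ^+ d)); last first.
        move=> i _; rewrite rmorphXn phib -mulrA -exprSr exprMn -!exprM; congr (_ * _ ^+ _).
        by rewrite mulnC.
      by rewrite big_split /= prodrXr -mdegE em prodrXl exprMn.
    move/dmono => /(_ x Jx); rewrite mevalB rmorph_prod rmorphXn /= => h.
    have [i mi] : exists i, (0 < m i)%N.
      apply/existsP; apply: contraT; rewrite negb_exists => /forallP hm.
      have : mdeg m = 0%N by rewrite mdegE big1 // => i _; apply/eqP; have := hm i; rewrite -eqn0Ngt.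
      by rewrite em.
    move/eqP: h; rewrite (bigD1 i) //= rmorphXn /= bx expr0n eqn0Ngt mi mul0r subr0 expf_eq0.
    by move/andP => [_ /eqP].
  apply: (iterate_nondegenerate nf (k := k)) => j.
  have : dvdr J (it k j - \sum_(m <- msupp (f j)) ((f j)@_m)%:MP * b m).
    apply/kerphi; rewrite rmorphB rmorph_sum -ht /evk /mmap mulr_sumr; apply/eqP; rewrite subr_eq0.
    apply/eqP; rewrite big_seq [RHS]big_seq; apply: eq_bigr => m /(dhomog_mf (hf j)) /= em.
    by have [_ pm] := hb _ em; rewrite rmorphM pm mulrCA.
  move/dmono => /(_ x Jx); rewrite mevalB [X in _ - X]raddf_sum big_seq big1 ?subr0 // => m.
  by move/(dhomog_mf (hf j)) => /= em; rewrite mevalM bm // mulr0.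
have w0 : wedge J phi (beta ord0) = 0.
  apply: (@key_lemma F charF0 n c J pJ hJ hc n3 smooth K phi kerphi q (d ^ k)%N theta kappa beta) => //.
  - lia.
  - have h : (d ^ 1 < d ^ k)%N by rewrite ltn_exp2l; lia.
    by move: h; rewrite expn1.
apply: (iterate_wedge k0).
have h1 : wedge J phi (fun j => cmp (beta ord0) (f j)) = 0 by rewrite wedge_comp w0 mul0mx.
have mu0 : phi (beta ord0 ord0 ^+ q) = theta ^+ q.
  by rewrite rmorphXn phib kappa0 expr1n !mulr1.
apply: (wedge_scale0 (iterate_homog hf k) _ (dhomogMn q (hbeta ord0 ord0))).
- by rewrite expn_gt0.
- by rewrite mu0 expf_neq0.
rewrite -h1; apply: wedge_eqmod kerphi _ _ _ => j.
rewrite rmorphM mu0 -ht mulrA -exprSr.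
rewrite rmorph_mmap /evk -(mmap_homog_scale _ _ _ (hf j)).
by apply: mmap_ext => // i /=; rewrite phib kappa0 expr1n mulr1.
Qed.

End NoReturn.

(** * Generic forms *)

Section PolynomialFamilies.
Variables (F : closedFieldType) (N n : nat) (T : Type) (dom : T -> Prop) (ev : T -> 'I_N -> F).
Local Notation S := {mpoly F[n.+1]}.
Local Notation A := {mpoly F[N]}.
Local Notation SA := {mpoly {mpoly F[N]}[n.+1]}.
Implicit Types (f : T) (E : T -> S).

Definition spec (f : T) : {rmorphism SA -> S} := map_mpoly (meval (ev f)).

(** Polynomial dependence on the parameters. It is restricted to [dom] because the parameters will
    be the coefficients of degree [d], which determine [f] only among forms. *)
Definition polyfam E := exists EU : SA, forall f, dom f -> E f = spec f EU.

Lemma polyfam_ext E E' : (forall f, dom f -> E f = E' f) -> polyfam E -> polyfam E'.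
Proof. by move=> h [U hU]; exists U => f hf; rewrite -h // hU. Qed.

Lemma specC f c : spec f c%:MP = (c.@[ev f])%:MP.
Proof. by rewrite /spec /= map_mpolyC. Qed.

Lemma specX f m : spec f 'X_[m] = 'X_[m].
Proof. by rewrite /spec /= map_mpolyX. Qed.

Lemma polyfam_const p : polyfam (fun=> p).
Proof.
exists (map_mpoly (@mpolyC _ F) p) => f _; apply/mpolyP => m.
by rewrite /spec /= !mcoeff_map_mpoly /= mevalC.
Qed.

Lemma polyfamD E E' : polyfam E -> polyfam E' -> polyfam (fun f => E f + E' f).
Proof. by move=> [U hU] [V hV]; exists (U + V) => f hf; rewrite rmorphD hU // hV. Qed.

Lemma polyfamB E E' : polyfam E -> polyfam E' -> polyfam (fun f => E f - E' f).
Proof. by move=> [U hU] [V hV]; exists (U - V) => f hf; rewrite rmorphB hU // hV. Qed.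

Lemma polyfamM E E' : polyfam E -> polyfam E' -> polyfam (fun f => E f * E' f).
Proof. by move=> [U hU] [V hV]; exists (U * V) => f hf; rewrite rmorphM hU // hV. Qed.

Lemma polyfam_sum (I : Type) (r : seq I) (p : pred I) (E : I -> T -> S) :
  (forall t, polyfam (E t)) -> polyfam (fun f => \sum_(t <- r | p t) E t f).
Proof.
move=> h; elim: r => [|t r [U hU]].
  by apply: polyfam_ext (polyfam_const 0) => f _; rewrite big_nil.
have [V hV] := h t; exists (if p t then V + U else U) => f hf; rewrite big_cons.
by case: ifP => _; rewrite ?rmorphD -?hU // -hV.
Qed.

Lemma polyfam_prod (I : Type) (r : seq I) (E : I -> T -> S) :
  (forall t, polyfam (E t)) -> polyfam (fun f => \prod_(t <- r) E t f).
Proof.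
move=> h; elim: r => [|t r [U hU]].
  by apply: polyfam_ext (polyfam_const 1) => f _; rewrite big_nil.
have [V hV] := h t; exists (V * U) => f hf; rewrite big_cons.
by rewrite rmorphM -hU // -hV.
Qed.

Lemma polyfam_det m (M : T -> 'M[S]_m) :
  (forall i j, polyfam (fun f => M f i j)) -> polyfam (fun f => \det (M f)).
Proof.
move=> h; apply: polyfam_sum => s; apply: polyfamM; first exact: polyfam_const.
by apply: polyfam_prod => i.
Qed.

Lemma polyfam_adj m (M : T -> 'M[S]_m) i j :
  (forall i j, polyfam (fun f => M f i j)) -> polyfam (fun f => \adj (M f) i j).
Proof.
move=> h; apply: (@polyfam_ext (fun f => (-1) ^+ (j + i) * \det (row' j (col' i (M f))))).
  by move=> f _; rewrite mxE.
apply: polyfamM; first exact: polyfam_const.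
apply: polyfam_det => k l; apply: polyfam_ext (h (lift j k) (lift i l)) => f _; by rewrite !mxE.
Qed.

Lemma polyfam_mderiv E j : polyfam E -> polyfam (fun f => (E f)^`M(j)).
Proof.
move=> [U hU]; exists (U^`M(j)) => f hf; rewrite hU //; apply/mpolyP => m.
by rewrite /spec /= mcoeff_deriv !mcoeff_map_mpoly /= mcoeff_deriv rmorphMn.
Qed.

Lemma polyfam_pihomog E e : polyfam E -> polyfam (fun f => pihomog mdeg e (E f)).
Proof.
move=> [U hU]; exists (pihomog mdeg e U) => f hf; rewrite hU //; apply/mpolyP => m.
rewrite [RHS]mcoeff_map_mpoly !mcoeff_pihomog mcoeff_map_mpoly /=.
by case: (mdeg m == e) => //; rewrite meval0.
Qed.

Lemma polyfam_coef E m : polyfam E -> polyfam (fun f => ((E f)@_m)%:MP).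
Proof.
move=> [U hU]; exists ((U@_m)%:MP) => f hf; rewrite hU // specC.
by rewrite /spec /= mcoeff_map_mpoly.
Qed.

Lemma polyfam_cmp (q : 'I_n.+1 -> T -> S) E : (forall i, polyfam (q i)) -> polyfam E ->
  polyfam (fun f => cmp (fun i => q i f) (E f)).
Proof.
move=> hq [U hU].
have [V hV] : exists V, forall i f, dom f -> q i f = spec f (V i).
  by apply: (fin_all_exists (P := fun i (V : SA) => forall f, dom f -> q i f = spec f V)).
exists (cmp V U) => f hf; rewrite hU //.
apply: (@rmorph_mpolyP _ _ _ (cmp (fun i => q i f) \o spec f) (spec f \o cmp V)) => [c|i] /=.
  by rewrite -/(spec f _) mmapC !specC mmapC.
by rewrite -/(spec f 'X_i) specX !mmap_XU -hV.
Qed.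

End PolynomialFamilies.

Section Generic.
Variables (F : closedFieldType) (n d : nat).
Local Notation S := {mpoly F[n.+1]}.
Local Notation A := {mpoly F[Ncoef n d]}.
Local Notation SA := {mpoly {mpoly F[Ncoef n d]}[n.+1]}.
Local Notation spec := (@spec F (Ncoef n d) n _ (coefvec d)).
Implicit Types (f : 'I_n.+1 -> S) (P Q : ('I_n.+1 -> S) -> Prop) (E : ('I_n.+1 -> S) -> S).

Definition forms f := forall i, f i \is d.-homog.

Definition generic P := exists G : A, G != 0 /\
  forall f, forms f -> G.@[coefvec d f] != 0 -> P f.

Lemma generic_and P Q : generic P -> generic Q -> generic (fun f => P f /\ Q f).
Proof.
move=> [G [G0 hG]] [H [H0 hH]]; exists (G * H); rewrite mulf_neq0 //; split=> // f hf.
by rewrite mevalM mulf_eq0 negb_or => /andP[g h]; split; [apply: hG | apply: hH].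
Qed.

Lemma generic_imp P Q : (forall f, forms f -> P f -> Q f) -> generic P -> generic Q.
Proof. by move=> h [G [G0 hG]]; exists G; split=> // f hf /(hG f hf); apply: h. Qed.

Definition form_of (a : 'I_(Ncoef n d) -> F) (i : 'I_n.+1) : S :=
  \sum_(s : monD n d) a (enum_rank (i, s)) *: 'X_[val (val s)].

Lemma form_of_forms a : forms (form_of a).
Proof.
move=> i; apply: homog_sum => s _; apply: dhomogZ; rewrite dhomogX /=; exact: (valP s).
Qed.

Lemma coefvec_form_of a : coefvec d (form_of a) =1 a.
Proof.
move=> k; rewrite /coefvec /form_of; move: (enum_valK k); case: (enum_val k) => i s /= e.
rewrite (raddf_sum (mcoeff _)) (bigD1 s) //= mcoeffZ mcoeffX eqxx mulr1 e big1 ?addr0 // => t ts.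
rewrite mcoeffZ mcoeffX (_ : (_ == _) = false) ?mulr0 //; apply/negbTE.
by apply: contraNneq ts => h; apply/eqP; apply: val_inj; apply: val_inj.
Qed.

Local Notation polyfam := (polyfam forms (coefvec d)).

Lemma polyfam_form i : polyfam (fun f => f i).
Proof.
exists (\sum_(s < #|{: monD n d}|) ('X_(enum_rank (i, enum_val s)))%:MP * 'X_[val (val (enum_val s))]).
move=> f hf; rewrite -{1}[f i]mmap_id (mmap_homog_sum _ _ (hf i)) rmorph_sum; apply: eq_bigr => s _.
rewrite rmorphM specC specX mevalXU /coefvec enum_rankK /=; congr (_ * _).
by rewrite mmap1_id.
Qed.

Lemma polyfam_jac : polyfam (fun f => jac f).
Proof.
apply: polyfam_det => i j.
apply: polyfam_ext (polyfam_mderiv j (polyfam_form i)) => f _; by rewrite mxE.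
Qed.

Definition line (R : comNzRingType) (x v : 'I_n.+1 -> R) (p : {mpoly R[n.+1]}) : {poly R} :=
  mmap (@polyC R) (fun i => (x i)%:P + v i *: 'X) p.

Lemma line_top (x v : 'I_n.+1 -> F) e p : p \is e.-homog ->
  (size (line x v p) <= e.+1)%N /\ (line x v p)`_e = p.@[v].
Proof.
pose Q (u : {poly F}) k l := (size u <= k.+1)%N /\ u`_k = l.
have QM u k l u' k' l' : Q u k l -> Q u' k' l' -> Q (u * u') (k + k')%N (l * l').
  move=> [su cu] [su' cu']; split.
    by rewrite (leq_trans (size_polyMleq _ _)) //; lia.
  rewrite coefM (bigD1 (inord k)) //= inordK ?ltnS ?leq_addr // addKn cu cu' big1 ?addr0 // => i ik.
  have ik' : i != k :> nat by apply: contra ik => /eqP ik; apply/eqP/val_inj; rewrite /= inordK ?ltnS ?leq_addr.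
  have [lt|ge] := ltnP k i; first by rewrite [u`_i]nth_default ?mul0r // (leq_trans su).
  by rewrite [u'`__]nth_default ?mulr0 // (leq_trans su') //; lia.
have Q1 i : Q ((x i)%:P + v i *: 'X) 1 (v i).
  split; last by rewrite coefD coefC coefZ coefX add0r mulr1.
  rewrite (leq_trans (size_polyD _ _)) // geq_max (leq_trans (size_polyC_leq1 _)) //.
  by rewrite (leq_trans (size_scale_leq _ _)) // size_polyX.
have Qm (m : 'X_{1..n.+1}) : Q (mmap1 (fun i => (x i)%:P + v i *: 'X) m) (mdeg m) (mmap1 v m).
  rewrite mdegE /mmap1; elim/big_rec3: _ => [|i y1 k y3 _ hQ]; first by split; rewrite ?size_poly1 ?coefC.
  apply: (QM) => //; elim: (m i) => [|k' IH]; first by rewrite !expr0; split; rewrite ?size_poly1 ?coefC.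
  by rewrite !exprS -add1n; apply: (QM).
move=> hp; rewrite /line /mmap /meval /mmap; have := fun m (h : m \in msupp p) => dhomog_mf hp h; elim: (msupp p) => [|m r IH] hr.
  by rewrite !big_nil size_poly0 coef0.
have [|h1 h2] := IH; first by move=> m' hm'; apply: hr; rewrite inE hm' orbT.
have em : mdeg m = e by apply: hr; rewrite inE eqxx.
have [h3 h4] := Qm m; rewrite !big_cons; split; last by rewrite coefD h2 coefCM -em h4.
rewrite (leq_trans (size_polyD _ _)) // geq_max h1 andbT mul_polyC (leq_trans (size_scale_leq _ _)) //.
by rewrite -em.
Qed.

Lemma line0 (x v : 'I_n.+1 -> F) p : (line x v p)`_0 = p.@[x].
Proof.
rewrite -horner_coef0 -[LHS]/(horner_eval 0 (line x v p)) /line rmorph_mmap.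
by apply: mmap_ext => [c|i] /=; rewrite /horner_eval !hornerE //= mulr0 addr0.
Qed.

Lemma line_spec (x v : 'I_n.+1 -> F) f (U : SA) :
  map_poly (meval (coefvec d f)) (line (fun i => (x i)%:MP) (fun i => (v i)%:MP) U) =
  line x v (spec f U).
Proof.
apply: (@rmorph_mpolyP _ _ _ (map_poly (meval (coefvec d f)) \o
    mmap (@polyC A) (fun i => ((x i)%:MP)%:P + (v i)%:MP *: 'X))
  (mmap (@polyC F) (fun i => (x i)%:P + v i *: 'X) \o spec f)) => [c|i] /=.
  by rewrite -/(spec f _) specC !mmapC map_polyC.
rewrite -/(spec f 'X_i) specX !mmap_XU rmorphD /= map_polyC map_polyZ map_polyX /=.
by rewrite !mevalC.
Qed.

(** Restrict both families to a line through [x0] whose direction [v] is off [J f0 = 0], and take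
    the pseudo-remainder [r] over the ring of parameters. Its constant term does not vanish at [f0],
    since [J] is zero and [E] is not at [x0]. Wherever this term and the leading coefficient are
    nonzero, division leaves a remainder. *)
Lemma generic_ndvd (J E : ('I_n.+1 -> S) -> S) c f0 x0 : polyfam J -> polyfam E ->
  (forall f, forms f -> J f \is c.-homog) -> forms f0 -> J f0 != 0 ->
  (J f0).@[x0] = 0 -> (E f0).@[x0] != 0 -> generic (fun f => ~ dvdr (J f) (E f)).
Proof.
move=> [JU eJ] [EU eE] hJ hf0 /nonzero_eval[v Jv] Jx Ex.
pose lnA := line (fun i => (x0 i)%:MP_[Ncoef n d]) (fun i => (v i)%:MP_[Ncoef n d]).
pose ev f := meval (coefvec d f).
(* The universal [JU] is constrained only on forms and may have terms beyond degree [c]; truncation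
   makes [J f] at [v] the leading coefficient. *)
pose j := \poly_(i < c.+1) (lnA JU)`_i.
have ej f : forms f -> map_poly (ev f) j = line x0 v (J f).
  move=> hf; have [sz _] := line_top x0 v (hJ f hf); apply/polyP => i.
  rewrite coef_map coef_poly -/(lnA _); case: ltnP => hi; last first.
    by rewrite [RHS]nth_default ?(leq_trans sz) //= meval0.
  by rewrite eJ // -line_spec coef_map.
have jc f : forms f -> ev f j`_c = (J f).@[v].
  by move=> hf; have [_ <-] := line_top x0 v (hJ f hf); rewrite -ej // coef_map.
have jc0 : j`_c != 0 by apply: contraNneq Jv => h; rewrite -(jc f0) // h /ev meval0.
have sj : size j = c.+1.
  apply/eqP; rewrite eqn_leq size_poly /= ltnNge; apply: contra jc0 => h; by rewrite nth_default.
have lj : lead_coef j = j`_c by rewrite lead_coefE sj.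
have j0 : j != 0 by rewrite -size_poly_eq0 sj.
pose r := (lnA EU %% j)%R.
have er f : forms f -> (ev f j`_c) ^+ scalp (lnA EU) j *: line x0 v (E f) =
    map_poly (ev f) (lnA EU %/ j)%R * line x0 v (J f) + map_poly (ev f) r.
  move=> hf; rewrite -ej // eE // -line_spec -/(lnA _) -rmorphM -rmorphD -Pdiv.Idomain.divp_eq lj.
  by rewrite /= map_polyZ rmorphXn.
exists (j`_c * r`_0); split.
  apply: contraNneq Ex => h; have := congr1 (fun p : {poly F} => p`_0) (er f0 hf0).
  rewrite coefD coefZ coef0M !line0 Jx mulr0 add0r coef_map.
  have -> : r`_0 = 0 by move/eqP: h; rewrite mulf_eq0 (negPf jc0) => /eqP.
  by rewrite /= /ev meval0 => /eqP; rewrite mulf_eq0 expf_eq0 -/(ev f0) jc // (negPf Jv) andbF.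
move=> f hf; rewrite mevalM mulf_eq0 negb_or => /andP[lf rf] [u eu].
have := er f hf; rewrite eu.
have -> : line x0 v (u * J f) = line x0 v u * line x0 v (J f) by exact: rmorphM.
rewrite scalerAl => /eqP; rewrite addrC -subr_eq -mulrBl => /eqP; set w := _ - _ => ew.
have r0 : map_poly (ev f) r != 0.
  apply: contraNneq rf => h; have := congr1 (fun p : {poly F} => p`_0) h.
  by rewrite coef_map coef0 => ->.
have w0 : w != 0 by apply: contraNneq r0 => h; rewrite -ew h mul0r.
have szJ : (c < size (line x0 v (J f)))%N.
  rewrite ltnNge; apply: contra lf => h.
  by rewrite -[meval _ _]/(ev f _) jc // -(line_top x0 v (hJ f hf)).2 nth_default.
have J0 : line x0 v (J f) != 0 by rewrite -size_poly_gt0 (leq_trans _ szJ).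
have := congr1 (fun p : {poly F} => size p) ew; rewrite size_mul //.
have s1 : (size (map_poly (ev f) r) <= c)%N.
  by rewrite (leq_trans (size_poly _ _)) // -ltnS -sj ltn_modp.
move: s1 szJ; rewrite -size_poly_gt0 in w0; move: w0.
set a := size w; set b := size (line _ _ _); set b' := size (map_poly _ _); move: a b b' => a b b'; lia.
Qed.

End Generic.

(** * A map with an isolated fold *)

Lemma det_kernel (K : fieldType) m (M : 'M[K]_m) : \det M = 0 ->
  exists k : 'I_m -> K, (exists j, k j != 0) /\ forall i, \sum_j M i j * k j = 0.
Proof.
rewrite -det_tr => /eqP/det0P[v v0 hv]; exists (v 0); split.
  by apply/rV0Pn.
move=> i; have := congr1 (fun w : 'rV_ _ => w 0 i) hv; rewrite !mxE => h.
by rewrite -[RHS]h; apply: eq_bigr => j _; rewrite mxE mulrC.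
Qed.

Lemma det_neq0 (K : fieldType) m (M : 'M[K]_m) :
  (forall k : 'I_m -> K, (forall i, \sum_j M i j * k j = 0) -> forall j, k j = 0) -> \det M != 0.
Proof.
by move=> h; apply/eqP => /det_kernel[k [[j kj] hk]]; rewrite (h k hk) eqxx in kj.
Qed.

Lemma meval_det (F : fieldType) n m (M : 'M[{mpoly F[n]}]_m) x :
  (\det M).@[x] = \det (\matrix_(i, j) (M i j).@[x]).
Proof. by rewrite -det_map_mx; congr (\det _); apply/matrixP => i j; rewrite !mxE. Qed.

Lemma mderivXUn n (R : comNzRingType) (i j : 'I_n) k :
  ('X_i ^+ k)^`M(j) = 'X_i ^+ k.-1 *+ k *+ (j == i) :> {mpoly R[n]}.
Proof.
elim: k => [|k IH]; first by rewrite expr0 mderivC mulr0n mul0rn.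
rewrite exprS mderivM IH mderivXU eq_sym; case: (j == i) => /=; last by rewrite mul0r mulr0 addr0.
rewrite mul1r !mulr1n mulrS; congr (_ + _).
by case: k {IH} => [|k]; rewrite ?mulr0n ?mulr0 // mulrnAr exprS.
Qed.

Section Witness.
Variables (F : closedFieldType) (charF0 : [pchar F] =i pred0).
Variables (n q : nat) (n3 : (3 <= n)%N) (q2 : (2 <= q)%N).
Local Notation S := {mpoly F[n.+1]}.
Local Notation d := q.+1.
Local Notation i1 := (inord 1 : 'I_n.+1).

Definition wpr (i : 'I_n.+1) : 'I_n.+1 := if i == 1%N :> nat then ord_max else inord i.-1.
Definition wex (i : 'I_n.+1) : nat := if i == 1%N :> nat then 2%N else 1%N.

(* On the fibre through [e_0], with [x_0 = 1], each [x_i] is a power of [X = x_1] and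
   [X^(d^n) = X^2]: besides the double point [e_0] it has only simple points. *)
Definition witness (i : 'I_n.+1) : S :=
  if i == 0%N :> nat then 'X_ord0 ^+ d
  else 'X_i ^+ wex i * 'X_ord0 ^+ (d - wex i) - 'X_(wpr i) ^+ d.

Local Notation w := witness.

Let aux1 (y z a t : F) e : a != 0 -> y * a * z * (t / a *+ e) = y *+ e * z * t.
Proof.
rewrite -[t / a *+ e]mulr_natr -[y *+ e]mulr_natr; move: e%:R => {}e a0; by field.
Qed.

Let aux2 (y a t : F) e : a != 0 -> y *+ e * t = a * y * (t / a *+ e).
Proof.
rewrite -[t / a *+ e]mulr_natr -[y *+ e]mulr_natr; move: e%:R => {}e a0; by field.
Qed.

Let wex_bounds i : (0 < wex i < d)%N. Proof. by rewrite /wex; case: ifP => _; lia. Qed.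

Let wpr_neq0 (i : 'I_n.+1) : i != 0%N :> nat -> wpr i != 0%N :> nat.
Proof.
rewrite /wpr; case: ifP => [_ _|/eqP h1 h0] /=; first by lia.
by have hi := ltn_ord i; rewrite inordK; lia.
Qed.

Let wpr_neq (i : 'I_n.+1) : i != 0%N :> nat -> wpr i != i :> nat.
Proof.
rewrite /wpr; case: ifP => [/eqP -> _|/eqP h1 h0] /=; first by lia.
by have hi := ltn_ord i; rewrite inordK; lia.
Qed.

Let wpr_next j : (0 < j < n)%N -> wpr (inord j.+1) = inord j.
Proof.
move=> hj; rewrite /wpr inordK; last by lia.
by case: eqP => [h|_] //; lia.
Qed.

Let wpr1 : wpr i1 = ord_max. Proof. by rewrite /wpr inordK ?eqxx //; lia. Qed.

Lemma witness_forms : forms d w.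
Proof.
move=> i; rewrite /w; have hX k (j : 'I_n.+1) : 'X_j ^+ k \is [in F[n.+1], k.-homog].
  by rewrite -[k in k.-homog]mul1n; apply: dhomogMn; rewrite dhomogX /= mdeg1.
case: ifP => _ //; apply: dhomogD; last by rewrite dhomogN.
have -> : d = (wex i + (d - wex i))%N by have := wex_bounds i; lia.
by rewrite [(_ + _ - _)%N]addKn; apply: dhomogM.
Qed.

Let weval0 x (i : 'I_n.+1) : i = 0%N :> nat -> (w i).@[x] = x ord0 ^+ d.
Proof. by move=> i0; rewrite /w i0 eqxx rmorphXn /= mevalXU. Qed.

Let weval x (i : 'I_n.+1) : i != 0%N :> nat ->
  (w i).@[x] = x i ^+ wex i * x ord0 ^+ (d - wex i) - x (wpr i) ^+ d.
Proof.
by move=> i0; rewrite /w (negPf i0) mevalB mevalM !rmorphXn /= !mevalXU.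
Qed.

Lemma witness_nondegenerate x : (forall i, (w i).@[x] = 0) -> forall j, x j = 0.
Proof.
move=> h; have x0 : x ord0 = 0.
  by have := h ord0; rewrite weval0 // => /eqP; rewrite expf_eq0 => /andP[_ /eqP].
have hp (i : 'I_n.+1) : i != 0%N :> nat -> x (wpr i) = 0.
  move=> i0; have := h i; rewrite weval // x0 expr0n.
  have -> : (d - wex i == 0)%N = false by have := wex_bounds i; lia.
  by rewrite mulr0 sub0r => /eqP; rewrite oppr_eq0 expf_eq0 => /andP[_ /eqP].
move=> j; have [j0|j0] := eqVneq (j : nat) 0%N; first by rewrite -x0; congr x; apply: val_inj.
have [jn|jn] := eqVneq (j : nat) n.
  have -> : j = wpr i1 by rewrite wpr1; apply: val_inj.
  by apply: hp; rewrite inordK //; lia.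
have hj : (0 < j < n)%N by have := ltn_ord j; lia.
by rewrite -[j]inord_val -wpr_next //; apply: hp; rewrite inordK //; lia.
Qed.

Let dw (i j : 'I_n.+1) : i != 0%N :> nat -> (w i)^`M(j) =
  ('X_i ^+ (wex i).-1 *+ wex i * 'X_ord0 ^+ (d - wex i)) *+ (j == i)
  + ('X_i ^+ wex i * ('X_ord0 ^+ (d - wex i).-1 *+ (d - wex i))) *+ (j == ord0)
  - ('X_(wpr i) ^+ q *+ d) *+ (j == wpr i).
Proof.
by move=> i0; rewrite /w (negPf i0) mderivB mderivM !mderivXUn [in LHS]mulrnAl [in LHS]mulrnAr.
Qed.

Let dw0 (i j : 'I_n.+1) : i = 0%N :> nat -> (w i)^`M(j) = ('X_ord0 ^+ q *+ d) *+ (j == ord0).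
Proof. by move=> i0; rewrite /w i0 eqxx mderivXUn. Qed.

Let mevalXn x (i : 'I_n.+1) k : ('X_i ^+ k).@[x] = x i ^+ k :> F.
Proof. by rewrite rmorphXn /= mevalXU. Qed.

Let dwe x (i j : 'I_n.+1) : i != 0%N :> nat -> ((w i)^`M(j)).@[x] =
  (x i ^+ (wex i).-1 *+ wex i * x ord0 ^+ (d - wex i)) *+ (j == i)
  + (x i ^+ wex i * (x ord0 ^+ (d - wex i).-1 *+ (d - wex i))) *+ (j == ord0)
  - (x (wpr i) ^+ q *+ d) *+ (j == wpr i).
Proof.
by move=> i0; rewrite dw // mevalB mevalD !mevalMn !mevalM !mevalMn !mevalXn.
Qed.

Let dw0e x (i j : 'I_n.+1) : i = 0%N :> nat ->
  ((w i)^`M(j)).@[x] = (x ord0 ^+ q *+ d) *+ (j == ord0).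
Proof. by move=> i0; rewrite dw0 // !mevalMn mevalXn. Qed.

Let v1 : i1 = 1%N :> nat. Proof. by rewrite inordK //; lia. Qed.
Let i10 : (i1 == ord0) = false. Proof. by apply/eqP => /(congr1 val) /=; rewrite v1. Qed.

Let i1P (i : 'I_n.+1) : (i == i1) = (i == 1%N :> nat). 
Proof. by rewrite -(inj_eq val_inj) /= v1. Qed.

(** The column of derivatives along [X_1] with its factor [X_1] removed, so that the Jacobian
    determinant is [wg] times [X_1]. *)
Let col1 (i : 'I_n.+1) : S := if i == i1 then 'X_ord0 ^+ q.-1 *+ 2 else
  if i == 2%N :> nat then - ('X_i1 ^+ q.-1 *+ d) else 0.

Let wM : 'M[S]_n.+1 := \matrix_(i, j) if j == i1 then col1 i else (w i)^`M(j).

Let dw1 i : (w i)^`M(i1) = col1 i * 'X_i1.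
Proof.
rewrite /col1; have [i0|i0] := eqVneq (i : nat) 0%N.
  rewrite dw0 // i10; case: eqP => [h|_]; first by move: i0; rewrite h v1.
  by rewrite i0 /= mul0r.
rewrite dw // i10 mulr0n addr0; have [->|ii] := eqVneq i i1.
  rewrite wpr1 (_ : (i1 == ord_max) = false) ?mulr0n ?subr0.
    by rewrite /wex v1 /= mulr1n subn2 mulrC mulrnAr -mulrnAl.
  by apply/eqP => /(congr1 val) /=; rewrite v1; lia.
rewrite mulr0n add0r.
have ii' : i != 1%N :> nat by rewrite -i1P.
rewrite /wpr (negPf ii'); have [i2|i2] := eqVneq (i : nat) 2%N.
  by rewrite i2 /= eqxx mulr1n mulNr mulrnAl -exprSr prednK //; lia.
rewrite (_ : (i1 == _) = false) ?mulr0n ?oppr0 ?mul0r //.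
by apply/eqP => /(congr1 val) /=; rewrite v1 inordK; have := ltn_ord i; lia.
Qed.

Let wg := \det wM.

Let jac_witness : jac w = wg * 'X_i1.
Proof.
rewrite /jac; have -> : diffmx w = wM *m diag_mx (\row_j if j == i1 then 'X_i1 else 1).
  apply/matrixP => i j; rewrite mul_mx_diag !mxE; case: eqP => [->|_]; last by rewrite mulr1.
  exact: dw1.
rewrite det_mulmx det_diag (bigD1 i1) //= mxE eqxx big1 ?mulr1 // => j ji.
by rewrite mxE (negPf ji).
Qed.

Let axis x := (x ord0 != 0 :> F) /\ forall j : 'I_n.+1, j != 0%N :> nat -> x j = 0.

Let neq0F k : (0 < k)%N -> k%:R != 0 :> F. Proof. exact: natr_neq0F. Qed.

Let mulrn_neq0 (a : F) k : (0 < k)%N -> a != 0 -> a *+ k != 0.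
Proof. by move=> k0 a0; rewrite -mulr_natr mulf_neq0 // neq0F. Qed.

Let row_axis x i : axis x -> i != i1 -> exists2 c : F, c != 0 &
  forall j, ((w i)^`M(j)).@[x] = c *+ (j == i).
Proof.
move=> [x0 hx] ii; have [i0|i0] := eqVneq (i : nat) 0%N.
  exists (x ord0 ^+ q *+ d); first by rewrite mulrn_neq0 // expf_neq0.
  by move=> k; rewrite dw0e //; congr (_ *+ (k == _)); apply: val_inj.
have wi : wex i = 1%N.
  by rewrite /wex -i1P (negPf ii).
exists (x ord0 ^+ q); first by rewrite expf_neq0.
move=> k; rewrite dwe // wi (hx _ i0) (hx _ (wpr_neq0 i0)) expr1 mul0r mul0rn addr0.
rewrite [0 ^+ q]expr0n (_ : (q == 0)%N = false); last by lia.
by rewrite mul0rn !mul0rn subr0 expr0 mulr1n mul1r subn1.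
Qed.

Let wg_axis x : axis x -> wg.@[x] != 0.
Proof.
move=> hx; have [x0 hx0] := hx; rewrite meval_det; apply: det_neq0 => k hk.
have n0 : i1 != 0%N :> nat by rewrite v1.
have w1 : wex i1 = 2%N by rewrite /wex v1.
have Mi i j : i != i1 -> (wM i j).@[x] = if j == i1 then 0 else ((w i)^`M(j)).@[x].
  move=> ii; rewrite mxE; case: ifP => // _; rewrite /col1 (negPf ii); case: eqP => _; last exact: meval0.
  rewrite mevalN mevalMn mevalXn hx0 // expr0n (_ : (q.-1 == 0)%N = false); last by lia.
  by rewrite mul0rn oppr0.
have ki i : i != i1 -> k i = 0.
  move=> ii; have [c c0 hc] := row_axis hx ii; have := hk i.
  rewrite (bigD1 i) //= big1; first rewrite mxE Mi // (negPf ii) hc eqxx addr0 => /eqP.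
    by rewrite mulf_eq0 (negPf c0) => /eqP.
  by move=> j ji; rewrite mxE Mi // hc (negPf ji); case: ifP; rewrite ?mulr0n mul0r.
move=> i; have [->|/ki//] := eqVneq i i1; have := hk i1.
rewrite (bigD1 i1) //= big1 => [|j ji]; last by rewrite ki // mulr0.
rewrite addr0 !mxE eqxx /col1 eqxx mevalMn mevalXn => /eqP; rewrite mulf_eq0.
by rewrite (negPf (mulrn_neq0 _ (expf_neq0 _ x0))) // => /eqP.
Qed.

Definition base_point (j : 'I_n.+1) : F := (j == ord0)%:R.
Local Notation e0 := base_point.

Let e0_axis : axis e0.
Proof.
split; first by rewrite /e0 eqxx oner_eq0.
by move=> j j0; rewrite /e0; case: eqP => // h; rewrite h in j0.
Qed.

Let e0_1 : e0 i1 = 0. Proof. by rewrite /e0 i10. Qed.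

Lemma witness_base j : (w j).@[e0] = e0 j.
Proof.
have [j0|j0] := eqVneq (j : nat) 0%N.
  by rewrite weval0 // (_ : j = ord0) /e0 ?eqxx ?expr1n //; apply: val_inj.
have [_ ax] := e0_axis; rewrite weval // (ax _ j0) (ax _ (wpr_neq0 j0)) !expr0n.
have -> : (wex j == 0)%N = false by have := wex_bounds j; lia.
by rewrite mul0r subr0.
Qed.

Lemma witness_critical : (jac w).@[e0] = 0.
Proof. by rewrite jac_witness mevalM mevalXU e0_1 mulr0. Qed.

Let d1J : ((jac w)^`M(i1)).@[e0] = wg.@[e0].
Proof. by rewrite jac_witness mderivM mevalD !mevalM mderivXU eqxx mevalXU e0_1 mulr0 add0r meval1 mulr1. Qed.

Lemma jac_witness_neq0 : jac w != 0.
Proof. by apply: contraNneq (wg_axis e0_axis) => h; rewrite -d1J h mderiv0 meval0. Qed.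

(** At [e_0] the rows of the differential other than row 1 are nonzero multiples of unit rows, and
    [J = wg X_1] has a nonzero derivative along [e_1]: the kernel is transversal to the critical
    locus. *)
Lemma witness_fold : ((grad (jac w) *m \adj (diffmx w)) 0 i1).@[e0] != 0.
Proof.
rewrite -det_replace_row meval_det; apply: det_neq0 => k hk.
have ki i : i != i1 -> k i = 0.
  move=> ii; have [c c0 hc] := row_axis e0_axis ii; have := hk i.
  rewrite (bigD1 i) //= big1; first rewrite !mxE (negPf ii) hc eqxx addr0 => /eqP.
    by rewrite mulf_eq0 (negPf c0) => /eqP.
  by move=> j ji; rewrite !mxE (negPf ii) hc (negPf ji) mulr0n mul0r.
move=> i; have [->|/ki//] := eqVneq i i1; have := hk i1.
rewrite (bigD1 i1) //= big1 => [|j ji]; last by rewrite ki // mulr0.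
by rewrite addr0 !mxE eqxx d1J => /eqP; rewrite mulf_eq0 (negPf (wg_axis e0_axis)) => /eqP.
Qed.

(** Generators of the ideal of the critical cone inside the fibre over [e_0] of the affine map. Both
    are taken in affine space, where scaling by [d]-th roots of unity already moves the points of a
    fibre. *)
Definition fibre_gen (t : option 'I_n.+1) : S :=
  if t is Some j then w j - (e0 j)%:MP else jac w.

(** Suppose the multipliers taking [X_1] into the ideal had a common zero [v]. Then [v] is in the
    fibre and both [J] and [wg] vanish there. If [v_1 = 0], then [v] is on the axis, where [wg] does
    not vanish. If not, all coordinates of [v] are nonzero, and the fibre is shown to be unramified
    at [v]. *)
Let fibre_X1 : gen fibre_gen 'X_i1.
Proof.
pose b p := gen fibre_gen (p * 'X_i1).
have II := gen_ideal fibre_gen.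
have bI : is_ideal b.
  split; rewrite /b; first by rewrite mul0r; apply: ideal0 II.
    by move=> u v hu hv; rewrite mulrDl; apply: (idealD II).
  by move=> u v hv; rewrite -mulrA; apply: (idealMl II).
apply: NNPP => no; have [|v hv] := nullstellensatz bI; first by rewrite /b mul1r.
have av p : gen fibre_gen p -> p.@[v] = 0 by move=> hp; apply: hv; apply: (idealMr II).
have vw j : (w j).@[v] = e0 j.
  have := av _ (gen_mem fibre_gen (Some j)); rewrite /= mevalB mevalC => /eqP.
  by rewrite subr_eq0 => /eqP.
have vJ : (jac w).@[v] = 0 by exact: av _ (gen_mem fibre_gen None).
have vg : wg.@[v] = 0 by apply: hv; rewrite /b -jac_witness; exact: gen_mem fibre_gen None.
have v0 : v ord0 ^+ d = 1 by rewrite -(weval0 v (i := ord0)) // vw /e0 eqxx.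
have v00 : v ord0 != 0.
  by apply/eqP => h; move: v0; rewrite h expr0n => /eqP; rewrite eq_sym oner_eq0.
have vi (i : 'I_n.+1) : i != 0%N :> nat -> v i ^+ wex i * v ord0 ^+ (d - wex i) = v (wpr i) ^+ d.
  move=> i0; have := vw i; rewrite weval // /e0.
  rewrite (_ : (i == ord0) = false); last by apply: contraNF i0 => /eqP ->.
  by move/eqP; rewrite subr_eq0 => /eqP.
have vS j : (0 < j < n)%N -> v (inord j.+1) * v ord0 ^+ q = v (inord j) ^+ d.
  move=> hj; have e : (inord j.+1 : 'I_n.+1) = j.+1 :> nat by rewrite inordK //; lia.
  have := @vi (inord j.+1); rewrite wpr_next // e /wex e.
  have -> : (j.+1 == 1)%N = false by lia.
  by rewrite expr1 subn1; apply.
have [v10|v10] := eqVneq (v i1) 0.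
  have hax : axis v.
    split=> // j j0; rewrite -[j]inord_val.
    have : (0 < j <= n)%N by have := ltn_ord j; lia.
    move: (nat_of_ord j); elim=> // -[|i] IH hi //.
    have := vS i.+1; rewrite IH; last by lia.
    rewrite expr0n /= => /(_ _)/eqP; rewrite mulf_eq0 (negPf (expf_neq0 _ v00)) orbF => h.
    by apply/eqP/h; lia.
  by move: (wg_axis hax); rewrite vg eqxx.
have vj j : (0 < j <= n)%N -> v (inord j) != 0.
  elim: j => // -[|j] IH hj //; apply: contraNneq (IH _) => [h|]; last by lia.
  have := vS j.+1; rewrite h mul0r => /(_ _)/esym/eqP; rewrite expf_eq0 /= => hh.
  by apply: hh; lia.
move: vJ; rewrite meval_det => /det_kernel[k [[l kl] hk]].
have k0 : k ord0 = 0.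
  have := hk ord0; rewrite (bigD1 ord0) //= big1.
    rewrite !mxE dw0e // eqxx addr0 => /eqP; rewrite mulf_eq0 mulr1n.
    by rewrite (negPf (mulrn_neq0 _ (expf_neq0 _ v00))) // => /eqP.
  by move=> j j0; rewrite !mxE dw0e // (negPf j0) mulr0n mul0r.
have kr (i : 'I_n.+1) : i != 0%N :> nat ->
    (v i ^+ (wex i).-1 *+ wex i * v ord0 ^+ (d - wex i)) * k i = (v (wpr i) ^+ q *+ d) * k (wpr i).
  move=> i0; have := hk i; rewrite (bigD1 i) //= (bigD1 (wpr i)) /=; last first.
    by apply: contra (wpr_neq i0) => /eqP ->.
  rewrite big1.
    have e1 : (wpr i == i) = false by apply: contraNF (wpr_neq i0) => /eqP ->.
    have e2 : (i == wpr i) = false by rewrite eq_sym.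
    have e3 : (i == ord0) = false by apply: contraNF i0 => /eqP ->.
    have e4 : (wpr i == ord0) = false by apply: contraNF (wpr_neq0 i0) => /eqP ->.
    have E j : (\matrix_(i', j') (diffmx w i' j').@[v]) i j = ((w i)^`M(j)).@[v] by rewrite !mxE.
    rewrite !E !dwe // !eqxx e1 e2 e3 e4.
    by rewrite !mulr1n !mulr0n !addr0 subr0 sub0r mulNr => /eqP; rewrite subr_eq0 => /eqP.
  move=> j /andP[ji jp]; rewrite !mxE dwe // (negPf ji) (negPf jp) !mulr0n add0r subr0.
  by case: eqP => [->|_]; rewrite ?k0 ?mulr0 // mulr0n mul0r.
(* Logarithmic coordinates of a kernel vector. The linearised equations become [kap_(j+1) = d kap_j]
   and [2 kap_1 = d kap_n], hence [(d^n - 2) kap_1 = 0], and [d^n > 2] in characteristic zero. *)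
pose kap j := k (inord j) / v (inord j).
have rec (i : 'I_n.+1) : i != 0%N :> nat -> (k i / v i) *+ wex i = (k (wpr i) / v (wpr i)) *+ d.
  move=> i0; have vi0 : v i != 0 by rewrite -[i]inord_val vj //; have := ltn_ord i; lia.
  have vp0 : v (wpr i) != 0.
    by rewrite -[wpr i]inord_val vj //; have := ltn_ord (wpr i); have := wpr_neq0 i0; lia.
  apply: (mulfI (expf_neq0 d vp0)); rewrite -{1}(vi i i0).
  have e1 : v i ^+ wex i = v i ^+ (wex i).-1 * v i by rewrite -exprSr prednK //; have := wex_bounds i; lia.
  transitivity ((v i ^+ (wex i).-1 *+ wex i * v ord0 ^+ (d - wex i)) * k i).
    by rewrite e1; exact: aux1.
  by rewrite kr // exprS; apply: aux2.
have kS j : (0 < j < n)%N -> kap j.+1 = kap j *+ d.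
  move=> hj; have e : (inord j.+1 : 'I_n.+1) = j.+1 :> nat by rewrite inordK //; lia.
  have := rec (inord j.+1); rewrite wpr_next // e /wex e.
  have -> : (j.+1 == 1)%N = false by lia.
  by rewrite mulr1n; apply.
have kp j : (j < n)%N -> kap j.+1 = kap 1%N *+ (d ^ j).
  elim: j => [|j IH] hj; first by rewrite expn0 mulr1n.
  by rewrite kS ?IH; [rewrite -mulrnA expnSr | lia | lia].
have k1 : kap 1%N = 0.
  have := rec i1; rewrite wpr1 v1 /wex v1 /= => /(_ isT).
  rewrite (_ : ord_max = inord n.-1.+1 :> 'I_n.+1); last by apply: val_inj; rewrite /= inordK //; lia.
  have kn : kap n.-1.+1 = kap 1%N *+ d ^ n.-1 by apply: kp; lia.
  rewrite -/(kap 1%N) -/(kap n.-1.+1) kn.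
  rewrite -mulrnA => /eqP; rewrite -subr_eq0.
  have h2 : (2 < d ^ n.-1 * d)%N.
    have h3 : (1 <= d ^ n.-1)%N by rewrite expn_gt0.
    by rewrite (leq_trans (_ : 3 <= 1 * d)%N) // ?leq_mul2r ?h3 ?orbT //; lia.
  rewrite -opprB oppr_eq0 -mulrnBr; last exact: ltnW.
  rewrite -mulr_natr mulf_eq0 => /orP[/eqP//|].
  by rewrite (negPf (neq0F _)) // subn_gt0.
case/negP: kl; have [l0|l0] := eqVneq (l : nat) 0%N.
  by rewrite (_ : l = ord0) ?k0 //; apply: val_inj.
have hl : (0 < l <= n)%N by have := ltn_ord l; lia.
have : kap l = 0 by rewrite -(prednK (proj1 (andP hl))) kp ?k1 ?mul0rn //; lia.
rewrite /kap inord_val => /eqP; rewrite mulf_eq0 invr_eq0.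
by have := vj _ hl; rewrite inord_val => /negPf ->; rewrite orbF.
Qed.

(** From [X_1] the equations [x_(j+1) x_0^q = x_j^d] eliminate the other coordinates one after
    another, as [x_0] is invertible; what remains is [x_0^d = 1]. *)
Lemma fibre_reduction p : exists c : 'I_d -> F,
  gen fibre_gen (p - \sum_k c k *: 'X_ord0 ^+ k).
Proof.
have II := gen_ideal fibre_gen.
have X0d : gen fibre_gen ('X_ord0 ^+ d - 1).
  by have := gen_mem fibre_gen (Some ord0); rewrite /= /w /= /e0 eqxx mpolyC1.
have Xi (i : 'I_n.+1) : i != 0%N :> nat -> gen fibre_gen 'X_i.
  move=> i0; have hi := ltn_ord i; rewrite -[i]inord_val.
  have : (0 < i <= n)%N by lia.
  move: (nat_of_ord i); elim=> // -[|j] IH hj; first exact: fibre_X1.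
  have {}IH : gen fibre_gen 'X_(inord j.+1) by apply: IH; lia.
  have e : (inord j.+2 : 'I_n.+1) = j.+2 :> nat by rewrite inordK //; lia.
  have h0 : (inord j.+2 : 'I_n.+1) != 0%N :> nat by rewrite e.
  have := gen_mem fibre_gen (Some (inord j.+2)); rewrite /= /w (negPf h0) wpr_next; last by lia.
  have -> : e0 (inord j.+2) = 0 by have [_ ->] := e0_axis.
  rewrite mpolyC0 subr0 /wex e /= expr1 subn1 /= => h.
  have h1 : gen fibre_gen ('X_(inord j.+2) * 'X_ord0 ^+ q).
    apply: (ideal_congr II) (idealMr II ('X_(inord j.+1) ^+ q) IH).
    by rewrite -exprS.
  have h2 := idealMr II 'X_ord0 h1; rewrite -mulrA -exprSr in h2.
  have h3 := idealMl II 'X_(inord j.+2) X0d.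
  have := idealB II h2 h3; rewrite -mulrBr opprB addrC subrK mulr1; exact.
have hX (m : 'X_{1..n.+1}) : exists c : 'I_d -> F, gen fibre_gen ('X_[m] - \sum_k c k *: 'X_ord0 ^+ k).
  have [[i [i0 mi]]|no] := classic (exists i : 'I_n.+1, i != 0%N :> nat /\ (0 < m i)%N).
    exists (fun=> 0); rewrite big1 ?subr0 => [|k _]; last by rewrite scale0r.
    have -> : m = (m - U_(i) + U_(i))%MM by rewrite submK // lep1mP -lt0n.
    by rewrite mpolyXD; apply: (idealMl II); apply: Xi.
  have em : 'X_[m] = 'X_ord0 ^+ m ord0 :> S.
    rewrite mpolyXn; congr 'X_[_]; apply/mnmP => i; rewrite mulmnE mnm1E.
    have [<-|i0] := eqVneq ord0 i; first by rewrite mul1n.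
    rewrite mul0n; apply/eqP; rewrite eqn0Ngt; apply/negP => h; apply: no; exists i; split=> //.
    by apply: contra i0 => /eqP h0; apply/eqP/val_inj.
  exists (fun k => (k == (m ord0 %% d)%N :> nat)%:R).
  have hr : (m ord0 %% d < d)%N by rewrite ltn_mod.
  rewrite (bigD1 (Ordinal hr)) //= eqxx scale1r big1 ?addr0 => [|k kr]; last first.
    rewrite (_ : (_ == _) = false) ?scale0r //; apply: contraNF kr => /eqP h; exact/eqP/val_inj.
  rewrite em {1}(divn_eq (m ord0) d) addnC exprD -[X in _ - X]mulr1 -mulrBr.
  apply: (idealMl II); rewrite mulnC exprM subrX1; exact: (idealMr II).
elim/mpolyind: p => [|a m p _ _ [c hc]].
  by exists (fun=> 0); rewrite big1 ?subr0 => [|k _]; [apply: ideal0 II | rewrite scale0r].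
have [c' hc'] := hX m; exists (fun k => a * c' k + c k).
have -> : a *: 'X_[m] + p - \sum_k (a * c' k + c k) *: 'X_ord0 ^+ k =
   a%:MP * ('X_[m] - \sum_k c' k *: 'X_ord0 ^+ k) + (p - \sum_k c k *: 'X_ord0 ^+ k).
  rewrite (eq_bigr (fun k : 'I_d => a%:MP * (c' k *: 'X_ord0 ^+ k) + c k *: 'X_ord0 ^+ k)).
    by rewrite big_split /= -mulr_sumr mulrBr -[a *: _]mul_mpolyC opprD addrACA.
  by move=> k _; rewrite scalerDl mul_mpolyC scalerA.
by apply: (idealD II) => //; apply: (idealMl II).
Qed.

End Witness.

(** * Generic injectivity on the critical cone *)

Section GenericInjectivity.
Variables (F : closedFieldType) (charF0 : [pchar F] =i pred0).
Variables (n q : nat) (n3 : (3 <= n)%N) (q2 : (2 <= q)%N).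
Local Notation S := {mpoly F[n.+1]}.
Local Notation d := q.+1.
Local Notation c := (n.+1 * q)%N.
Local Notation w := (@witness F n q).
Local Notation e0 := (@base_point F n).
Local Notation polyfam := (@polyfam F (Ncoef n d) n _ (@forms F n d) (coefvec d)).
Implicit Types f : 'I_n.+1 -> S.

Let fgen f (t : option 'I_n.+1) : S := if t is Some j then f j - (e0 j)%:MP else jac f.
Let gdeg (t : option 'I_n.+1) := if t is Some j then d else c.

(** The bound on [A t] says that no term [A t * fgen w t] exceeds degree [B], so that a deformation
    of [w] does not leave the space of polynomials of degree at most [B]. *)
Let reducible B p := exists (a : 'I_d -> F) (A : option 'I_n.+1 -> S),
  (forall t, msize (A t) <= (B - gdeg t).+1)%N /\
  p = \sum_k a k *: 'X_ord0 ^+ k + \sum_t A t * fgen w t.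

Let reducible0 B : reducible B 0.
Proof.
exists (fun=> 0), (fun=> 0); split=> [t|]; first by rewrite msize0.
by rewrite !big1 ?addr0 // => k _; rewrite ?scale0r ?mul0r.
Qed.

Let reducibleD B u p r : reducible B p -> reducible B r -> reducible B (u *: p + r).
Proof.
move=> [a [A [sA ->]]] [a' [A' [sA' ->]]].
exists (fun k => u * a k + a' k), (fun t => u *: A t + A' t); split=> [t|].
  rewrite (leq_trans (msizeD_le _ _)) // geq_max sA' andbT.
  by rewrite (leq_trans (msizeZ_le _ _)).
rewrite scalerDr !scaler_sumr addrACA -!big_split; congr (_ + _); apply: eq_bigr => k _ /=.
  by rewrite scalerDl scalerA.
by rewrite mulrDl scalerAl.
Qed.

Let reducible_combination B p : (forall m, m \in msupp p -> reducible B 'X_[m]) -> reducible B p.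
Proof.
move=> h; rewrite [p]mpolyE; elim: (msupp p) h => [|m r IH] h; first by rewrite big_nil.
rewrite big_cons; apply: reducibleD; first by apply: h; rewrite inE eqxx.
by apply: IH => m' hm'; apply: h; rewrite inE hm' orbT.
Qed.

(** Above degree [M0] a monomial is a combination of the [w_j] with controlled degrees; replacing
    [w_j] by its value at [e_0] leaves a polynomial of smaller degree. Only finitely many monomials
    remain, and [B] is taken beyond the degrees that [fibre_reduction] uses for them. *)
Let bounded_reduction : exists B, (forall t, gdeg t <= B)%N /\ (0 < B)%N /\
  forall m : 'X_{1..n.+1}, (mdeg m <= B)%N -> reducible B 'X_[m].
Proof.
have [M0 [dM hM]] := projective_nullstellensatz (@witness_forms F n q n3 q2)
  (@witness_nondegenerate F n q n3 q2).
have h0 (m : 'X_{1..n.+1 < M0}) : exists z : ('I_d -> F) * {ffun option 'I_n.+1 -> S},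
    'X_[m] = \sum_k z.1 k *: 'X_ord0 ^+ k + \sum_t z.2 t * fgen w t.
  have [a [A eA]] := fibre_reduction charF0 n3 q2 ('X_[m] : S).
  exists (a, finfun A); apply/eqP; rewrite addrC -subr_eq eA; apply/eqP.
  by apply: eq_bigr => t _; rewrite ffunE; case: t.
have [z hz] := fin_all_exists h0.
pose B1 := \max_(m : 'X_{1..n.+1 < M0}) \max_t msize ((z m).2 t).
have hB1 (m : 'X_{1..n.+1 < M0}) t : (msize ((z m).2 t) <= B1)%N.
  by rewrite /B1 (leq_trans _ (leq_bigmax m)) // (leq_trans _ (leq_bigmax t)).
exists (M0 + B1 + c + d)%N; split; first by case=> [j|] /=; lia.
split; first by lia.
move=> m; move: {2}(mdeg m) (leqnn (mdeg m)) => k; elim: k m => [|k IH] m hk hm.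
all: have [lt|ge] := ltnP (mdeg m) M0.
- pose m' := BMultinom lt; exists (z m').1, (z m').2; split; last exact: (hz m').
  by move=> t; apply: (leq_trans (hB1 m' t)); case: t => [j|] /=; lia.
- by have := dM ord0; lia.
- pose m' := BMultinom lt; exists (z m').1, (z m').2; split; last exact: (hz m').
  by move=> t; apply: (leq_trans (hB1 m' t)); case: t => [j|] /=; lia.
have [A [hA eA]] := hM _ m ge erefl.
have -> : 'X_[m] = 1 *: (\sum_j A j * (w j - (e0 j)%:MP)) + A ord0.
  rewrite scale1r (eq_bigr (fun j => A j * w j - A j * (e0 j)%:MP)); last by move=> j _; rewrite mulrBr.
  rewrite sumrB -eA (bigD1 ord0) //= /base_point eqxx mpolyC1 mulr1 big1 ?addr0 ?subrK // => j j0.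
  by rewrite (negPf j0) mpolyC0 mulr0.
apply: reducibleD.
  exists (fun=> 0), (fun t => if t is Some j then A j else 0); split.
    case=> [j|] /=; last by rewrite msize0.
    apply: (leq_trans (homog_msize_le (hA j))); rewrite ltnS leq_sub2r //; lia.
  rewrite [X in _ = X + _]big1 ?add0r => [|k' _]; last by rewrite scale0r.
  rewrite (bigID isSome) /= [X in _ + X]big1 ?addr0; last by case=> // _; rewrite mul0r.
  rewrite (reindex_omap Some id) //=; last by case.
  by apply: eq_bigl => j; rewrite eqxx.
apply: reducible_combination => m' /(dhomog_mf (hA ord0)) /= hm'; have := dM ord0.
by move=> dM0; apply: IH; lia.
Qed.

Lemma pihomog_cmp_ndvd m e (g : 'I_m -> S) r (p : {mpoly F[m]}) : ~~ (r %| e)%N ->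
  (forall i, g i \is r.-homog) -> pihomog mdeg e (cmp g p) = 0.
Proof.
move=> re hg; elim/mpolyind: p => [|u k p _ _ IH]; first by rewrite mmap0 pihomog0.
rewrite mmapD pihomogD IH addr0.
have hX : u *: 'X_[k] \is (mdeg k).-homog by apply: dhomogZ; rewrite dhomogX.
rewrite (pihomog_homog _ (homog_cmp hg hX)); case: eqP => // h.
by move: re; rewrite -h dvdn_mull.
Qed.

(** The reduction of monomials to powers of [X_0] holds over [e_0] for the witness. Its deformation
    to any [f] is a linear system for the monomials, with coefficients polynomial in [f(x)];
    Cramer's rule solves it wherever the determinant [D] is nonzero, as it is for the witness at
    [e_0]. *)
Lemma generic_inverse : generic d (fun f => exists (D : S) (cc : 'I_n.+1 -> S) (delta : nat),
  [/\ D \is delta.-homog, forall i, cc i \is delta.-homog, cc ord0 = D,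
    forall i, dvdr (jac f) (cmp f D * 'X_i - cmp f (cc i) * 'X_ord0) & ~ dvdr (jac f) (cmp f D)]).
Proof.
have [B [gB [B0 hB]]] := bounded_reduction.
have wf := @witness_forms F n q n3 q2.
pose T : finType := 'X_{1..n.+1 < B.+1}; pose e := #|T|.
pose mon (s : 'I_e) : 'X_{1..n.+1} := val (enum_val s : T).
have expand (p : S) : (msize p <= B.+1)%N -> p = \sum_s (p@_(mon s))%:MP * 'X_[mon s].
  move=> hp; rewrite {1}(mpolywE hp) (big_enum_val (fun m : T => p@_m *: 'X_[m])) /=.
  by apply: eq_bigr => s _; rewrite mul_mpolyC.
have hred (s : 'I_e) : exists z : {ffun 'I_d -> F} * {ffun option 'I_n.+1 -> S},
    (forall t, msize (z.2 t) <= (B - gdeg t).+1)%N /\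
    'X_[mon s] = \sum_k z.1 k *: 'X_ord0 ^+ k + \sum_t z.2 t * fgen w t.
  have [a [A [sA eA]]] := hB (mon s) (bmdeg (enum_val s : T)).
  exists (finfun a, finfun A); split=> [t|]; first by rewrite ffunE.
  by rewrite eA; congr (_ + _); apply: eq_bigr => k _; rewrite ffunE.
have [z hz] := fin_all_exists hred.
(* The error made when [f] replaces the witness in the reduction. It has degree at most [B], so it
   expands in the same monomials, and it is zero for the witness. *)
pose rem f s := \sum_t (z s).2 t * (fgen w t - fgen f t).
have fgen_diff f t : forms d f -> (msize (fgen w t - fgen f t) <= (gdeg t).+1)%N.
  move=> hf; apply: homog_msize_le; case: t => [j|] /=.
    by rewrite opprB addrA subrK; apply: dhomogD; rewrite ?dhomogN.
  by apply: dhomogD; rewrite ?dhomogN; [exact: (homog_jac wf) | exact: (homog_jac hf)].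
have rem_size f s : forms d f -> (msize (rem f s) <= B.+1)%N.
  move=> hf; rewrite /rem; elim/big_ind: _ => [|u v hu hv|t _]; first by rewrite msize0.
    by rewrite (leq_trans (msizeD_le _ _)) // geq_max hu.
  by have := msizeM_leS ((hz s).1 t) (fgen_diff f t hf); rewrite subnK.
(* The variables in [N] are coordinates of the target, to be replaced by the [f_j]. Modulo the
   Jacobian, [1 - N] along [f] sends the vector of monomials to the combinations of powers of [X_0];
   for the witness, [N] vanishes at [e_0]. *)
pose N f : 'M[S]_e := \matrix_(s, s')
  (\sum_j (((z s).2 (Some j))@_(mon s'))%:MP * ('X_j - (e0 j)%:MP) + ((rem f s)@_(mon s'))%:MP).
pose D f := \det (1%:M - N f).
pose E f s k := \sum_s' \adj (1%:M - N f) s s' * ((z s').1 k)%:MP.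
have remP s : polyfam (fun f => rem f s).
  apply: polyfam_sum => t; apply: polyfamM; first exact: polyfam_const.
  apply: polyfamB; first exact: polyfam_const.
  case: t => [j|] /=; last exact: polyfam_jac.
  by apply: polyfamB; [apply: polyfam_form | apply: polyfam_const].
have DP : polyfam D.
  apply: polyfam_det => s s'.
  apply: (@polyfam_ext _ _ _ _ _ _ (fun f => (1%:M : 'M[S]_e) s s' -
    (\sum_j (((z s).2 (Some j))@_(mon s'))%:MP * ('X_j - (e0 j)%:MP) + ((rem f s)@_(mon s'))%:MP))).
    by move=> f _; rewrite !mxE.
  apply: polyfamB; first exact: polyfam_const.
  by apply: polyfamD; [apply: polyfam_const | apply: polyfam_coef].
have rel f s : forms d f -> dvdr (jac f)
    (cmp f (D f) * 'X_[mon s] - \sum_k cmp f (E f s k) * 'X_ord0 ^+ k).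
  move=> hf; have II := dvdr_ideal (jac f).
  pose M := map_mx (cmp f) (1%:M - N f).
  have row s1 : dvdr (jac f) (\sum_s' M s1 s' * 'X_[mon s'] - \sum_k (z s1).1 k *: 'X_ord0 ^+ k).
    have -> : \sum_s' M s1 s' * 'X_[mon s'] = 'X_[mon s1] - \sum_j (z s1).2 (Some j) * (f j - (e0 j)%:MP)
        - rem f s1.
      have [sA _] := hz s1.
      have e1 : 'X_[mon s1] = \sum_s' (1%:M : 'M[S]_e) s1 s' * 'X_[mon s'].
        rewrite (bigD1 s1) //= mxE eqxx mul1r big1 ?addr0 // => s' h.
        by rewrite mxE eq_sym (negPf h) mul0r.
      have e2 : \sum_j (z s1).2 (Some j) * (f j - (e0 j)%:MP) =
          \sum_s' (\sum_j (((z s1).2 (Some j))@_(mon s'))%:MP * (f j - (e0 j)%:MP)) * 'X_[mon s'].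
        under [RHS]eq_bigr => s' _ do rewrite mulr_suml.
        rewrite exchange_big; apply: eq_bigr => j _ /=.
        rewrite {1}(expand ((z s1).2 (Some j))) ?mulr_suml; last first.
          by rewrite (leq_trans (sA _)) // ltnS leq_subr.
        by apply: eq_bigr => s' _; rewrite mulrAC.
      rewrite {1}(expand _ (rem_size f s1 hf)) e1 e2 -!sumrB; apply: eq_bigr => s' _.
      rewrite -!mulrBl; congr (_ * _); rewrite !mxE mmapB mmapD mmapC opprD addrA; congr (_ - _ - _).
        by case: (s1 == s'); rewrite ?mmap1 ?mmap0 // rmorph1.
      rewrite rmorph_sum; apply: eq_bigr => j _ /=.
      by rewrite rmorphM /= mmapB !mmapC mmap_XU.
    have [_ {1}->] := hz s1.
    have -> : \sum_t (z s1).2 t * fgen w t = (z s1).2 None * jac f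
        + \sum_j (z s1).2 (Some j) * (f j - (e0 j)%:MP) + rem f s1.
      have -> : (z s1).2 None * jac f + \sum_j (z s1).2 (Some j) * (f j - (e0 j)%:MP) =
          \sum_t (z s1).2 t * fgen f t.
        rewrite (bigD1 None) //=; congr (_ + _).
        rewrite (reindex_omap Some id) //=; last by case.
        by apply/esym/eq_bigl => j; rewrite eqxx.
      rewrite /rem -big_split; apply: eq_bigr => t _ /=; by rewrite -mulrDr addrC subrK.
    set u := \sum_k _; set v := \sum_j _; set y := rem _ _; set x := _ * jac f.
    have -> : u + (x + v + y) - v - y - u = x by clearbody u v y x; ring.
    by exists ((z s1).2 None).
  have -> : cmp f (D f) * 'X_[mon s] - \sum_k cmp f (E f s k) * 'X_ord0 ^+ k =
    \sum_s1 (\adj M) s s1 * (\sum_s' M s1 s' * 'X_[mon s'] - \sum_k (z s1).1 k *: 'X_ord0 ^+ k).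
    under [RHS]eq_bigr => s1 _ do rewrite mulrBr.
    rewrite sumrB; congr (_ - _).
      have -> : cmp f (D f) = \det M by rewrite /M det_map_mx.
      have := congr1 (fun A : 'M[S]_e => (A *m \col_s' 'X_[mon s']) s 0) (mul_adj_mx M).
      rewrite /= mul_scalar_mx -mulmxA => /esym; rewrite [LHS]mxE [X in _ * X]mxE => ->.
      rewrite mxE; apply: eq_bigr => s1 _; rewrite [(M *m _) _ _]mxE; congr (_ * _).
      by apply: eq_bigr => s' _; rewrite !mxE.
    under [RHS]eq_bigr => s1 _ do rewrite mulr_sumr.
    rewrite exchange_big; apply: eq_bigr => k _ /=; rewrite /E rmorph_sum mulr_suml.
    apply: eq_bigr => s1 _ /=; rewrite rmorphM /= mmapC /M -map_mx_adj [map_mx _ (\adj _) _ _]mxE.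
    by rewrite -mul_mpolyC mulrA.
  by apply: (ideal_sum II) => s1 _; apply: (idealMl II).
have [delta hdelta] : exists delta, (cmp w (pihomog mdeg delta (D w))).@[e0] != 0.
  have D1 : (cmp w (D w)).@[e0] = 1.
    rewrite meval_cmp (meval_eq _ (witness_base F n3 q2)) meval_det -[RHS](det1 F e); congr (\det _).
    apply/matrixP => s s'; rewrite !mxE mevalB mevalD mevalC raddf_sum big1 ?add0r; last first.
      by move=> j _ /=; rewrite mevalM mevalB mevalXU [X in _ - X]mevalC subrr mulr0.
    have -> : rem w s = 0 by rewrite /rem big1 // => t _; rewrite subrr mulr0.
    by rewrite mcoeff0 subr0; case: (s == s'); rewrite ?meval0 // meval1.
  apply: NNPP => no; move: D1; rewrite [D w](pihomog_partitionE (mf := mdeg) (leqnn _)).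
  rewrite [cmp w _]rmorph_sum [(\sum_i _).@[_]]rmorph_sum big1 => [/eqP|k _] /=; first by rewrite eq_sym oner_eq0.
  by apply/eqP; apply: contraT => h; case: no; exists k.
have sU (i : 'I_n.+1) : exists s, mon s = U_(i)%MM.
  have h : (mdeg U_(i)%MM < B.+1)%N by rewrite mdeg1 ltnS.
  by exists (enum_rank (BMultinom h : T)); rewrite /mon enum_rankK.
have [sig hsig] := fin_all_exists sU.
have gen_nd : generic d (fun f => ~ dvdr (jac f) (cmp f (pihomog mdeg delta (D f)))).
  apply: (@generic_ndvd _ _ _ (fun f => jac f) (fun f => cmp f (pihomog mdeg delta (D f))) c w e0).
  - exact: polyfam_jac.
  - apply: (polyfam_cmp (q := fun i f => f i)); first exact: polyfam_form.
    exact: polyfam_pihomog.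
  - by move=> f hf; exact: (homog_jac hf).
  - exact: wf.
  - exact: jac_witness_neq0.
  - exact: witness_critical.
  - exact: hdelta.
apply: generic_imp gen_nd => f hf nd.
pose one : 'I_d := inord 1.
exists (pihomog mdeg delta (D f)), (fun i => if i == ord0 then pihomog mdeg delta (D f)
  else pihomog mdeg delta (E f (sig i) one)), delta; split=> //.
- exact: pihomogP.
- by move=> i; case: ifP => _; apply: pihomogP.
move=> i; case: ifP => [/eqP ->|_]; first by rewrite subrr; apply: ideal0 (dvdr_ideal _).
have := rel f (sig i) hf; rewrite hsig; move: (D f) (E f (sig i)) => Df Ef.
(* Compositions with [f] have components only in degrees divisible by [d], so in degree
   [delta d + 1] the power [X_0^k] survives for [k = 1] alone. *)
move=> /(dvdr_pihomog (delta * d + 1) (homog_jac hf)).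
have hXn k (j : 'I_n.+1) : 'X_j ^+ k \is [in F[n.+1], k.-homog].
  by rewrite -[k in k.-homog]mul1n; apply: dhomogMn; rewrite dhomogX /= mdeg1.
rewrite raddfB /= [pihomog _ _ (\sum_(k < d) _)]raddf_sum /= -['X_i]expr1 (pihomog_mulr _ _ (hXn 1%N i)) addn1 ltnS leq0n subn1 /=.
rewrite pihomog_cmp // (bigD1 one) //= big1 ?addr0; last first.
  move=> k k1; rewrite (pihomog_mulr _ _ (hXn _ ord0)); case: ifP => // kd.
  rewrite (@pihomog_cmp_ndvd _ _ _ d) ?mul0r //.
  have k1' : k != 1%N :> nat.
    by apply: contra k1 => /eqP h; apply/eqP/val_inj; rewrite /= inordK //; lia.
  apply/negP => /dvdnP[u hu]; have := ltn_ord k; move: k1' kd hu; move: (nat_of_ord k) => k'.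
  move=> k1' kd hu kd'; have e' : (delta * d + 1 = u * d + k')%N by move: kd hu; lia.
  have := congr1 (modn^~ d) e'; rewrite /= !modnMDl !modn_small //; last by lia.
  by move=> h; rewrite -h in k1'.
have -> : one = 1%N :> nat by rewrite inordK //; lia.
by rewrite (pihomog_mulr _ _ (hXn 1%N ord0)) ltnS leq0n subn1 /= pihomog_cmp.
Qed.

End GenericInjectivity.

(** * Counting parameters *)

Section Shears.
Variables (F : closedFieldType) (n : nat).
Local Notation S := {mpoly F[n.+1]}.
Implicit Types (s t : 'I_n.+1) (w z : 'I_n.+1 -> F) (p : S) (f : 'I_n.+1 -> S).

Definition shear s w (j : 'I_n.+1) : S := 'X_j + (w j)%:MP * 'X_s.
Definition unit_point t (j : 'I_n.+1) : F := (j == t)%:R.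

Lemma shear_homog s w e p : p \is e.-homog -> cmp (shear s w) p \is e.-homog.
Proof.
move=> hp; rewrite -[e]muln1; apply: homog_cmp hp => j; apply: dhomogD.
  by rewrite dhomogX /= mdeg1.
by rewrite mul_mpolyC; apply: dhomogZ; rewrite dhomogX /= mdeg1.
Qed.

Lemma shear0 s w p : (forall j, w j = 0) -> cmp (shear s w) p = p.
Proof.
move=> w0; rewrite -[RHS]mmap_id; apply: mmap_ext => // j.
by rewrite /shear w0 mpolyC0 mul0r addr0.
Qed.

Lemma shearK s w p : w s = 0 -> cmp (shear s (fun j => - w j)) (cmp (shear s w) p) = p.
Proof.
move=> ws; rewrite mmap_mmap -[RHS]mmap_id; apply: mmap_ext => // j.
rewrite mmapD rmorphM /= mmapC !mmap_XU /shear ws oppr0 mpolyC0 mul0r addr0.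
by rewrite mpolyCN mulNr subrK.
Qed.

Lemma meval_shear s w p z : (cmp (shear s w) p).@[z] = p.@[fun j => z j + w j * z s].
Proof.
by rewrite meval_cmp; apply: meval_eq => j; rewrite mevalD mevalM mevalC !mevalXU.
Qed.

Lemma mderiv_shear s w j k : (shear s w j)^`M(k) = (j == k)%:R + (w j)%:MP * (s == k)%:R.
Proof. by rewrite /shear mderivD mderivM mderivC mul0r add0r !mderivXU. Qed.

Lemma deriv_shear s w p z k : ((cmp (shear s w) p)^`M(k)).@[z] =
  (p^`M(k)).@[fun j => z j + w j * z s] +
  (\sum_l w l * (p^`M(l)).@[fun j => z j + w j * z s]) *+ (s == k).
Proof.
rewrite mderiv_cmp rmorph_sum /=.
transitivity (\sum_l ((p^`M(l)).@[fun j => z j + w j * z s] *+ (l == k) +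
    w l * (p^`M(l)).@[fun j => z j + w j * z s] *+ (s == k))).
  apply: eq_bigr => l _; rewrite mevalM meval_shear mderiv_shear mevalD mevalM mevalC.
  rewrite !rmorph_nat; move: (meval _ _) (w l) => u v.
  by case: (l == k); case: (s == k); rewrite ?mulr1n ?mulr0n; ring.
rewrite big_split /= sumrMnl; congr (_ + _).
rewrite (bigD1 k) //= eqxx mulr1n big1 ?addr0 // => l /negPf ->; by rewrite mulr0n.
Qed.

Lemma jac_shear s w f : w s = 0 ->
  jac (fun i => cmp (shear s w) (f i)) = cmp (shear s w) (jac f).
Proof.
move=> ws; rewrite /jac diffmx_comp det_mulmx det_map_mx.
have -> : diffmx (shear s w) = 1%:M + (\col_i (w i)%:MP) *m (\row_j (s == j)%:R).
  by apply/matrixP => i j; rewrite !mxE mderiv_shear big_ord1 !mxE.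
rewrite det_one_plus_rank1 mxE (bigD1 s) //= !mxE eqxx ws mpolyC0 mulr0 add0r big1 ?addr0 ?mulr1 //.
by move=> j js; rewrite !mxE eq_sym (negPf js) mul0r.
Qed.

Lemma meval_unit_point e p t : p \is e.-homog -> p.@[unit_point t] = p@_(U_(t) *+ e).
Proof.
move=> hp; rewrite [in RHS](mpolyE p) (raddf_sum (mcoeff _)) /meval /mmap big_seq [RHS]big_seq.
apply: eq_bigr => m /(dhomog_mf hp) /= em; rewrite mcoeffZ mcoeffX /=; congr (_ * _).
have [->|mt] := eqVneq m (U_(t) *+ e)%MM.
  rewrite /mmap1 big1 // => j _; rewrite mulmnE mnm1E /unit_point eq_sym.
  by case: (t == j); rewrite ?expr1n // mul0n expr0.
have [j [jt mj]] : exists j, j != t /\ m j != 0%N.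
  apply: NNPP => no; case/eqP: mt; apply/mnmP => j; rewrite mulmnE mnm1E.
  have no' k : k != t -> m k = 0%N.
    by move=> kt; apply/eqP; apply: contraT => h; case: no; exists k.
  have [<-|tj] := eqVneq t j; last by rewrite mul0n no' // eq_sym.
  by rewrite mul1n -em mdegE (bigD1 t) //= big1 ?addn0 // => k kt; rewrite no'.
by rewrite /mmap1 (bigD1 j) //= /unit_point (negPf jt) expr0n (negPf mj) mul0r.
Qed.

End Shears.

Section ParameterCount.
Variables (F : closedFieldType) (n d : nat) (t j0 j1 i0 : 'I_n.+1).
Local Notation S := {mpoly F[n.+1]}.

(** Three shears of the source, one combination in the target, and the coefficients: [4 (n + 1)]
    parameters more than the space of forms has dimensions. A normal form is negligible once it
    kills more than [4 (n + 1)] of them. *)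
Definition params : finType := ('I_n.+1 + 'I_n.+1 + ('I_n.+1 + 'I_n.+1) + coefIdx n d)%type.
Definition parW1 j : params := inl (inl (inl j)).
Definition parW2 j : params := inl (inl (inr j)).
Definition parW3 j : params := inl (inr (inl j)).
Definition parL j : params := inl (inr (inr j)).
Definition parC i (m : monD n d) : params := inr (i, m).

Definition pcore (p : params -> F) (i : 'I_n.+1) : S :=
  \sum_(m : monD n d) (p (parC i m))%:MP * 'X_[val (val m)].

Definition ptarget (p : params -> F) (i : 'I_n.+1) : S :=
  if i == i0 then pcore p i0 - \sum_k (p (parL k))%:MP * pcore p k else pcore p i.

Definition param_map (p : params -> F) (i : 'I_n.+1) : S :=
  cmp (shear t (fun j => p (parW1 j))) (cmp (shear j0 (fun j => p (parW2 j)))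
    (cmp (shear j1 (fun j => p (parW3 j))) (ptarget p i))).

Let K := #|{: params}|.
Let ev (p : params -> F) (k : 'I_K) := p (enum_val k).
Local Notation polyfam := (@polyfam F K n _ (fun=> True) ev).

Let polyfam_par (a : params) : polyfam (fun p => (p a)%:MP).
Proof.
exists ('X_(enum_rank a))%:MP => p _; by rewrite specC mevalXU /ev enum_rankK.
Qed.

Let polyfam_shear (s : 'I_n.+1) (W : 'I_n.+1 -> params) E : polyfam E ->
  polyfam (fun p => cmp (shear s (fun j => p (W j))) (E p)).
Proof.
move=> hE; apply: (polyfam_cmp (q := fun j p => shear s (fun j => p (W j)) j)) => // j.
apply: polyfamD; first exact: polyfam_const.
by apply: polyfamM; [apply: polyfam_par | apply: polyfam_const].
Qed.

Let polyfam_core i : polyfam (fun p => pcore p i).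
Proof.
by apply: polyfam_sum => m; apply: polyfamM; [apply: polyfam_par | apply: polyfam_const].
Qed.

Let polyfam_param_map i : polyfam (fun p => param_map p i).
Proof.
do 3!apply: polyfam_shear; rewrite /ptarget; case: (i == i0); last exact: polyfam_core.
apply: polyfamB; first exact: polyfam_core.
by apply: polyfam_sum => k; apply: polyfamM; [apply: polyfam_par | apply: polyfam_core].
Qed.

(* The forms parametrised by the points whose coordinates in the image of [g]
   vanish depend on fewer parameters than the space of all forms has dimensions. *)
Lemma generic_avoid (B : finType) (g : B -> params) : injective g -> (4 * n.+1 < #|B|)%N ->
  generic d (fun f => ~ exists p, (forall b, p (g b) = 0) /\ forall i, f i = param_map p i).
Proof.
move=> ginj hB.
have [U hU] : exists U : 'I_n.+1 -> {mpoly {mpoly F[K]}[n.+1]}, forall i p, param_map p i = @spec F K n _ ev p (U i).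
  apply: (fin_all_exists (P := fun i (U : {mpoly {mpoly F[K]}[n.+1]}) => forall p, param_map p i = @spec F K n _ ev p U)).
  by move=> i; have [U hU] := polyfam_param_map i; exists U => p; apply: hU.
pose psi (k : 'I_(Ncoef n d)) : {mpoly F[K]} :=
  let im := @enum_val _ (mem {: coefIdx n d}) k in (U im.1)@_(val (val im.2)).
have hpsi p k : coefvec d (param_map p) k = (psi k).@[ev p].
  by rewrite /coefvec /psi hU /spec /= mcoeff_map_mpoly.
pose Z : pred params := [pred a | a \in codom g].
pose I (u : {mpoly F[K]}) := forall p : params -> F, (forall b, p (g b) = 0) -> u.@[ev p] = 0.
have II : is_ideal I.
  split=> [p _|u v hu hv p hp|u v hv p hp]; first exact: meval0.
    by rewrite mevalD hu // hv // addr0.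
  by rewrite mevalM hv // mulr0.
pose K' := #|[predC Z]|.
pose y (j : 'I_K') : {mpoly F[K]} := 'X_(enum_rank (enum_val j)).
have HM (m : 'X_{1..K}) : mdeg m = 1%N -> exists b : 'I_K' -> {mpoly F[K]},
    (forall j, msize (b j) <= 1)%N /\ I ('X_[m] - \sum_j b j * y j).
  move/eqP; rewrite mdeg_eq1 => /existsP[k /eqP ->].
  have [hk|hk] := boolP (Z (enum_val k)).
    exists (fun=> 0); split=> [j|]; first by rewrite msize0.
    rewrite big1 ?subr0 => [p hp|j _]; last by rewrite mul0r.
    by rewrite mevalXU /ev; move: hk => /codomP[b ->].
  exists (fun j => (enum_val j == enum_val k)%:R); split=> [j|].
    by case: (_ == _); rewrite ?msize1 ?msize0.
  have hk' : enum_val k \in [predC Z] by rewrite inE.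
  rewrite (bigD1 (enum_rank_in hk' (enum_val k))) //= enum_rankK_in // eqxx mul1r /y enum_rankK_in //.
  rewrite enum_valK big1 ?addr0 ?subrr; first exact: ideal0 II.
  move=> j jk; rewrite (_ : (_ == _) = false) ?mul0r //; apply: contraNF jk => /eqP h.
  by apply/eqP; apply: enum_val_inj; rewrite enum_rankK_in.
have [|Phi [Phi0 hPhi]] := dependent_mod II HM psi.
  have cZ : #|Z| = #|B| by rewrite -(card_codom ginj); apply: eq_card.
  have := cardC Z; rewrite cZ; move: hB; rewrite /K'.
  have -> : #|{: params}| = (n.+1 + n.+1 + (n.+1 + n.+1) + Ncoef n d)%N.
    by rewrite !card_sum !card_ord.
  by rewrite (_ : #|[predC Z]| = #|predC Z|) //; lia.
exists Phi; split=> // f hf Pf [p [hp fp]]; case/eqP: Pf.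
have -> : Phi.@[coefvec d f] = (cmp psi Phi).@[ev p].
  rewrite rmorph_mmap; apply: mmap_ext => [c|k] /=; first by rewrite mevalC.
  rewrite -hpsi /coefvec; by rewrite fp.
by apply: hPhi.
Qed.

End ParameterCount.

Lemma generic_true (F : closedFieldType) n d (P : ('I_n.+1 -> {mpoly F[n.+1]}) -> Prop) :
  (forall f, P f) -> generic d P.
Proof. by move=> h; exists 1; rewrite oner_neq0. Qed.

Lemma generic_forall (F : closedFieldType) n d (I : finType)
    (P : I -> ('I_n.+1 -> {mpoly F[n.+1]}) -> Prop) :
  (forall i, generic d (P i)) -> generic d (fun f => forall i, P i f).
Proof.
move=> h; suff : generic d (fun f => forall i, i \in enum I -> P i f).
  by apply: generic_imp => f _ hf i; apply: hf; rewrite mem_enum.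
elim: (enum I) => [|i s IH]; first exact: generic_true.
apply: generic_imp (generic_and (h i) IH) => f _ [hi hs] k; rewrite inE => /orP[/eqP->//|]; exact: hs.
Qed.

Section Charts.
Variables (F : closedFieldType) (charF0 : [pchar F] =i pred0) (n q : nat).
Local Notation S := {mpoly F[n.+1]}.
Local Notation d := q.+1.
Implicit Types (f : 'I_n.+1 -> S) (t s j k : 'I_n.+1) (w v x : 'I_n.+1 -> F).

Let mk_proof (m : 'X_{1..n.+1}) : mdeg m == d -> (mdeg m < d.+1)%N.
Proof. by move/eqP->. Qed.

Definition mk_mon (m : 'X_{1..n.+1}) (h : mdeg m == d) : monD n d :=
  exist _ (BMultinom (mk_proof h)) h.

Let tq_proof t j : mdeg (U_(t) *+ q + U_(j))%MM == d.
Proof. by rewrite mdegD mdegMn !mdeg1 mul1n addn1. Qed.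

(** The monomial [X_t^q X_j]; up to a positive integer its coefficient is the derivative along [j]
    at the coordinate point [t]. *)
Definition tq t j := mk_mon (tq_proof t j).

Definition param_point W1 W2 W3 L f (a : params n d) : F :=
  match a with
  | inl (inl (inl j)) => W1 j | inl (inl (inr j)) => W2 j
  | inl (inr (inl j)) => W3 j | inl (inr (inr j)) => L j
  | inr (i, m) => (f i)@_(val (val m))
  end.

Lemma pcore_param_point W1 W2 W3 L f i : forms d f -> pcore (param_point W1 W2 W3 L f) i = f i.
Proof.
move=> hf; rewrite -[RHS]mmap_id (mmap_homog_sum _ _ (hf i)) /pcore.
rewrite -(big_enum_val (fun m : monD n d => ((f i)@_(val (val m)))%:MP *
  mmap1 (fun i => 'X_i : S) (val (val m)))) /=.
by apply: eq_bigr => m _; rewrite mmap1_id.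
Qed.

Lemma meval_shear_base t w (p : S) :
  (cmp (shear t w) p).@[unit_point F t] = p.@[fun j => unit_point F t j + w j].
Proof. by rewrite meval_shear; apply: meval_eq => j; rewrite /unit_point eqxx mulr1. Qed.

Lemma meval_shear_fixed s t w (p : S) : s != t ->
  (cmp (shear s w) p).@[unit_point F t] = p.@[unit_point F t].
Proof.
by move=> st; rewrite meval_shear; apply: meval_eq => j; rewrite /unit_point (negPf st) mulr0 addr0.
Qed.

Lemma deriv_shear_fixed s t w (p : S) k : s != t ->
  ((cmp (shear s w) p)^`M(k)).@[unit_point F t] = (p^`M(k)).@[unit_point F t] +
  (\sum_l w l * (p^`M(l)).@[unit_point F t]) *+ (s == k).
Proof.
move=> st; rewrite deriv_shear.
have e (r : S) : r.@[fun j => unit_point F t j + w j * unit_point F t s] = r.@[unit_point F t].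
  by apply: meval_eq => j; rewrite /unit_point (negPf st) mulr0 addr0.
by rewrite e; congr (_ + _ *+ _); apply: eq_bigr => l _; rewrite e.
Qed.

Lemma deriv_unit_point e (p : S) t j : p \is e.+1.-homog ->
  (p^`M(j)).@[unit_point F t] = p@_(U_(t) *+ e + U_(j)) *+ ((U_(t) *+ e)%MM j).+1.
Proof.
move=> hp; have := homog_mderiv j hp => /= hp'.
by rewrite (meval_unit_point t hp') mcoeff_deriv.
Qed.

Lemma mulrSn_eq0 (u : F) (k : nat) : (u *+ k.+1 == 0) = (u == 0).
Proof.
by rewrite -mulr_natr mulf_eq0 (negPf (natr_neq0F charF0 (ltn0Sn k))) orbF.
Qed.

Lemma meval_scale e (p : S) x c : p \is e.-homog -> p.@[fun j => c * x j] = c ^+ e * p.@[x].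
Proof. exact: mmap_homog_scale. Qed.

(** The shear with pivot [t] and this vector carries the coordinate point [t] to [x / x_t]. *)
Definition slope x t j : F := x j / x t - unit_point F t j.

Lemma slope_base x t : x t != 0 -> slope x t t = 0.
Proof. by move=> xt; rewrite /slope divff // /unit_point eqxx subrr. Qed.

Lemma slope_eval x t e (p : S) : p \is e.-homog ->
  (cmp (shear t (slope x t)) p).@[unit_point F t] = (x t)^-1 ^+ e * p.@[x].
Proof.
move=> hp; rewrite meval_shear_base -(meval_scale _ _ hp); apply: meval_eq => j.
by rewrite /slope addrC subrK mulrC.
Qed.

(** A shear moves a common zero to a coordinate point [t], where the [n + 1] coefficients of [X_t^d]
    vanish. With the three idle groups of parameters and the entry of the shear at its own pivot,
    [4 (n + 1) + 1] parameters are zero. *)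
Lemma generic_nondegenerate :
  generic d (fun f => forall x, (forall i, (f i).@[x] = 0) -> forall j, x j = 0).
Proof.
pose B : finType := ('I_n.+1 + 'I_n.+1 + ('I_n.+1 + 'I_n.+1) + unit)%type.
pose g t (b : B) : params n d := match b with
  | inl (inl (inl j)) => parW2 d j | inl (inl (inr j)) => parW3 d j
  | inl (inr (inl j)) => parL d j | inl (inr (inr i)) => parC i (tq t t)
  | inr _ => parW1 d t end.
have hg t : injective (g t).
  by case=> [[[a|a]|[a|a]]|[]] [[[b|b]|[b|b]]|[]] //= [->].
have hB : (4 * n.+1 < #|B|)%N by rewrite !card_sum !card_ord card_unit; lia.
have := generic_forall (fun t => @generic_avoid F n d t t t t B (g t) (hg t) hB).
apply: generic_imp => f hf av x fx; apply: NNPP => no.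
have [t xt] : exists t, x t != 0.
  by apply: NNPP => h; apply: no => j; apply/eqP; apply: contraT => xj; case: h; exists j.
pose f1 i := cmp (shear t (slope x t)) (f i).
have hf1 : forms d f1 by move=> i; apply: shear_homog.
apply: (av t); exists (param_point (fun j => - slope x t j) (fun=> 0) (fun=> 0) (fun=> 0) f1); split.
  case=> [[[a|a]|[a|a]]|[]] //=; last by rewrite slope_base ?oppr0.
  have e : (U_(t) *+ q + U_(t) = U_(t) *+ d)%MM by rewrite mulmS addmC.
  by rewrite e -(meval_unit_point t (hf1 a)) /f1 (slope_eval _ _ (hf a)) fx mulr0.
move=> i; rewrite /param_map /=.
rewrite [cmp (shear t (fun=> 0)) (cmp _ _)]shear0 // [cmp (shear t (fun=> 0)) _]shear0 // /ptarget.
have -> : (if i == t then pcore (param_point (fun j => - slope x t j) (fun=> 0) (fun=> 0) (fun=> 0) f1) t -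
    \sum_k (0 : F)%:MP * pcore (param_point (fun j => - slope x t j) (fun=> 0) (fun=> 0) (fun=> 0) f1) k
    else pcore (param_point (fun j => - slope x t j) (fun=> 0) (fun=> 0) (fun=> 0) f1) i) = f1 i.
  case: eqP => [->|_]; last exact: pcore_param_point.
  by rewrite big1 ?subr0 ?pcore_param_point // => k _; rewrite mpolyC0 mul0r.
by rewrite /f1 shearK // slope_base.
Qed.

End Charts.

(** * Singular points of the critical locus on a plane *)

Section Smooth.
Variables (F : closedFieldType) (charF0 : [pchar F] =i pred0) (n q : nat).
Hypotheses (n3 : (3 <= n)%N) (q2 : (2 <= q)%N).
Local Notation S := {mpoly F[n.+1]}.
Local Notation d := q.+1.
Local Notation up := (@unit_point F n).
Implicit Types (f g : 'I_n.+1 -> S) (t s i j k : 'I_n.+1) (w v x : 'I_n.+1 -> F).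

Let tqq_proof t j k : mdeg (U_(t) *+ q.-1 + U_(j) + U_(k))%MM == d.
Proof. by rewrite !mdegD mdegMn !mdeg1 mul1n; lia. Qed.

Definition tqq t j k := mk_mon (tqq_proof t j k).

Let tq_inj t j k : tq q t j = tq q t k -> j = k.
Proof.
move/(congr1 (fun m : monD n d => val (val m))) => /= /mnmP/(_ j).
by rewrite !mnmDE !mulmnE !mnm1E eqxx; case: (k =P j) => // _; lia.
Qed.

Let tq_tqq t j k l : k != t -> l != t -> tq q t j <> tqq t k l.
Proof.
move=> kt lt /(congr1 (fun m : monD n d => val (val m))) /= /mnmP/(_ t).
rewrite !mnmDE !mulmnE !mnm1E eqxx (negPf kt) (negPf lt); lia.
Qed.

Let tqq_inj t k l l' : tqq t l k = tqq t l' k -> l = l'.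
Proof.
move/(congr1 (fun m : monD n d => val (val m))) => /= /mnmP/(_ l).
by rewrite !mnmDE !mulmnE !mnm1E eqxx; case: (l' =P l) => // _; lia.
Qed.

Let parC_inj i i' (m m' : monD n d) : parC i m = parC i' m' -> i = i' /\ m = m'.
Proof. by move=> h; injection h => -> ->. Qed.

Let mulrSn0 (u : F) (k : nat) : u *+ k.+1 = 0 -> u = 0.
Proof. by move/eqP; rewrite (mulrSn_eq0 charF0) => /eqP. Qed.

Let inord3 (j : 'I_(n - 2)) : (inord (j + 3) : 'I_n.+1) = (j + 3)%N :> nat.
Proof. by have hj := ltn_ord j; rewrite inordK //; lia. Qed.

(** Corank one: [n - 1] zeros for a point of the plane with pivot [t], one each for the pivots [j0]
    and [i0], [n + 1] for the idle third shear, [n + 1] for column [j0] of the differential, [n] for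
    the rest of row [i0], and two second derivatives. The total is [4 (n + 1) + 1]. *)
Definition zeros1 : finType :=
  (('I_(n - 2) + unit) + (unit + unit) + ('I_n.+1 + 'I_n.+1) + ('I_n + bool))%type.

Definition chart1 t j0 j1 i0 (b : zeros1) : params n d := match b with
  | inl (inl (inl (inl j))) => parW1 d (inord (j + 3)) | inl (inl (inl (inr _))) => parW1 d t
  | inl (inl (inr (inl _))) => parW2 d j0 | inl (inl (inr (inr _))) => parL d i0
  | inl (inr (inl j)) => parW3 d j | inl (inr (inr i)) => parC i (tq q t j0)
  | inr (inl k) => parC i0 (tq q t (lift j0 k))
  | inr (inr b) => parC i0 (tqq t (if b then j0 else j1) j0) end.

Let chart1_inj t j0 j1 i0 : (t < 3)%N -> j0 != t -> j1 != t -> j1 != j0 ->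
  injective (chart1 t j0 j1 i0).
Proof.
move=> t3 j0t j1t j01.
have h3 (j : 'I_(n - 2)) : inord (j + 3) <> t by move/(congr1 val) => /=; rewrite inord3; lia.
have hb b : (if b then j0 else j1) != t by case: b.
case=> [[[[a|[]]|[[]|[]]]|[a|a]]|[a|a]] [[[[b|[]]|[[]|[]]]|[b|b]]|[b|b]] //=; rewrite /parW1 /parW2 /parW3 /parL.
- by case=> /(congr1 val) /=; rewrite !inord3 => h; do 4!congr inl; apply: val_inj; move: h => /=; lia.
- by case=> /h3.
- by case=> /esym/h3.
- by case=> ->.
- by move/parC_inj => [-> _].
- by move/parC_inj => [_ /tq_inj/eqP]; rewrite (negPf (neq_lift _ _)).
- by move/parC_inj => [_ /tq_tqq]; case.
- by move/parC_inj => [_ /tq_inj/esym/eqP]; rewrite (negPf (neq_lift _ _)).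
- by move/parC_inj => [_ /tq_inj/lift_inj ->].
- by move/parC_inj => [_ /tq_tqq]; case.
- by move/parC_inj => [_ /esym/tq_tqq]; case.
- by move/parC_inj => [_ /esym/tq_tqq]; case.
move/parC_inj => [_ /tqq_inj]; case: a; case: b => // /eqP; first by rewrite eq_sym (negPf j01).
by rewrite (negPf j01).
Qed.

(** Corank at least two: [n - 1] zeros for the point, one for the second shear and two for the
    third, [n + 1] for the idle target, and [2 (n + 1)] for two columns of the differential. The
    total is again [4 (n + 1) + 1]. *)
Definition zeros2 : finType :=
  (('I_(n - 2) + unit) + (unit + (unit + unit)) + ('I_n.+1 + ('I_n.+1 + 'I_n.+1)))%type.

Definition chart2 t j0 j1 (b : zeros2) : params n d := match b with
  | inl (inl (inl j)) => parW1 d (inord (j + 3)) | inl (inl (inr _)) => parW1 d t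
  | inl (inr (inl _)) => parW2 d j0 | inl (inr (inr (inl _))) => parW3 d j1
  | inl (inr (inr (inr _))) => parW3 d j0 | inr (inl j) => parL d j
  | inr (inr (inl i)) => parC i (tq q t j0) | inr (inr (inr i)) => parC i (tq q t j1) end.

Let chart2_inj t j0 j1 : (t < 3)%N -> j1 != j0 -> injective (chart2 t j0 j1).
Proof.
move=> t3 j01.
have h3 (j : 'I_(n - 2)) : inord (j + 3) <> t by move/(congr1 val) => /=; rewrite inord3; lia.
case=> [[[a|[]]|[[]|[[]|[]]]]|[a|[a|a]]] [[[b|[]]|[[]|[[]|[]]]]|[b|[b|b]]] //=; rewrite /parW1 /parW2 /parW3 /parL.
- by case=> /(congr1 val) /=; rewrite !inord3 => h; do 3!congr inl; apply: val_inj; move: h => /=; lia.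
- by case=> /h3.
- by case=> /esym/h3.
- by case=> /eqP; rewrite (negPf j01).
- by case=> /esym/eqP; rewrite (negPf j01).
- by case=> ->.
- by move/parC_inj => [-> _].
- by move/parC_inj => [_ /tq_inj/esym/eqP]; rewrite (negPf j01).
- by move/parC_inj => [_ /tq_inj/eqP]; rewrite (negPf j01).
- by move/parC_inj => [-> _].
Qed.

Let euler_base g i t : forms d g -> ((g i)^`M(t)).@[up t] = (g i).@[up t] *+ d.
Proof.
move=> hg; rewrite (deriv_unit_point t t (hg i)) (meval_unit_point t (hg i)).
by rewrite mulmnE mnm1E eqxx mul1n; congr (_@_ _ *+ _); rewrite mulmS addmC.
Qed.

(** By Euler the derivative along [t] at the coordinate point [t] is [d] times the value, which is
    not zero; so a kernel vector has another nonzero entry. A shear with that pivot straightens the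
    vector and leaves the point fixed. *)
Let kernel_escape g v t i : forms d g -> (g i).@[up t] != 0 -> (exists j, v j != 0) ->
  (forall i, \sum_j ((g i)^`M(j)).@[up t] * v j = 0) -> exists s, s != t /\ v s != 0.
Proof.
move=> hg gt [j vj] hv; apply: NNPP => no.
have v0 s : s != t -> v s = 0 by move=> st; apply/eqP; apply: contraT => vs; case: no; exists s.
have vt : v t != 0 by have [<-//|jt] := eqVneq j t; rewrite v0 ?eqxx in vj.
have := hv i; rewrite (bigD1 t) //= big1 ?addr0 => [|s st]; last by rewrite v0 ?mulr0.
rewrite euler_base // => /eqP; rewrite mulf_eq0 (negPf vt) orbF => /eqP/mulrSn0 h.
by rewrite h eqxx in gt.
Qed.

Let slope_sum v s (u : 'I_n.+1 -> F) : v s != 0 -> \sum_l u l * v l = 0 ->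
  u s + \sum_l slope v s l * u l = 0.
Proof.
move=> vs h; rewrite (eq_bigr (fun l => (v s)^-1 * (u l * v l) - unit_point F s l * u l)).
  rewrite sumrB -mulr_sumr h mulr0 sub0r (bigD1 s) //= /unit_point eqxx mul1r big1 ?addr0 ?subrr //.
  by move=> l /negPf ->; rewrite mul0r.
by move=> l _; rewrite /slope mulrBl; congr (_ - _); rewrite mulrAC mulrC [u l * _]mulrC.
Qed.

Let pull v s t (p : S) : s != t -> v s != 0 -> \sum_l (p^`M(l)).@[up t] * v l = 0 ->
  ((cmp (shear s (slope v s)) p)^`M(s)).@[up t] = 0.
Proof.
by move=> st vs h; rewrite deriv_shear_fixed // eqxx mulr1n; apply: slope_sum.
Qed.

Let pull_other v s t (p : S) k : s != t -> s != k ->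
  ((cmp (shear s (slope v s)) p)^`M(k)).@[up t] = (p^`M(k)).@[up t].
Proof. by move=> st sk; rewrite deriv_shear_fixed // (negPf sk) mulr0n addr0. Qed.

Let coef_tq g i t j : forms d g -> ((g i)^`M(j)).@[up t] = 0 -> (g i)@_(val (val (tq q t j))) = 0.
Proof.
by move=> hg; rewrite (deriv_unit_point t j (hg i)) => /mulrSn0.
Qed.

Let third (i j : 'I_n.+1) : exists k, k != i /\ k != j.
Proof.
have h (c : nat) : (c < 3)%N -> (inord c : 'I_n.+1) = c :> nat by move=> hc; rewrite inordK //; lia.
apply: NNPP => no.
have h' (c : nat) : (c < 3)%N -> (c == i :> nat) || (c == j :> nat).
  move=> hc; apply: contraT; rewrite negb_or => /andP[ci cj]; case: no; exists (inord c).
  by split; [apply: contra ci | apply: contra cj] => /eqP <-; rewrite h.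
have := h' 0%N isT; have := h' 1%N isT; have := h' 2%N isT; lia.
Qed.

Let card_zeros1 : (4 * n.+1 < #|zeros1|)%N.
Proof. by rewrite /zeros1 !card_sum !card_ord card_unit card_bool; lia. Qed.

Let card_zeros2 : (4 * n.+1 < #|zeros2|)%N.
Proof. by rewrite /zeros2 !card_sum !card_ord card_unit; lia. Qed.

Let cofactor_zero (M : 'M[S]_n.+1) t i k j0 : k != j0 -> (forall i, (M i j0).@[up t] = 0) ->
  (cofactor M i k).@[up t] = 0.
Proof.
move=> kj h; rewrite /cofactor mevalM meval_det.
have [j' ej] : exists j' : 'I_n, j0 = lift k j' by have [j' -> _] := unlift_some kj; exists j'.
by rewrite (expand_det_col _ j') big1 ?mulr0 // => l _; rewrite !mxE -ej h mul0r.
Qed.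

(** With [lam] in the left kernel of the differential, this makes row [i0] vanish; [ptarget] is its
    inverse. *)
Let target_shear g (lam : 'I_n.+1 -> F) i0 i : S :=
  if i == i0 then g i0 + \sum_k (slope lam i0 k)%:MP * g k else g i.

Let target_forms g lam i0 : forms d g -> forms d (target_shear g lam i0).
Proof.
move=> hg i; rewrite /target_shear; case: ifP => // _; apply: dhomogD => //.
by apply: homog_sum => k _; rewrite mul_mpolyC; apply: dhomogZ.
Qed.

Let target_undo g (lam : 'I_n.+1 -> F) i0 : lam i0 != 0 -> target_shear g lam i0 i0 -
  \sum_k (slope lam i0 k)%:MP * target_shear g lam i0 k = g i0.
Proof.
move=> l0; rewrite {1}/target_shear eqxx.
rewrite [X in _ - X](eq_bigr (fun k => (slope lam i0 k)%:MP * g k)) ?addrK // => k _.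
rewrite /target_shear; case: eqP => // ->.
by rewrite slope_base // mpolyC0 !mul0r.
Qed.

Let target_jac g (lam : 'I_n.+1 -> F) i0 : lam i0 != 0 -> jac (target_shear g lam i0) = jac g.
Proof.
move=> l0; pose r : 'rV[S]_n.+1 := \row_k ((k == i0)%:R + (slope lam i0 k)%:MP).
have -> : jac (target_shear g lam i0) = \det (replace_row 1%:M i0 r *m diffmx g).
  congr (\det _); apply/matrixP => i j; rewrite !mxE /target_shear.
  have [->|ii] := eqVneq i i0.
    rewrite mderivD raddf_sum /=.
    under [RHS]eq_bigr => k _ do rewrite !mxE eqxx mulrDl.
    rewrite big_split /=; congr (_ + _).
      rewrite (bigD1 i0) //= eqxx mul1r big1 ?addr0 // => k /negPf ->; by rewrite mul0r.
    by apply: eq_bigr => k _; rewrite mderivM mderivC mul0r add0r.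
  rewrite (bigD1 i) //= !mxE (negPf ii) eqxx mul1r big1 ?addr0 // => k ki.
  by rewrite !mxE (negPf ii) eq_sym (negPf ki) mul0r.
by rewrite det_mulmx det_replace_row1 mxE eqxx slope_base // mpolyC0 addr0 mul1r.
Qed.

Let target_deriv g lam i0 i j x : ((target_shear g lam i0 i)^`M(j)).@[x] =
  if i == i0 then ((g i0)^`M(j)).@[x] + \sum_k slope lam i0 k * ((g k)^`M(j)).@[x]
  else ((g i)^`M(j)).@[x].
Proof.
rewrite /target_shear; case: ifP => // _; rewrite mderivD mevalD; congr (_ + _).
rewrite [(\sum_k _)^`M(j)]raddf_sum [meval _ _]rmorph_sum; apply: eq_bigr => k _ /=.
by rewrite mderivM mderivC mul0r add0r mevalM mevalC.
Qed.

(** A singular point is moved to the coordinate point [t] and a kernel vector to [e_j0]. In corank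
    one the gradient of [J] is a nonzero cofactor times the derivatives of the entry [(i0, j0)], so
    these second derivatives vanish, and two of them outweigh the two dimensions of the plane. In
    higher corank a second kernel vector is straightened instead. *)
Theorem generic_smooth : generic d (fun f => forall x, (forall j : 'I_n.+1, (3 <= j)%N -> x j = 0) ->
  (exists j, x j != 0) -> (jac f).@[x] = 0 -> exists j, ((jac f)^`M(j)).@[x] != 0).
Proof.
pose T : finType := ('I_n.+1 * 'I_n.+1 * ('I_n.+1 * 'I_n.+1))%type.
have av1 : generic d (fun f => forall a : T, let: (t, j0, (j1, i0)) := a in
    (t < 3)%N -> j0 != t -> j1 != t -> j1 != j0 ->
    ~ exists p, (forall b, p (chart1 t j0 j1 i0 b) = 0) /\ forall i, f i = param_map t j0 j1 i0 p i).
  apply: generic_forall => -[[t j0] [j1 i0]].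
  have [/and4P[h1 h2 h3 h4]|no] := boolP [&& (t < 3)%N, j0 != t, j1 != t & j1 != j0].
    have h := @generic_avoid F n d t j0 j1 i0 zeros1 _ (@chart1_inj t j0 j1 i0 h1 h2 h3 h4) card_zeros1.
    by apply: generic_imp h => f _ h' *.
  by apply: generic_true => f h1 h2 h3 h4; move: no; rewrite h1 h2 h3 h4.
have av2 : generic d (fun f => forall a : T, let: (t, j0, (j1, i0)) := a in
    (t < 3)%N -> j1 != j0 ->
    ~ exists p, (forall b, p (chart2 t j0 j1 b) = 0) /\ forall i, f i = param_map t j0 j1 i0 p i).
  apply: generic_forall => -[[t j0] [j1 i0]].
  have [/andP[h1 h2]|no] := boolP ((t < 3)%N && (j1 != j0)).
    have h := @generic_avoid F n d t j0 j1 i0 zeros2 _ (@chart2_inj t j0 j1 h1 h2) card_zeros2.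
    by apply: generic_imp h => f _ h' *.
  by apply: generic_true => f h1 h2; move: no; rewrite h1 h2.
apply: generic_imp (generic_and (generic_nondegenerate F n q) (generic_and av1 av2)).
move=> f hf [nf [{}av1 {}av2]] x xL [t xt] Jx; apply: NNPP => sing.
have {sing} dJ j : ((jac f)^`M(j)).@[x] = 0.
  by apply/eqP; apply: contraT => h; case: sing; exists j.
have t3 : (t < 3)%N by rewrite ltnNge; apply: contra xt => /xL ->.
pose f1 i := cmp (shear t (slope x t)) (f i).
have hf1 : forms d f1 by move=> i; apply: shear_homog.
have hJ := homog_jac hf.
have J1 : (jac f1).@[up t] = 0.
  by rewrite /f1 jac_shear ?slope_base // (slope_eval _ _ hJ) Jx mulr0.
have dJ1 k : ((jac f1)^`M(k)).@[up t] = 0.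
  rewrite /f1 jac_shear ?slope_base // deriv_shear.
  have e l : ((jac f)^`M(l)).@[fun j => up t j + slope x t j * up t t] = 0.
    by rewrite -meval_shear (slope_eval _ _ (homog_mderiv l hJ)) dJ mulr0.
  by rewrite e big1 ?mul0rn ?addr0 // => l _; rewrite e mulr0.
have [i nf1] : exists i, (f1 i).@[up t] != 0.
  apply: NNPP => no; have xt' := xt; case/eqP: xt'; apply: nf => i; apply/eqP; apply: contraT => h.
  case: no; exists i; rewrite /f1 (slope_eval _ _ (hf i)) mulf_neq0 // expf_neq0 //.
  by rewrite invr_eq0.
have [v [v0 hv']] : exists v, (exists j, v j != 0) /\
    forall i, \sum_j ((f1 i)^`M(j)).@[up t] * v j = 0.
  move: J1; rewrite meval_det => /det_kernel[v [v0 hv]]; exists v; split=> // k.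
  by rewrite -[RHS](hv k); apply: eq_bigr => j _; rewrite !mxE.
have [j0 [j0t vj0]] := kernel_escape hf1 nf1 v0 hv'.
pose f2 i := cmp (shear j0 (slope v j0)) (f1 i).
have hf2 : forms d f2 by move=> k; apply: shear_homog.
have nf2 : (f2 i).@[up t] != 0 by rewrite /f2 meval_shear_fixed.
have J2 : (jac f2).@[up t] = 0 by rewrite /f2 jac_shear ?slope_base // meval_shear_fixed.
have dJ2 k : ((jac f2)^`M(k)).@[up t] = 0.
  rewrite /f2 jac_shear ?slope_base // deriv_shear_fixed // dJ1 big1 ?mul0rn ?addr0 // => l _.
  by rewrite dJ1 mulr0.
have col2 k : ((f2 k)^`M(j0)).@[up t] = 0 by apply: pull.
have [lam [[i0 li0] hlam]] : exists lam : 'I_n.+1 -> F, (exists i, lam i != 0) /\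
    forall j, \sum_i ((f2 i)^`M(j)).@[up t] * lam i = 0.
  move: J2; rewrite meval_det -det_tr => /det_kernel[lam [l0 hl]]; exists lam; split=> // j.
  by rewrite -[RHS](hl j); apply: eq_bigr => k _; rewrite !mxE.
have undo k :
    cmp (shear t (fun j => - slope x t j)) (cmp (shear j0 (fun j => - slope v j0 j)) (f2 k)) = f k.
  by rewrite /f2 shearK ?slope_base // /f1 shearK ?slope_base.
have xL3 (j : 'I_(n - 2)) : - slope x t (inord (j + 3)) = 0.
  rewrite /slope xL ?inord3 ?leq_addl // mul0r sub0r opprK /unit_point.
  by case: eqP => // h; move: t3; rewrite -h inord3; lia.
pose f3 := target_shear f2 lam i0.
have hf3 : forms d f3 by apply: target_forms.
have row3 j : ((f3 i0)^`M(j)).@[up t] = 0.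
  by rewrite target_deriv eqxx; apply: (slope_sum (u := fun k => ((f2 k)^`M(j)).@[up t])).
have col3 k : ((f3 k)^`M(j0)).@[up t] = 0.
  rewrite target_deriv; case: ifP => // _; rewrite col2 add0r big1 // => l _; by rewrite col2 mulr0.
(* Row [i0] and column [j0] vanish at the point. In the derivative of the expansion along row [i0],
   the cofactors other than that of [j0] contain the zero column, so one term is left. *)
have dJ3 j : ((f3 i0)^`M(j0)^`M(j)).@[up t] * (cofactor (diffmx f3) i0 j0).@[up t] = 0.
  have : ((\sum_k diffmx f3 i0 k * cofactor (diffmx f3) i0 k)^`M(j)).@[up t] = 0.
    have <- : jac f3 = \sum_k diffmx f3 i0 k * cofactor (diffmx f3) i0 k by exact: expand_det_row.
    have -> : jac f3 = jac f2 by exact: target_jac.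
    exact: dJ2.
  rewrite [(\sum_k _)^`M(j)]raddf_sum [(\sum_k _).@[_]]rmorph_sum /=.
  rewrite (bigD1 j0) //= big1 ?addr0 => [|k kj].
    move: (cofactor (diffmx f3) i0 j0) => C.
    by rewrite mderivM mevalD !mevalM !mxE col3 mul0r addr0.
  have : (cofactor (diffmx f3) i0 k).@[up t] = 0.
    by apply: (cofactor_zero _ kj) => l; rewrite mxE col3.
  move: (cofactor (diffmx f3) i0 k) => C hC.
  by rewrite mderivM mevalD !mevalM !mxE row3 mul0r addr0 hC mulr0.
have [cof|cof] := eqVneq (cofactor (diffmx f3) i0 j0).@[up t] 0; last first.
  have [j1 [j1t j10]] := third t j0.
  apply: (av1 (t, j0, (j1, i0))) => //.
  exists (param_point (fun j => - slope x t j) (fun j => - slope v j0 j) (fun=> 0) (slope lam i0) f3).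
  split=> [b|k].
    case: b => [[[[a|[]]|[[]|[]]]|[a|a]]|[a|a]] /=.
    - exact: xL3.
    - by rewrite slope_base // oppr0.
    - by rewrite slope_base // oppr0.
    - exact: slope_base.
    - by [].
    - exact: (coef_tq hf3).
    - exact: (coef_tq hf3).
    have := dJ3 (if a then j0 else j1); move/eqP; rewrite mulf_eq0 (negPf cof) orbF => /eqP.
    have hq : (q = q.-1.+1)%N by lia.
    have h3' := homog_mderiv j0 (hf3 i0); rewrite /= hq in h3'.
    rewrite (deriv_unit_point _ _ h3') => /mulrSn0; rewrite mcoeff_deriv => /mulrSn0; exact.
  rewrite /param_map /= [cmp (shear j1 _) _]shear0 // -{1}(undo k); do 2!congr (mmap _ _ _).
  rewrite /ptarget !pcore_param_point //; case: eqP => [->|/eqP ki]; last first.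
    by rewrite /f3 /target_shear (negPf ki).
  rewrite -(target_undo f2 li0) -/f3; congr (_ - _).
  by apply: eq_bigr => l _; rewrite pcore_param_point.
(* A kernel vector of the minor, extended by zero at [j0], is killed by every row but [i0]; the left
   kernel relation [lam], whose entry at [i0] is nonzero, takes care of row [i0]. *)
have [u [u0 uj0 hu]] : exists u : 'I_n.+1 -> F, [/\ exists j, u j != 0, u j0 = 0 &
    forall i, \sum_j ((f2 i)^`M(j)).@[up t] * u j = 0].
  move/eqP: cof; rewrite /cofactor mevalM mulf_eq0 => /orP[/eqP h|/eqP].
    by move: h; rewrite rmorphXn /= mevalN meval1 => /eqP; rewrite signr_eq0.
  rewrite meval_det => /det_kernel[u' [[k uk] hu']].
  pose u j := if unlift j0 j is Some j' then u' j' else 0.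
  have ul (j' : 'I_n) : u (lift j0 j') = u' j' by rewrite /u liftK.
  have u00 : u j0 = 0 by rewrite /u unlift_none.
  exists u; split=> //; first by exists (lift j0 k); rewrite ul.
  have hi k' : k' != i0 -> \sum_j ((f2 k')^`M(j)).@[up t] * u j = 0.
    move=> ki; rewrite (bigD1_ord j0) //= u00 mulr0 add0r.
    have [k2 ek] : exists k2 : 'I_n, k' = lift i0 k2.
      by rewrite eq_sym in ki; have [k2 -> _] := unlift_some ki; exists k2.
    rewrite -[RHS](hu' k2); apply: eq_bigr => j _; rewrite !mxE ul -ek; congr (_ * _).
    by rewrite target_deriv (negPf ki).
  move=> k'; have [->|/hi//] := eqVneq k' i0; apply: (mulfI li0); rewrite mulr0.
  pose rho l := \sum_j ((f2 l)^`M(j)).@[up t] * u j.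
  have hrho l : l != i0 -> rho l = 0 by apply: hi.
  have : \sum_l lam l * rho l = 0.
    under eq_bigr => l _ do rewrite mulr_sumr.
    rewrite exchange_big big1 // => j _ /=.
    under eq_bigr => l _ do rewrite mulrA [lam l * _]mulrC.
    by rewrite -mulr_suml hlam mul0r.
  rewrite -/(rho i0); clearbody rho.
  by rewrite (bigD1 i0) //= big1 ?addr0 // => l /hrho ->; rewrite mulr0.
have [j1 [j1t uj1]] := kernel_escape hf2 nf2 u0 hu.
have j10 : j1 != j0 by apply: contraNneq uj1 => ->; rewrite uj0.
pose f4 k := cmp (shear j1 (slope u j1)) (f2 k).
have hf4 : forms d f4 by move=> k; apply: shear_homog.
apply: (av2 (t, j0, (j1, t))) => //.
exists (param_point (fun j => - slope x t j) (fun j => - slope v j0 j) (fun j => - slope u j1 j) (fun=> 0) f4).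
split=> [b|k].
  case: b => [[[a|[]]|[[]|[[]|[]]]]|[a|[a|a]]] /=.
  - exact: xL3.
  - by rewrite slope_base // oppr0.
  - by rewrite slope_base // oppr0.
  - by rewrite slope_base // oppr0.
  - by rewrite /slope uj0 mul0r /unit_point eq_sym (negPf j10) subr0 oppr0.
  - by [].
  - by apply: (coef_tq hf4); rewrite pull_other.
  - by apply: (coef_tq hf4); apply: pull.
rewrite /param_map /= -{1}(undo k); do 2!congr (mmap _ _ _).
rewrite [ptarget t _ k](_ : _ = f4 k); last first.
  rewrite /ptarget !pcore_param_point //; case: eqP => [->|//].
  by rewrite big1 ?subr0 // => l _; rewrite /= mpolyC0 mul0r.
by rewrite /f4 shearK // slope_base.
Qed.

End Smooth.

(** * The theorem *)

Section Scaling.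
Variables (F : closedFieldType) (n d : nat).
Local Notation S := {mpoly F[n.+1]}.

Lemma fapply_scale (f : 'I_n.+1 -> S) (a s : F) (x y : 'I_n.+1 -> F) : forms d f ->
  (forall j, x j = s * y j) -> forall i, fapply (fun i => a *: f i) x i = a * s ^+ d * fapply f y i.
Proof.
move=> hf h i; rewrite /fapply mevalZ -mulrA; congr (_ * _).
rewrite -(meval_scale _ _ (hf i)); exact: meval_eq.
Qed.

Lemma iter_scale (f : 'I_n.+1 -> S) (a : F) x k : forms d f -> a != 0 ->
  exists2 s : F, s != 0 & forall j, iter k (fapply (fun i => a *: f i)) x j = s * iter k (fapply f) x j.
Proof.
move=> hf a0; elim: k => [|k [s s0 IH]]; first by exists 1 => [|j]; rewrite ?oner_eq0 ?mul1r.
exists (a * s ^+ d); first by rewrite mulf_neq0 ?expf_neq0.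
by move=> j /=; rewrite (fapply_scale _ hf IH).
Qed.

Lemma in_crit_scale (f : 'I_n.+1 -> S) (a : F) x : a != 0 ->
  in_crit (fun i => a *: f i) x <-> in_crit f x.
Proof.
move=> a0; have e : jacdet (fun i => a *: f i) x = a ^+ n.+1 * jacdet f x.
  rewrite /jacdet -detZ; congr (\det _); apply/matrixP => i j; by rewrite !mxE mderivZ mevalZ.
split=> -[x0 h]; split=> //; last by rewrite e h mulr0.
by move/eqP: h; rewrite e mulf_eq0 expf_eq0 (negPf a0) andbF => /eqP.
Qed.

Lemma iter_crit_sub_scale (f : 'I_n.+1 -> S) (a : F) k : forms d f -> a != 0 ->
  iter_crit_sub f k -> iter_crit_sub (fun i => a *: f i) k.
Proof.
move=> hf a0 h x /(in_crit_scale f x a0) /h[y [cy [l [l0 hl]]]].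
exists y; split; first by apply/in_crit_scale.
have [s s0 hs] := iter_scale x k hf a0; exists (s * l / a); split.
  by rewrite !mulf_neq0 ?invr_eq0.
by move=> j; rewrite hs hl /fapply mevalZ mulrA [in RHS]mulrA divfK.
Qed.

(** The values of [G] on the line through [v] are a polynomial in [a] whose coefficients are the
    values of the components at [v]; it vanishes at every nonzero [a]. *)
Lemma homog_components_vanish N (G : {mpoly F[N]}) (v : 'I_N -> F) :
  (forall a, a != 0 -> G.@[fun k => a * v k] = 0) -> forall e, (pihomog mdeg e G).@[v] = 0.
Proof.
move=> h e; pose m := msize G; pose r := \poly_(i < m) (pihomog mdeg i G).@[v].
have [lt|ge] := ltnP e m; last by rewrite pihomog_large ?meval0.
suff r0 : r = 0 by have := congr1 (fun p : {poly F} => p`_e) r0; rewrite coef0 coef_poly lt.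
apply/eqP; apply: contraT => nr.
have : r * 'X != 0 by rewrite mulf_neq0 ?polyX_eq0.
move/closed_nonrootP => [a]; rewrite rootM negb_or rootX => /andP[/negP ra a0]; case: ra.
have := h a a0; rewrite {1}[G](pihomog_partitionE (mf := mdeg) (leqnn m)) [meval _ _]rmorph_sum => ha.
rewrite /root horner_poly; apply/eqP; rewrite -[RHS]ha; apply: eq_bigr => i _ /=.
have hi : pihomog mdeg i G \is i.-homog by apply: pihomogP.
by rewrite mulrC; apply/esym; exact: mmap_homog_scale hi.
Qed.

End Scaling.

Lemma generic_fold (F : closedFieldType) (charF0 : [pchar F] =i pred0) n q :
  (3 <= n)%N -> (2 <= q)%N -> generic q.+1 (fun f : 'I_n.+1 -> {mpoly F[n.+1]} =>
    ~ dvdr (jac f) ((grad (jac f) *m \adj (diffmx f)) 0 (inord 1))).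
Proof.
move=> n3 q2; have wf := @witness_forms F n q n3 q2.
apply: (@generic_ndvd F n q.+1 (fun f => jac f)
  (fun f => (grad (jac f) *m \adj (diffmx f)) 0 (inord 1)) (n.+1 * q) (@witness F n q) (@base_point F n)).
- exact: polyfam_jac.
- apply: (@polyfam_ext _ _ _ _ _ _ (fun f => \sum_j (jac f)^`M(j) * \adj (diffmx f) j (inord 1))).
    by move=> f _; rewrite [RHS]mxE; apply: eq_bigr => j _; rewrite [grad _ _ _]mxE.
  apply: polyfam_sum => j; apply: polyfamM; first by apply: polyfam_mderiv; apply: polyfam_jac.
  apply: polyfam_adj => i k.
  by apply: polyfam_ext (polyfam_mderiv k (polyfam_form _ _ i)) => f _; rewrite mxE.
- by move=> f hf; exact: (homog_jac hf).
- exact: wf.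
- exact: jac_witness_neq0.
- exact: witness_critical.
- exact: witness_fold.
Qed.

Lemma generic_no_return (F : closedFieldType) (charF0 : [pchar F] =i pred0) n q :
  (3 <= n)%N -> (2 <= q)%N -> generic q.+1 (fun f : 'I_n.+1 -> {mpoly F[n.+1]} =>
    forall k, (2 <= k)%N -> ~ iter_crit_sub f k).
Proof.
move=> n3 q2.
apply: generic_imp (generic_and (generic_nondegenerate F n q) (generic_and
  (generic_smooth charF0 n3 q2) (generic_and (generic_inverse charF0 n3 q2)
  (generic_fold charF0 n3 q2)))).
move=> f hf [nf [smooth [[D [cc [delta [hD hcc cc0 gi nD]]]] fold]]] k k2 hk.
have J0 : jac f != 0.
  apply/eqP => h; apply: fold; exists 0; rewrite mul0r mxE big1 // => j _.
  by rewrite !mxE h mderiv0 mul0r.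
have pJ : primer (jac f).
  by apply: form_prime (homog_jac hf) smooth => //=; [lia | nia].
have [K [phi kerphi]] := prime_quotient_field pJ.
apply: (no_return charF0 n3 q2 hf nf smooth pJ kerphi _ hD hcc cc0 gi nD k2 hk).
apply/eqP => w0; apply: fold; apply/kerphi; rewrite -wedgeE w0 mxE //.
Qed.

Theorem theorem27 (F : closedFieldType) (charF0 : [pchar F] =i pred0)
    (n d : nat) (hn : (3 <= n)%N) (hd : (3 <= d)%N) :
  exists G : {mpoly F[Ncoef n d]},
    (exists e : nat, G \is e.-homog) /\
    (exists f0 : 'I_n.+1 -> {mpoly F[n.+1]},
        isEnd d f0 /\ G.@[coefvec d f0] != 0) /\
    (forall f : 'I_n.+1 -> {mpoly F[n.+1]},
        isEnd d f ->
        (exists k : nat, (2 <= k)%N /\ iter_crit_sub f k) ->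
        G.@[coefvec d f] = 0).
Proof.
have [q [q2 ->]] : exists q, (2 <= q)%N /\ d = q.+1 by exists d.-1; lia.
have [H [H0 hH]] := generic_no_return charF0 hn q2.
have [E [E0 hE]] := generic_nondegenerate F n q.
(* [H] need not be homogeneous. The return condition is invariant under scaling [f], so every
   component of [H] vanishes on the set, and any nonzero one will do. *)
have [e Ge] : exists e, pihomog mdeg e H != 0.
  apply: NNPP => no; case/eqP: H0; rewrite (pihomog_partitionE (mf := mdeg) (leqnn (msize H))).
  by rewrite big1 // => e _; apply/eqP; apply: contraT => h; case: no; exists e.
exists (pihomog mdeg e H); split; first by exists e; apply: pihomogP.
split.
  (* A point where neither this component nor the nondegeneracy condition [E] vanishes supplies
     [f0]. *)
  have [a] := nonzero_eval (mulf_neq0 Ge E0); rewrite mevalM mulf_eq0 negb_or => /andP[Ga Ea].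
  have ea := coefvec_form_of a.
  exists (form_of a); split; last by rewrite (meval_eq _ ea).
  split; first exact: form_of_forms.
  by apply: hE; [exact: form_of_forms | rewrite (meval_eq _ ea)].
move=> f [hf _] [k [k2 hk]]; apply: homog_components_vanish => a a0.
apply/eqP; apply: contraT => Ha; case: (hH (fun i => a *: f i) _ _ k k2).
- by move=> i; apply: dhomogZ.
- apply: contraNneq Ha => h; rewrite -h; apply/eqP/esym; apply: meval_eq => l.
  by rewrite /coefvec mcoeffZ.
exact: iter_crit_sub_scale.
Qed.
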